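(* Let $v\in H^{-1}_{loc}(\mathbb{R})$ be $\pi$-periodic, written as $v=C+Q'$ with $C\in\mathbb{C}$ and $Q\in L^2_{loc}(\mathbb{R})$ $\pi$-periodic with $\int_0^\pi Q\,dx=0$. Let $L(v)$ be the operator in $L^2(\mathbb{R})$ with domain $$D(L(v))=\{y\in H^1(\mathbb{R}):\ y'-Qy\in L^2(\mathbb{R})\cap W^1_{1,loc}(\mathbb{R}),\ \ell_Q(y)\in L^2(\mathbb{R})\},$$ $$L(v)y=\ell_Q(y):=-(y'-Qy)'-Qy'+Cy.$$ Then: (a) $D(L(v))$ is dense in $L^2(\mathbb{R})$; (b) $L(v)$ is closed and $(L(v))^*=L(\overline{v})$ (in particular, if $v$ is real-valued, $L(v)$ is self-adjoint); (c) the spectrum $Sp(L(v))$ is continuous, and $$Sp(L(v))=\{\lambda\in\mathbb{C}:\ \exists\,\theta\in[0,2\pi)\ \text{with}\ \Delta(\lambda)=2\cos\theta\}.$$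
   Context: $H^{-1}_{loc}(\mathbb{R})$: distributions $v$ such that for every $T>0$ there is $C(T)$ with $|\langle v,\varphi\rangle|\le C(T)(\int_{-T}^T|\varphi|^2+|\varphi'|^2)^{1/2}$ for all smooth $\varphi$ supported in $[-T,T]$; $v$ is $\pi$-periodic if $\langle v,\varphi(x)\rangle=\langle v,\varphi(x-\pi)\rangle$ for all test functions. Every such $v$ has a unique representation $v=C+Q'$ as stated. $\overline{v}=\overline{C}+\overline{Q}'$. $W^1_{1,loc}(\mathbb{R})$ denotes locally absolutely continuous functions. Lyapunov function: for $\lambda\in\mathbb{C}$ let $(y_1(x;\lambda),u_1(x;\lambda))$ and $(y_2(x;\lambda),u_2(x;\lambda))$ be the (locally absolutely continuous) solutions of $y'=Qy+u$, $u'=(C-\lambda-Q^2)y-Qu$ with $(y_1,u_1)(0)=(1,0)$, $(y_2,u_2)(0)=(0,1)$, and set $\Delta(\lambda)=y_1(\pi;\lambda)+u_2(\pi;\lambda)$ (an entire function of $\lambda$). *)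

(* Defs.v *)
(* MathComp + MathComp-Analysis (R : realType), complex numbers R[i]
   from mathcomp-real-closed.  Complex-valued functions on R are handled
   through their real and imaginary parts; "L^2 elements" are represented by
   measurable functions, equality in L^2 is a.e. equality w.r.t. Lebesgue
   measure. *)
From mathcomp Require Import all_boot all_order all_algebra.
From mathcomp Require Import all_classical all_reals all_analysis.
From mathcomp.real_closed Require Import complex.
Set Implicit Arguments.
Unset Strict Implicit.
Unset Printing Implicit Defensive.
Import Order.TTheory GRing.Theory Num.Theory.
Import numFieldNormedType.Exports.
Local Open Scope classical_set_scope.
Local Open Scope ring_scope.

Section Hill.
Context {R : realType}.
Local Notation C := (R[i]).
Local Notation mu := (@lebesgue_measure R).

Definition cRe (z : C) : R := complex.Re z.
Definition cIm (z : C) : R := complex.Im z.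

(* |z|^2 *)
Definition sqmod (z : C) : R := cRe z ^+ 2 + cIm z ^+ 2.

(* closed interval [a,b] as a set *)
Definition itv (a b : R) : set R := [set x | a <= x <= b].

(* measurability of a complex-valued function (componentwise) *)
Definition cmeasurable (f : R -> C) : Prop :=
  measurable_fun setT (cRe \o f) /\ measurable_fun setT (cIm \o f).

(* f in L^2(R) *)
Definition L2 (f : R -> C) : Prop :=
  cmeasurable f /\ (\int[mu]_x (sqmod (f x))%:E < +oo)%E.

(* f in L^2_loc(R) *)
Definition L2loc (f : R -> C) : Prop :=
  cmeasurable f /\
  forall a b : R, (\int[mu]_(x in itv a b) (sqmod (f x))%:E < +oo)%E.

(* f in L^1_loc(R) *)
Definition L1loc (f : R -> C) : Prop :=
  cmeasurable f /\
  forall a b : R, (\int[mu]_(x in itv a b) (Num.sqrt (sqmod (f x)))%:E < +oo)%E.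

(* Lebesgue integral of a complex-valued function over D *)
Definition cint (D : set R) (f : R -> C) : C :=
  Complex (Rintegral mu D (cRe \o f)) (Rintegral mu D (cIm \o f)).

(* equality almost everywhere *)
Definition ae_eq (f g : R -> C) : Prop := {ae mu, forall x, f x = g x}.

(* y is locally absolutely continuous (y in W^1_{1,loc}) with derivative g
   (a.e.), i.e. g in L^1_loc and y(b) - y(a) = int_a^b g for all a <= b. *)
Definition ACd (y g : R -> C) : Prop :=
  L1loc g /\ forall a b : R, a <= b -> y b - y a = cint (itv a b) g.

(* y in H^1(R), with (weak) derivative g *)
Definition H1 (y g : R -> C) : Prop := L2 y /\ L2 g /\ ACd y g.

(* L^2 inner product and norm *)
Definition l2inner (f g : R -> C) : C := cint setT (fun x => f x * (g x)^*).
Definition l2norm (f : R -> C) : R := Num.sqrt (Rintegral mu setT (sqmod \o f)).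

(* Graph of the operator L(v), v = Cc + Q':  (y, f) with y in D(L(v)) and
   f = L(v) y, both taken up to a.e. equality.  Here yt is the continuous
   representative of y, g = yt', p is the W^1_{1,loc} representative of
   y' - Q y and p' its derivative, so that l_Q(y) = - p' - Q y' + Cc y. *)
Definition graphL (Cc : C) (Q : R -> C) (y f : R -> C) : Prop :=
  L2 y /\ L2 f /\
  exists yt g p p' : R -> C,
    [/\ ae_eq y yt /\ H1 yt g,
        ae_eq p (fun x => g x - Q x * yt x) /\ L2 p, ACd p p',
        L2 (fun x => - p' x - Q x * g x + Cc * yt x) &
        ae_eq f (fun x => - p' x - Q x * g x + Cc * yt x)].

(* domain D(L(v)) *)
Definition domL (Cc : C) (Q : R -> C) (y : R -> C) : Prop :=
  exists f, graphL Cc Q y f.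

(* graph of the adjoint operator L(v)^* *)
Definition adjgraphL (Cc : C) (Q : R -> C) (z w : R -> C) : Prop :=
  L2 z /\ L2 w /\
  forall y f, graphL Cc Q y f -> l2inner f z = l2inner y w.

(* L(v) is a closed operator: its graph is closed in L^2 x L^2 *)
Definition closedL (Cc : C) (Q : R -> C) : Prop :=
  forall (ys fs : nat -> R -> C) (y f : R -> C),
    (forall n, graphL Cc Q (ys n) (fs n)) -> L2 y -> L2 f ->
    l2norm (fun x => ys n x - y x) @[n --> \oo] --> (0 : R) ->
    l2norm (fun x => fs n x - f x) @[n --> \oo] --> (0 : R) ->
    graphL Cc Q y f.

(* lam is in the resolvent set: L(v) - lam is a bijection of D(L(v)) onto
   L^2 (up to a.e. equality) with bounded inverse *)
Definition resolventL (Cc : C) (Q : R -> C) (lam : C) : Prop :=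
  [/\ (forall y f, graphL Cc Q y f ->
         ae_eq (fun x => f x - lam * y x) (fun=> 0) -> ae_eq y (fun=> 0)),
      (forall h, L2 h -> exists y f, graphL Cc Q y f /\
         ae_eq (fun x => f x - lam * y x) h) &
      exists M : R, forall y f, graphL Cc Q y f ->
         l2norm y <= M * l2norm (fun x => f x - lam * y x)].

Definition spectrumL (Cc : C) (Q : R -> C) (lam : C) : Prop :=
  ~ resolventL Cc Q lam.

(* lam belongs to the continuous spectrum: lam in the spectrum, L(v) - lam
   injective with dense range *)
Definition cont_spectrumL (Cc : C) (Q : R -> C) (lam : C) : Prop :=
  [/\ spectrumL Cc Q lam,
      (forall y f, graphL Cc Q y f ->
         ae_eq (fun x => f x - lam * y x) (fun=> 0) -> ae_eq y (fun=> 0)) &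
      (forall h, L2 h -> forall eps : R, 0 < eps -> exists y f,
         graphL Cc Q y f /\ l2norm (fun x => f x - lam * y x - h x) < eps)].

(* solutions of y' = Q y + u, u' = (Cc - lam - Q^2) y - Q u *)
Definition ode_sol (Cc : C) (Q : R -> C) (lam : C) (y u : R -> C) : Prop :=
  ACd y (fun x => Q x * y x + u x) /\
  ACd u (fun x => (Cc - lam - Q x ^+ 2) * y x - Q x * u x).

(* Lyapunov function Delta(lam) = y1(pi) + u2(pi) *)
Definition Lyapunov (Cc : C) (Q : R -> C) (lam : C) : C :=
  xget 0 [set d | exists y1 u1 y2 u2 : R -> C,
    [/\ ode_sol Cc Q lam y1 u1, ode_sol Cc Q lam y2 u2,
        y1 0 = 1 /\ u1 0 = 0, y2 0 = 0 /\ u2 0 = 1 &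
        d = y1 pi + u2 pi]].

End Hill.

(* Main.v *)
Require Import Defs.
From mathcomp Require Import all_boot all_order all_algebra.
From mathcomp Require Import all_classical all_reals all_analysis.
From mathcomp.real_closed Require Import complex.
From mathcomp Require Import ring lra measurable_realfun.
Import Order.TTheory GRing.Theory Num.Theory.
Import numFieldNormedType.Exports.
Local Open Scope classical_set_scope.
Local Open Scope ring_scope.
Set Implicit Arguments.
Unset Strict Implicit.
Unset Printing Implicit Defensive.

(* With [u = y' - Q y], the equation [(L(v) - lam) y = h] is a first order system
   whose monodromy matrix over one period has determinant 1 and trace
   [Delta(lam)]; its multipliers are [r] and [r^-1] with [r + r^-1 = Delta(lam)],
   and [|r| = 1] exactly when [Delta(lam) = 2 cos theta].

   If [|r| < 1], the two Floquet solutions decay exponentially, one at each end,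
   and variation of constants gives a resolvent, bounded on L^2 by a weighted
   energy estimate.  If [|r| = 1], a solution of the homogeneous system which is
   square integrable on a half-line is 0; hence [L(v) - lam] is injective for every
   [lam], and for [|r| = 1] it is not onto, since a preimage of [1_[0,pi] conj(phi)],
   with [phi] a homogeneous solution, would vanish outside [0, pi], and Lagrange's
   identity would force [int_0^pi |phi|^2 = 0].

   An energy estimate over one period gives [|r| < 1] for [lam = C - K] with [K]
   large, so some [L(v) - lam] is onto.  As [L(v)] is symmetric for the bilinear
   pairing [int f g], this identifies its adjoint with the conjugate operator;
   being an adjoint, [L(v)] is closed.  A function orthogonal to the range of
   [L(v) - lam] (to the domain of [L(v)]) yields an eigenfunction (an element
   [(0, g)] of the graph), hence is 0, which gives both density statements. *)

(** * Complex-valued integrable functions *)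

(** Two features of [Q] shape the proof. It is only in L^2_loc, so the coefficient [Q^2] of the
    system is only in L^1_loc: solutions need not be differentiable everywhere, and the product and
    chain rules are drawn from the integral form of absolute continuity. It also need not be
    bounded, so [y] and [u] in L^2 do not give [y' = Q y + u] in L^2, as membership in the domain
    demands. The size of the Floquet solutions is therefore measured by [exp(S)] with [S']
    proportional to [1 + |Q|^2], not by [exp(c x)]; the energy estimate then carries the weight
    [1 + |Q|^2] and controls [y], [u] and [Q y] together. The same obstacle decides how large [K]
    must be: the form [int |y'|^2 + K |y|^2] is perturbed by a term that costs [int |Q|^2 |y|^2],
    and this is absorbed by bounding [sup |y|^2] by a small multiple of [int |y'|^2] plus a multiple
    of [int |y|^2]. The pairing [int f g] carries no conjugation because [v] is complex: [L(v)] is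
    symmetric for it whether or not it is self-adjoint. *)

Section ComplexIntegral.
Context {R : realType}.
Local Notation C := (R[i]).
Local Notation mu := (@lebesgue_measure R).
Implicit Types (f g : R -> C) (z w : C) (D : set R).

(** The sum norm stands in for the modulus: it is submultiplicative and passes under the integral
    component by component, with constant 1 and without square roots. [sqmod_n1] and [n1_sqmod]
    convert to the modulus. *)
Definition n1 z : R := `|cRe z| + `|cIm z|.

Lemma cReD z w : cRe (z + w) = cRe z + cRe w. Proof. by case: z; case: w. Qed.
Lemma cImD z w : cIm (z + w) = cIm z + cIm w. Proof. by case: z; case: w. Qed.
Lemma cReN z : cRe (- z) = - cRe z. Proof. by case: z. Qed.
Lemma cImN z : cIm (- z) = - cIm z. Proof. by case: z. Qed.
Lemma cReM z w : cRe (z * w) = cRe z * cRe w - cIm z * cIm w.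
Proof. by case: z; case: w. Qed.
Lemma cImM z w : cIm (z * w) = cRe z * cIm w + cIm z * cRe w.
Proof. by case: z; case: w. Qed.
Lemma cReJ z : cRe z^* = cRe z. Proof. by case: z. Qed.
Lemma cImJ z : cIm z^* = - cIm z. Proof. by case: z. Qed.
Lemma cRe_real (r : R) : cRe (real_complex R r) = r. Proof. by []. Qed.
Lemma cIm_real (r : R) : cIm (real_complex R r) = 0. Proof. by []. Qed.
Lemma cRe0 : cRe (0 : C) = 0. Proof. by []. Qed.
Lemma cIm0 : cIm (0 : C) = 0. Proof. by []. Qed.
Lemma cRe1 : cRe (1 : C) = 1. Proof. by []. Qed.
Lemma cIm1 : cIm (1 : C) = 0. Proof. by []. Qed.
Definition cReImE := (cReD, cImD, cReN, cImN, cReM, cImM, cReJ, cImJ, cRe_real,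
  cIm_real, cRe0, cIm0, cRe1, cIm1).

Lemma ceq z w : cRe z = cRe w -> cIm z = cIm w -> z = w.
Proof. by case: z => a b; case: w => c d /= -> ->. Qed.

Lemma n1_ge0 z : 0 <= n1 z. Proof. exact: addr_ge0. Qed.

Lemma n1D z w : n1 (z + w) <= n1 z + n1 w.
Proof.
rewrite /n1 !cReImE.
by rewrite addrACA lerD// ler_normD.
Qed.

Lemma n1N z : n1 (- z) = n1 z. Proof. by rewrite /n1 !cReImE !normrN. Qed.

Lemma n1B z w : n1 (z - w) <= n1 z + n1 w.
Proof. by rewrite (le_trans (n1D _ _))// n1N. Qed.

Lemma n1BC z w : n1 (z - w) = n1 (w - z). Proof. by rewrite -n1N opprB. Qed.

Lemma n1M z w : n1 (z * w) <= n1 z * n1 w.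
Proof.
rewrite /n1 !cReImE mulrDl !mulrDr -!normrM.
have := ler_normB (cRe z * cRe w) (cIm z * cIm w).
have := ler_normD (cRe z * cIm w) (cIm z * cRe w).
lra.
Qed.

Lemma n10 : n1 (0 : C) = 0. Proof. by rewrite /n1 !cReImE normr0 addr0. Qed.

Lemma n1_eq0 z : n1 z <= 0 -> z = 0.
Proof.
rewrite /n1 => h; have h1 := normr_ge0 (cRe z); have h2 := normr_ge0 (cIm z).
apply: ceq; apply/normr0_eq0; rewrite ?cReImE; lra.
Qed.

Lemma n1_real (r : R) : n1 (real_complex R r) = `|r|.
Proof. by rewrite /n1 !cReImE normr0 addr0. Qed.

Lemma cRe_n1 z : `|cRe z| <= n1 z. Proof. by rewrite lerDl. Qed.
Lemma cIm_n1 z : `|cIm z| <= n1 z. Proof. by rewrite lerDr. Qed.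

Lemma conj_funK f : (fun x => ((f x)^*)^*) = f.
Proof. by apply/funext => x; rewrite conjCK. Qed.

Lemma sqmod_ge0 z : 0 <= sqmod z. Proof. by rewrite addr_ge0// sqr_ge0. Qed.

Lemma sqmodM z w : sqmod (z * w) = sqmod z * sqmod w.
Proof. rewrite /sqmod !cReImE; ring. Qed.

Lemma sqmodN z : sqmod (- z) = sqmod z.
Proof. by rewrite /sqmod !cReImE !sqrrN. Qed.

Lemma sqmodJ z : sqmod z^* = sqmod z.
Proof. by rewrite /sqmod !cReImE !sqrrN. Qed.

Lemma sqmodBC z w : sqmod (z - w) = sqmod (w - z).
Proof. by rewrite -sqmodN opprB. Qed.

Lemma sqmod0 : sqmod (0 : C) = 0.
Proof. by rewrite /sqmod !cReImE expr0n addr0. Qed.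

Lemma sqmod1 : sqmod (1 : C) = 1.
Proof. by rewrite /sqmod !cReImE expr0n addr0 expr1n. Qed.

Lemma sqmod_eq0 z : sqmod z = 0 -> z = 0.
Proof.
move/eqP; rewrite paddr_eq0 ?sqr_ge0// !sqrf_eq0 => /andP[/eqP h1 /eqP h2].
exact: ceq.
Qed.

Lemma mulJ_sqmod z : z * z^* = real_complex R (sqmod z).
Proof. by apply: ceq; rewrite /sqmod !cReImE; ring. Qed.

Lemma sqmodD_le z w : sqmod (z + w) <= 2 * sqmod z + 2 * sqmod w.
Proof.
rewrite /sqmod !cReImE.
have := sqr_ge0 (cRe z - cRe w); have := sqr_ge0 (cIm z - cIm w); lra.
Qed.

Lemma sqmodB_le z w : sqmod (z - w) <= 2 * sqmod z + 2 * sqmod w.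
Proof. by rewrite -(sqmodN w) sqmodD_le. Qed.

Lemma sqmod_n1 z : sqmod z <= n1 z ^+ 2.
Proof.
rewrite /sqmod /n1 sqrrD !real_normK ?num_real//.
have := mulr_ge0 (normr_ge0 (cRe z)) (normr_ge0 (cIm z)); lra.
Qed.

Lemma n1_sqmod z : n1 z ^+ 2 <= 2 * sqmod z.
Proof.
rewrite /sqmod /n1; have := sqr_ge0 (`|cRe z| - `|cIm z|).
rewrite sqrrB sqrrD !real_normK ?num_real//; lra.
Qed.

Lemma sqrt_sqmod_n1 z : Num.sqrt (sqmod z) <= n1 z.
Proof. by rewrite -[leRHS]ger0_norm ?n1_ge0// -sqrtr_sqr ler_wsqrtr// sqmod_n1. Qed.

Lemma measurable_sqrt : measurable_fun setT (@Num.sqrt R).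
Proof. by apply: continuous_measurable_fun; exact: sqrt_continuous. Qed.

Lemma cRe_sqrt z : `|cRe z| <= Num.sqrt (sqmod z).
Proof. by rewrite -sqrtr_sqr ler_wsqrtr// lerDl sqr_ge0. Qed.

Lemma cIm_sqrt z : `|cIm z| <= Num.sqrt (sqmod z).
Proof. by rewrite -sqrtr_sqr ler_wsqrtr// lerDr sqr_ge0. Qed.

Lemma eq_cmeasurable f g : f =1 g -> cmeasurable f -> cmeasurable g.
Proof. by move=> /funext ->. Qed.

Lemma cmeas_cst z : cmeasurable (fun=> z).
Proof. by split; exact: measurable_cst. Qed.

Lemma cmeasD f g : cmeasurable f -> cmeasurable g ->
  cmeasurable (fun x => f x + g x).
Proof.
move=> [f1 f2] [g1 g2]; split.
- rewrite (_ : _ \o _ = (cRe \o f) \+ (cRe \o g)); last by apply/funext => x /=; rewrite cReD.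
  exact: measurable_funD.
- rewrite (_ : _ \o _ = (cIm \o f) \+ (cIm \o g)); last by apply/funext => x /=; rewrite cImD.
  exact: measurable_funD.
Qed.

Lemma cmeasM f g : cmeasurable f -> cmeasurable g ->
  cmeasurable (fun x => f x * g x).
Proof.
move=> [f1 f2] [g1 g2]; split.
- rewrite (_ : _ \o _ = ((cRe \o f) \* (cRe \o g)) \- ((cIm \o f) \* (cIm \o g))).
    by apply: measurable_funB; exact: measurable_funM.
  by apply/funext => x /=; rewrite cReM.
- rewrite (_ : _ \o _ = ((cRe \o f) \* (cIm \o g)) \+ ((cIm \o f) \* (cRe \o g))).
    by apply: measurable_funD; exact: measurable_funM.
  by apply/funext => x /=; rewrite cImM.
Qed.

Lemma cmeasJ f : cmeasurable f -> cmeasurable (fun x => (f x)^*).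
Proof.
move=> [f1 f2]; split.
- by rewrite (_ : _ \o _ = cRe \o f)//; apply/funext => x /=; rewrite cReJ.
- rewrite (_ : _ \o _ = \- (cIm \o f)); last by apply/funext => x /=; rewrite cImJ.
  exact: measurable_funN.
Qed.

Lemma cmeasZ z f : cmeasurable f -> cmeasurable (fun x => z * f x).
Proof. by move=> mf; apply: cmeasM => //; exact: cmeas_cst. Qed.

Lemma cmeasN f : cmeasurable f -> cmeasurable (fun x => - f x).
Proof.
move=> mf; apply: (@eq_cmeasurable (fun x => -1 * f x)); last exact: cmeasZ.
by move=> x; rewrite mulN1r.
Qed.

Lemma cmeasB f g : cmeasurable f -> cmeasurable g ->
  cmeasurable (fun x => f x - g x).
Proof. by move=> mf mg; apply: cmeasD => //; exact: cmeasN. Qed.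

Lemma cmeas_real (h : R -> R) : measurable_fun setT h ->
  cmeasurable (fun x => real_complex R (h x)).
Proof. by move=> mh; split => //; exact: measurable_cst. Qed.

Lemma meas_n1 f : cmeasurable f -> measurable_fun setT (n1 \o f).
Proof.
by move=> [mf1 mf2]; apply: measurable_funD; apply: measurableT_comp.
Qed.

Lemma meas_sqmod f : cmeasurable f -> measurable_fun setT (sqmod \o f).
Proof.
by move=> [mf1 mf2]; apply: measurable_funD; exact: measurable_funX.
Qed.

Lemma meas_itv (a b : R) : measurable (itv a b).
Proof. by rewrite (_ : itv a b = `[a, b]%classic)//; exact: measurable_itv. Qed.

Lemma cmeas_indic D f : measurable D -> cmeasurable f ->
  cmeasurable (fun x => real_complex R (\1_D x) * f x).
Proof. by move=> mD mf; apply: cmeasM => //; apply: cmeas_real. Qed.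

Local Notation ig D h := (mu.-integrable D (EFin \o (h : R -> R))).

Lemma ig_dom D (h k : R -> R) : measurable D -> measurable_fun setT h ->
  (forall x, D x -> `|h x| <= k x) -> ig D k -> ig D h.
Proof.
move=> mD mh hk; apply: le_integrable => //.
  by apply/measurable_EFinP; exact: measurable_funTS.
by move=> x Dx /=; rewrite lee_fin (le_trans (hk x Dx))// ler_norm.
Qed.

Lemma eq_ig D (h k : R -> R) : h =1 k -> ig D h -> ig D k.
Proof. by move=> /funext ->. Qed.

Lemma igD D (h k : R -> R) : measurable D -> ig D h -> ig D k ->
  ig D (fun x => h x + k x).
Proof. by move=> mD ih ik; exact: (integrableD _ ih ik). Qed.

Lemma igZ D r (h : R -> R) : measurable D -> ig D h -> ig D (fun x => r * h x).
Proof. by move=> mD ih; exact: (integrableZl _ _ ih). Qed.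

Lemma igB D (h k : R -> R) : measurable D -> ig D h -> ig D k ->
  ig D (fun x => h x - k x).
Proof. by move=> mD ih ik; exact: (integrableB _ ih ik). Qed.

Lemma ig_norm D (h : R -> R) : measurable D -> ig D h -> ig D (fun x => `|h x|).
Proof. by move=> mD ih; exact: (integrable_norm ih). Qed.

Lemma igS D E (h : R -> R) : measurable D -> measurable E -> E `<=` D ->
  ig D h -> ig E h.
Proof. by move=> mD mE ED; exact: integrableS. Qed.

Lemma mu_itv (a b : R) : mu (itv a b) = if a < b then (b - a)%:E else 0%E.
Proof.
rewrite (_ : itv a b = `[a, b]%classic)//.
by rewrite lebesgue_measure_itv/= lte_fin EFinB.
Qed.

Lemma ig_cst a b (r : R) : ig (itv a b) (fun=> r).
Proof.
apply: measurable_bounded_integrable; first exact: meas_itv.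
- have h : (mu (itv a b) < +oo)%E by rewrite mu_itv; case: ifP => _; rewrite ltry.
  exact: h.
- exact: measurable_cst.
- by exists `|r|; split; [exact: num_real | move=> M hM x _ /=; exact: ltW].
Qed.

Lemma ae_imp (P Q : R -> Prop) : (forall x, P x -> Q x) ->
  {ae mu, forall x, P x} -> {ae mu, forall x, Q x}.
Proof. by move=> PQ [N [mN N0 sN]]; exists N; split => // x nQ; apply: sN => /PQ. Qed.

Lemma ae_and (P Q : R -> Prop) : {ae mu, forall x, P x} ->
  {ae mu, forall x, Q x} -> {ae mu, forall x, P x /\ Q x}.
Proof.
move=> hP hQ; rewrite /prop_near1 /nbhs /= /almost_everywhere.
rewrite (_ : ~` _ = ~` [set x | P x] `|` ~` [set x | Q x]); last by rewrite -setCI.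
exact: negligibleU.
Qed.

Lemma ae_all (P : R -> Prop) : (forall x, P x) -> {ae mu, forall x, P x}.
Proof.
move=> aP; exists set0; split => //; rewrite ?measure0//.
by move=> x /=; apply: contra_notP => _; exact: aP.
Qed.

Lemma ig_ae D (h k : R -> R) : measurable D -> measurable_fun setT k ->
  {ae mu, forall x, h x = k x} -> ig D h -> ig D k.
Proof.
move=> mD mk hk /integrableP[mh ih]; apply/integrableP; split.
  by apply/measurable_EFinP; exact: measurable_funTS.
rewrite (le_lt_trans _ ih)//; apply: ae_ge0_le_integral => //=.
- apply/measurable_EFinP; apply: measurableT_comp => //; exact: measurable_funTS.
- apply/measurable_EFinP; apply: measurableT_comp => //; exact/measurable_EFinP.
- by apply: ae_imp hk => x /= hx Dx; rewrite hx.
Qed.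

Lemma RI_ae D (h k : R -> R) : measurable D -> measurable_fun setT h ->
  measurable_fun setT k -> {ae mu, forall x, h x = k x} ->
  Rintegral mu D h = Rintegral mu D k.
Proof.
move=> mD mh mk hk; congr fine; apply: ae_eq_integral => //.
- by apply/measurable_EFinP; exact: measurable_funTS.
- by apply/measurable_EFinP; exact: measurable_funTS.
- by apply: ae_imp hk => x /= hx Dx; rewrite hx.
Qed.

Lemma ge0_ig D (h : R -> R) : measurable D -> measurable_fun setT h ->
  (forall x, 0 <= h x) -> ((\int[mu]_(x in D) (h x)%:E < +oo)%E <-> ig D h).
Proof.
move=> mD mh h0; split => [hoo|].
  apply/integrableP; split; first by apply/measurable_EFinP; exact: measurable_funTS.
  by under eq_integral do rewrite /= ger0_norm//.
by move=> /integrableP[_]; under eq_integral do rewrite /= ger0_norm//.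
Qed.

Lemma RI_le D (h k : R -> R) : measurable D -> ig D h -> ig D k ->
  (forall x, D x -> h x <= k x) -> Rintegral mu D h <= Rintegral mu D k.
Proof. by move=> mD ih ik hk; apply: le_Rintegral. Qed.

Lemma RI_subset D E (h : R -> R) : measurable D -> measurable E -> E `<=` D ->
  measurable_fun setT h -> (forall x, 0 <= h x) -> ig D h ->
  Rintegral mu E h <= Rintegral mu D h.
Proof.
move=> mD mE ED mh h0 ih; rewrite fine_le//.
- exact/integrable_fin_num/igS/ih.
- exact/integrable_fin_num/ih.
apply: ge0_subset_integral => //.
  by apply/measurable_EFinP; exact: measurable_funTS.
by move=> x _; rewrite lee_fin.
Qed.

Lemma RI_split (a c b : R) (h : R -> R) : a <= c -> c <= b ->
  ig (itv a b) h ->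
  Rintegral mu (itv a b) h = Rintegral mu (itv a c) h + Rintegral mu (itv c b) h.
Proof.
move=> ac cb ih; have := @Rintegral_itvB _ h (BLeft a) (BRight b) c ih.
rewrite !bnd_simp => /(_ ac cb) /eqP; rewrite subr_eq => /eqP e1.
rewrite [LHS]e1.
rewrite (Rintegral_itv_obnd_cbnd (r := c) (b := BRight b)); first by rewrite addrC.
apply: igS ih; [exact: meas_itv|exact: measurable_itv|].
move=> x /=; rewrite in_itv/= => /andP[cx xb].
by rewrite /itv/= xb (le_trans ac (ltW cx)).
Qed.

Lemma itv_set0 (a b : R) : b < a -> itv a b = set0.
Proof.
move=> ba; apply/seteqP; split => x //= /andP[ax xb].
by have := lt_le_trans ba (le_trans ax xb); rewrite ltxx.
Qed.

Lemma itv1 (a : R) : itv a a = [set a].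
Proof.
apply/seteqP; split => x /=; last by move=> ->; apply/andP.
by move=> /andP[ax xa]; apply/eqP; rewrite eq_le xa.
Qed.

Lemma itv_sub (a b c d : R) : c <= a -> b <= d -> itv a b `<=` itv c d.
Proof.
by move=> ca bd x /= /andP[ax xb]; rewrite /itv/= (le_trans ca ax) (le_trans xb bd).
Qed.

Lemma RI_itv1 a (h : R -> R) : Rintegral mu (itv a a) h = 0.
Proof. by rewrite itv1 Rintegral_set1. Qed.

Lemma RI_cst (a b r : R) : a <= b -> Rintegral mu (itv a b) (fun=> r) = r * (b - a).
Proof.
move=> ab; rewrite Rintegral_cst; last exact: meas_itv.
have -> : fine (mu (itv a b)) = if a < b then b - a else 0 by rewrite mu_itv; case: ifP.
congr (_ * _); case: ltP => //= ba.
by have -> : a = b; [apply/eqP; rewrite eq_le ab|rewrite subrr].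
Qed.

Definition cig D f := ig D (cRe \o f) /\ ig D (cIm \o f).

Lemma cig_dom D f (k : R -> R) : measurable D -> cmeasurable f ->
  (forall x, D x -> n1 (f x) <= k x) -> ig D k -> cig D f.
Proof.
move=> mD [m1 m2] fk ik; split; apply: ig_dom ik => // x Dx /=.
- exact: le_trans (cRe_n1 _) (fk x Dx).
- exact: le_trans (cIm_n1 _) (fk x Dx).
Qed.

Lemma cig_n1 D f : measurable D -> cig D f -> ig D (n1 \o f).
Proof. by move=> mD [i1 i2]; apply: igD => //; exact: ig_norm. Qed.

Lemma cigD D f g : measurable D -> cig D f -> cig D g -> cig D (fun x => f x + g x).
Proof.
move=> mD [f1 f2] [g1 g2]; split.
- by apply: (eq_ig _ (igD mD f1 g1)) => x /=; rewrite cReD.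
- by apply: (eq_ig _ (igD mD f2 g2)) => x /=; rewrite cImD.
Qed.

Lemma cigZ D z f : measurable D -> cig D f -> cig D (fun x => z * f x).
Proof.
move=> mD [f1 f2]; split.
- apply: (eq_ig _ (igB mD (igZ (cRe z) mD f1) (igZ (cIm z) mD f2))).
  by move=> x /=; rewrite cReM.
- apply: (eq_ig _ (igD mD (igZ (cRe z) mD f2) (igZ (cIm z) mD f1))).
  by move=> x /=; rewrite cImM.
Qed.

Lemma cigN D f : measurable D -> cig D f -> cig D (fun x => - f x).
Proof.
move=> mD /(cigZ (-1) mD); rewrite (_ : (fun x => _) = (fun x => - f x))//.
by apply/funext => x; rewrite mulN1r.
Qed.

Lemma cigB D f g : measurable D -> cig D f -> cig D g -> cig D (fun x => f x - g x).
Proof. by move=> mD cf cg; apply: cigD => //; exact: cigN. Qed.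

Lemma cigJ D f : measurable D -> cig D f -> cig D (fun x => (f x)^*).
Proof.
move=> mD [f1 f2]; split.
- by apply: (eq_ig _ f1) => x /=; rewrite cReJ.
- by apply: (eq_ig _ (igZ (-1) mD f2)) => x /=; rewrite cImJ mulN1r.
Qed.

Lemma cig_ae D f g : measurable D -> cmeasurable g -> Defs.ae_eq f g ->
  cig D f -> cig D g.
Proof.
move=> mD [m1 m2] fg [f1 f2]; split.
- by apply: ig_ae f1 => //; apply: ae_imp fg => x /= ->.
- by apply: ig_ae f2 => //; apply: ae_imp fg => x /= ->.
Qed.

Lemma eq_cint D f g : (forall x, D x -> f x = g x) -> cint D f = cint D g.
Proof.
by move=> fg; congr Complex; apply: eq_Rintegral => x /set_mem Dx /=; rewrite fg.
Qed.

Lemma cint_ae D f g : measurable D -> cmeasurable f -> cmeasurable g ->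
  Defs.ae_eq f g -> cint D f = cint D g.
Proof.
move=> mD [f1 f2] [g1 g2] fg; congr Complex; apply: RI_ae => //.
- by apply: ae_imp fg => x /= ->.
- by apply: ae_imp fg => x /= ->.
Qed.

Lemma cintD D f g : measurable D -> cig D f -> cig D g ->
  cint D (fun x => f x + g x) = cint D f + cint D g.
Proof.
move=> mD [f1 f2] [g1 g2]; apply: ceq; rewrite cReImE /= -RintegralD//;
by apply: eq_Rintegral => x _ /=; rewrite !cReImE.
Qed.

Lemma cintZ D z f : measurable D -> cig D f ->
  cint D (fun x => z * f x) = z * cint D f.
Proof.
move=> mD [f1 f2]; apply: ceq; rewrite cReImE /= -!RintegralZl//.
- rewrite -RintegralB//; [|exact: igZ|exact: igZ].
  by apply: eq_Rintegral => x _ /=; rewrite !cReImE.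
- rewrite -RintegralD//; [|exact: igZ|exact: igZ].
  by apply: eq_Rintegral => x _ /=; rewrite !cReImE.
Qed.

Lemma cintN D f : measurable D -> cig D f -> cint D (fun x => - f x) = - cint D f.
Proof.
move=> mD cf; rewrite -mulN1r -cintZ//.
by apply: eq_cint => x _; rewrite mulN1r.
Qed.

Lemma cintB D f g : measurable D -> cig D f -> cig D g ->
  cint D (fun x => f x - g x) = cint D f - cint D g.
Proof. by move=> mD cf cg; rewrite cintD ?cintN//; exact: cigN. Qed.

Lemma cintJ D f : measurable D -> cig D f -> cint D (fun x => (f x)^*) = (cint D f)^*.
Proof.
move=> mD [f1 f2]; apply: ceq; rewrite cReImE /=.
- by apply: eq_Rintegral => x _ /=; rewrite cReJ.
- rewrite -mulN1r -RintegralZl//.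
  by apply: eq_Rintegral => x _ /=; rewrite cImJ mulN1r.
Qed.

Lemma cint0 D f : (forall x, D x -> f x = 0) -> cint D f = 0.
Proof.
move=> f0; rewrite (eq_cint f0); apply: ceq;
by rewrite /cint /= /Rintegral integral0_eq.
Qed.

Lemma n1_cint D f : measurable D -> cig D f ->
  n1 (cint D f) <= Rintegral mu D (n1 \o f).
Proof.
move=> mD [f1 f2]; rewrite /n1 /=.
have -> : Rintegral mu D (n1 \o f) =
    Rintegral mu D (fun x => `|(cRe \o f) x|) + Rintegral mu D (fun x => `|(cIm \o f) x|).
  by rewrite -RintegralD//; exact: ig_norm.
by apply: lerD; exact: le_normr_Rintegral.
Qed.

Lemma n1_cint_le D f (k : R -> R) : measurable D -> cig D f -> ig D k ->
  (forall x, D x -> n1 (f x) <= k x) -> n1 (cint D f) <= Rintegral mu D k.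
Proof.
move=> mD cf ik fk; apply: (le_trans (n1_cint mD cf)).
by apply: RI_le => //; exact: cig_n1.
Qed.

Lemma cint_split (a c b : R) f : a <= c -> c <= b -> cig (itv a b) f ->
  cint (itv a b) f = cint (itv a c) f + cint (itv c b) f.
Proof. by move=> ac cb [f1 f2]; apply: ceq; rewrite cReImE /=; exact: RI_split. Qed.

Lemma cint_itv1 a f : cint (itv a a) f = 0.
Proof. by apply: ceq; rewrite /= RI_itv1. Qed.

Lemma cint_set0 f : cint set0 f = 0.
Proof. by apply: ceq; rewrite /= Rintegral_set0. Qed.

Lemma cint_real D (h : R -> R) : cint D (fun x => real_complex R (h x)) =
  real_complex R (Rintegral mu D h).
Proof. by apply: ceq; rewrite /cint //= /Rintegral integral0. Qed.

Lemma L1locP f : L1loc f <-> cmeasurable f /\ forall a b, cig (itv a b) f.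
Proof.
split => -[mf h]; split => // a b.
- have ms : measurable_fun setT (fun x => Num.sqrt (sqmod (f x))).
    by apply: (measurableT_comp measurable_sqrt); exact: meas_sqmod.
  have /(ge0_ig (meas_itv a b) ms (fun x => sqrtr_ge0 _)) is_ := h a b.
  case: mf => m1 m2.
  split; (apply: ig_dom is_ => //; first exact: meas_itv) => x _ /=; [exact: cRe_sqrt|exact: cIm_sqrt].
- have ms : measurable_fun setT (fun x => Num.sqrt (sqmod (f x))).
    by apply: (measurableT_comp measurable_sqrt); exact: meas_sqmod.
  apply/(ge0_ig (meas_itv a b) ms (fun x => sqrtr_ge0 _)).
  apply: ig_dom (cig_n1 _ (h a b)) => // [|x _|]; try exact: meas_itv.
  by rewrite ger0_norm ?sqrtr_ge0//; exact: sqrt_sqmod_n1.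
Qed.

End ComplexIntegral.

#[global] Hint Extern 0 (measurable (itv _ _)) => exact: meas_itv : core.

(** * Locally absolutely continuous functions *)

Section AbsolutelyContinuous.
Context {R : realType}.
Local Notation C := (R[i]).
Local Notation mu := (@lebesgue_measure R).
Local Notation ig D h := (mu.-integrable D (EFin \o (h : R -> R))).
Local Notation RI a b h := (Rintegral mu (itv a b) h).
Implicit Types (f g y z : R -> C) (h k : R -> R) (a b : R).

Lemma RI_cont h a b : a <= b -> ig (itv a b) h ->
  {within `[a, b], continuous (fun x => RI a x h)}.
Proof. exact: parameterized_integral_continuous. Qed.

Lemma RI_ge0 h a b : (forall x, 0 <= h x) -> 0 <= RI a b h.
Proof. by move=> h0; apply: Rintegral_ge0. Qed.

(** The primitive of an integrable function is continuous, so the intermediate value theorem finds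
    the half-mass point even for discontinuous [h]. *)
Lemma RI_half h a b : a <= b -> ig (itv a b) h -> (forall x, 0 <= h x) ->
  exists m, [/\ a <= m, m <= b, RI a m h = RI a b h / 2 & RI m b h = RI a b h / 2].
Proof.
move=> ab ih h0.
have Ige0 := RI_ge0 a b h0.
have /(IVT ab (RI_cont ab ih)) : Num.min (RI a a h) (RI a b h) <= RI a b h / 2 <=
    Num.max (RI a a h) (RI a b h).
  rewrite RI_itv1 /Num.min /Num.max; case: ifPn => [h1|]; first by apply/andP; split; lra.
  by rewrite -leNgt => h1; apply/andP; split; lra.
move=> [m]; rewrite in_itv/= => /andP[am mb] mE; exists m; split => //.
have := RI_split am mb ih; lra.
Qed.

Lemma dyadic_small (q : R) : 0 <= q -> (forall e : R, 0 < e -> q <= e) -> q = 0.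
Proof.
move=> q0 h; apply/eqP; rewrite eq_le q0 andbT leNgt; apply/negP => qp.
have := h (q / 2) ltac:(lra); lra.
Qed.

(* Bisecting [a, b] at the half-mass point of [h] halves the sum of the squared
   masses, so a function whose increments are of second order is constant. *)
Lemma sq_increment_const f h a b (c : R) : 0 <= c -> a <= b ->
  ig (itv a b) h -> (forall x, 0 <= h x) ->
  (forall u v, a <= u -> u <= v -> v <= b -> n1 (f v - f u) <= c * RI u v h ^+ 2) ->
  f b = f a.
Proof.
move=> c0 ab ih h0 fh.
have ihS u v : a <= u -> v <= b -> ig (itv u v) h.
  by move=> au vb; apply: igS ih => //; exact: itv_sub.
have key n u v : a <= u -> u <= v -> v <= b ->
    n1 (f v - f u) * 2 ^+ n <= c * RI u v h ^+ 2.
  elim: n u v => [|n IH] u v au uv vb; first by rewrite expr0 mulr1; exact: fh.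
  have [m [um mv e1 e2]] := RI_half uv (ihS _ _ au vb) h0.
  have := IH u m au um (le_trans mv vb); have := IH m v (le_trans au um) mv vb.
  rewrite e1 e2 (exprS 2) => h1 h2.
  have : n1 (f v - f u) <= n1 (f v - f m) + n1 (f m - f u).
    by rewrite (le_trans _ (n1D _ _))// addrA subrK.
  rewrite -(ler_pM2r (_ : 0 < 2 ^+ n)) ?exprn_gt0//.
  have e : c * (RI u v h / 2) ^+ 2 = c * RI u v h ^+ 2 / 4.
    by move: (RI u v h) => r; field.
  rewrite !e in h1 h2.
  move: (2 ^+ n) (c * RI u v h ^+ 2) h1 h2 => p r.
  move: (n1 _) (n1 _) (n1 _) => d1 d2 d3.
  lra.
apply/eqP; rewrite -subr_eq0; apply/eqP/n1_eq0.
rewrite (@dyadic_small (n1 (f b - f a)))// ?n1_ge0// => e e0.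
set q := n1 (f b - f a); have q0 : 0 <= q := n1_ge0 _.
set B := c * RI a b h ^+ 2.
have B0 : 0 <= B by rewrite mulr_ge0// sqr_ge0.
pose n := Num.truncn (B / e).
have nB : B / e < n.+1%:R by exact: truncnS_gt.
have n2 : n.+1%:R <= (2 : R) ^+ n.+1 by rewrite -natrX ler_nat ltnW// ltn_expl.
have := key n.+1 a b (lexx _) ab (lexx _); rewrite -/q -/B => h1.
rewrite -(ler_pM2r (_ : 0 < 2 ^+ n.+1)) ?exprn_gt0//.
apply: (le_trans h1); move: nB; rewrite ltr_pdivrMr// => nB.
by rewrite (le_trans (ltW nB))// mulrC ler_pM2l.
Qed.

Lemma L1loc_cig f a b : L1loc f -> cig (itv a b) f.
Proof. by move=> /L1locP[_ /(_ a b)]. Qed.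

Lemma L1loc_meas f : L1loc f -> cmeasurable f.
Proof. by case. Qed.

Hint Resolve L1loc_cig L1loc_meas : core.

Lemma L1loc_n1 f a b : L1loc f -> ig (itv a b) (n1 \o f).
Proof. by move=> Lf; apply: cig_n1 => //; exact: L1loc_cig. Qed.

Lemma L1locD f g : L1loc f -> L1loc g -> L1loc (fun x => f x + g x).
Proof.
move=> Lf Lg; apply/L1locP; split; first by apply: cmeasD; exact: L1loc_meas.
by move=> a b; apply: cigD => //; exact: L1loc_cig.
Qed.

Lemma L1locZ c f : L1loc f -> L1loc (fun x => c * f x).
Proof.
move=> Lf; apply/L1locP; split; first by apply: cmeasZ; exact: L1loc_meas.
by move=> a b; apply: cigZ => //; exact: L1loc_cig.
Qed.

Lemma eq_L1loc f g : f =1 g -> L1loc f -> L1loc g.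
Proof. by move=> /funext ->. Qed.

Lemma L1locN f : L1loc f -> L1loc (fun x => - f x).
Proof.
by move=> /(L1locZ (-1)); apply: eq_L1loc => x; rewrite mulN1r.
Qed.

Lemma L1locB f g : L1loc f -> L1loc g -> L1loc (fun x => f x - g x).
Proof. by move=> Lf Lg; apply: L1locD => //; exact: L1locN. Qed.

Lemma L1locJ f : L1loc f -> L1loc (fun x => (f x)^*).
Proof.
move=> Lf; apply/L1locP; split; first by apply: cmeasJ; exact: L1loc_meas.
by move=> a b; apply: cigJ => //; exact: L1loc_cig.
Qed.

Lemma L1loc_ae f g : cmeasurable g -> Defs.ae_eq f g -> L1loc f -> L1loc g.
Proof.
move=> mg fg Lf; apply/L1locP; split => // a b.
by apply: cig_ae fg _ => //; exact: L1loc_cig.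
Qed.

Lemma L1loc_bounded f : cmeasurable f ->
  (forall a b, exists M : R, forall x, itv a b x -> n1 (f x) <= M) -> L1loc f.
Proof.
move=> mf bf; apply/L1locP; split => // a b; have [M hM] := bf a b.
by apply: (@cig_dom _ _ _ (fun=> M)) => //; exact: ig_cst.
Qed.

Lemma L1loc_cst c : L1loc (fun=> c : C).
Proof.
by apply: L1loc_bounded; [exact: cmeas_cst | move=> a b; exists (n1 c)].
Qed.

Lemma L1locM_bounded f g : cmeasurable f ->
  (forall a b, exists M : R, forall x, itv a b x -> n1 (f x) <= M) ->
  L1loc g -> L1loc (fun x => f x * g x).
Proof.
move=> mf bf Lg; apply/L1locP; split; first by apply: cmeasM => //; exact: L1loc_meas.
move=> a b; have [M hM] := bf a b.
apply: (@cig_dom _ _ _ (fun x => M * (n1 \o g) x)) => //.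
- by apply: cmeasM => //; exact: L1loc_meas.
- by move=> x abx; rewrite (le_trans (n1M _ _))// ler_wpM2r ?n1_ge0// hM.
- by apply: igZ => //; exact: L1loc_n1.
Qed.

(** The oriented integral from 0 to [x]: for [x] of either sign one of the two intervals is empty,
    and at 0 both are null. *)
Definition prim f (x : R) : C := cint (itv 0 x) f - cint (itv x 0) f.

Lemma prim0 f : prim f 0 = 0.
Proof. by rewrite /prim !cint_itv1 subrr. Qed.

Lemma prim_incr f a b : L1loc f -> a <= b -> prim f b - prim f a = cint (itv a b) f.
Proof.
move=> Lf ab; have ci u v : cig (itv u v) f := L1loc_cig u v Lf.
have ge0 x : 0 <= x -> prim f x = cint (itv 0 x) f.
  move=> x0; rewrite /prim; have [->|xn0] := eqVneq x 0; first by rewrite cint_itv1 subr0.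
  by rewrite (itv_set0 (_ : 0 < x)) ?cint_set0 ?subr0// lt_neqAle eq_sym xn0.
have le0 x : x <= 0 -> prim f x = - cint (itv x 0) f.
  move=> x0; rewrite /prim; have [->|xn0] := eqVneq x 0; first by rewrite cint_itv1 sub0r.
  by rewrite (itv_set0 (_ : x < 0)) ?cint_set0 ?sub0r// lt_neqAle xn0.
have [a0|a0] := leP 0 a.
  rewrite (ge0 b (le_trans a0 ab)) (ge0 a a0).
  by rewrite (cint_split a0 ab)// addrC addKr.
have [b0|b0] := leP b 0.
  by rewrite !le0// ?ltW// (cint_split ab b0)// opprK addrC addrK.
rewrite (ge0 b (ltW b0)) (le0 a (ltW a0)) opprK.
by rewrite (cint_split (ltW a0) (ltW b0))// addrC.
Qed.

Lemma ACd_prim f : L1loc f -> ACd (prim f) f.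
Proof. by move=> Lf; split => // a b ab; exact: prim_incr. Qed.

Lemma ACd_L1loc y g : ACd y g -> L1loc g. Proof. by case. Qed.

Lemma ACd_incr y g a b : ACd y g -> a <= b -> y b = y a + cint (itv a b) g.
Proof. by move=> [_ /(_ a b) h] /h <-; rewrite addrC subrK. Qed.

Lemma n1_incr y g a b u v : ACd y g -> a <= u -> u <= v -> v <= b ->
  n1 (y v - y u) <= RI a b (n1 \o g).
Proof.
move=> ay au uv vb; have Lg := ACd_L1loc ay; rewrite (proj2 ay)//.
apply: (le_trans (n1_cint _ _)) => //; first exact: L1loc_cig.
apply: RI_subset => //; first exact: itv_sub.
- exact: (meas_n1 (L1loc_meas Lg)).
- by move=> x; exact: n1_ge0.
- exact: L1loc_n1.
Qed.

Lemma ACd_bounded y g a b : ACd y g ->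
  exists M : R, forall x, itv a b x -> n1 (y x) <= M.
Proof.
move=> ay; exists (n1 (y a) + RI a b (n1 \o g)) => x /andP[ax xb].
rewrite -[y x](subrK (y a)) addrC (le_trans (n1D _ _))// lerD2l.
exact: (n1_incr ay).
Qed.

Lemma AC_cont_real h k : (forall a b, ig (itv a b) k) ->
  (forall a b, a <= b -> h b - h a = RI a b k) -> continuous h.
Proof.
move=> ik hk x.
have xx : x - 1 <= x + 1 by lra.
have cw := RI_cont xx (ik _ _).
have cw' : {within `[x - 1, x + 1], continuous h}.
  have /(_ _ _ _) : {within `[x - 1, x + 1], continuous (fun t => h (x - 1) + RI (x - 1) t k)}.
    by move=> t; apply: cvgD; [exact: cvg_cst | exact: cw].
  apply: subspace_eq_continuous => t /set_mem; rewrite /= in_itv/= => /andP[h1 h2].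
  by rewrite /from_subspace -hk// addrC subrK.
apply: (within_continuous_continuous _ cw'); first by lra.
by rewrite in_itv/=; apply/andP; split; lra.
Qed.

Lemma ACd_cRe y g : ACd y g -> continuous (cRe \o y).
Proof.
move=> ay; apply: (@AC_cont_real _ (cRe \o g)).
  by move=> a b; case: (L1loc_cig a b (ACd_L1loc ay)).
by move=> a b ab /=; rewrite -cReN -cReD (proj2 ay).
Qed.

Lemma ACd_cIm y g : ACd y g -> continuous (cIm \o y).
Proof.
move=> ay; apply: (@AC_cont_real _ (cIm \o g)).
  by move=> a b; case: (L1loc_cig a b (ACd_L1loc ay)).
by move=> a b ab /=; rewrite -cImN -cImD (proj2 ay).
Qed.

Lemma ACd_meas y g : ACd y g -> cmeasurable y.
Proof.
by move=> ay; split; apply: continuous_measurable_fun; [exact: ACd_cRe ay|exact: ACd_cIm ay].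
Qed.

Lemma ACd_L1M y g f : ACd y g -> L1loc f -> L1loc (fun x => y x * f x).
Proof.
move=> ay; apply: L1locM_bounded; first exact: ACd_meas ay.
by move=> a b; exact: ACd_bounded ay.
Qed.

Lemma ACd_ae y g g' : ACd y g -> cmeasurable g' -> Defs.ae_eq g g' -> ACd y g'.
Proof.
move=> [Lg yg] mg' gg'; split; first exact: L1loc_ae gg' Lg.
move=> a b ab; rewrite yg//; apply: cint_ae => //; exact: L1loc_meas.
Qed.

Lemma eq_ACd y y' g g' : y =1 y' -> g =1 g' -> ACd y g -> ACd y' g'.
Proof. by move=> /funext -> /funext ->. Qed.

Lemma ACd_cst c : ACd (fun=> c : C) (fun=> 0).
Proof.
split; first exact: L1loc_cst.
by move=> a b _; rewrite subrr cint0.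
Qed.

Lemma ACdD y g z (k : R -> C) : ACd y g -> ACd z k -> ACd (fun x => y x + z x) (fun x => g x + k x).
Proof.
move=> [Lg yg] [Lk zk]; split; first exact: L1locD.
move=> a b ab; rewrite cintD//; [|exact: L1loc_cig|exact: L1loc_cig].
by rewrite -yg// -zk//; ring.
Qed.

Lemma ACdZ c y g : ACd y g -> ACd (fun x => c * y x) (fun x => c * g x).
Proof.
move=> [Lg yg]; split; first exact: L1locZ.
move=> a b ab; rewrite cintZ//; last exact: L1loc_cig.
by rewrite -yg//; ring.
Qed.

Lemma ACdN y g : ACd y g -> ACd (fun x => - y x) (fun x => - g x).
Proof. by move=> /(ACdZ (-1)); apply: eq_ACd => x; rewrite mulN1r. Qed.

Lemma ACdB y g z (k : R -> C) : ACd y g -> ACd z k -> ACd (fun x => y x - z x) (fun x => g x - k x).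
Proof. by move=> ay az; apply: ACdD => //; exact: ACdN. Qed.

Lemma ACdJ y g : ACd y g -> ACd (fun x => (y x)^*) (fun x => (g x)^*).
Proof.
move=> [Lg yg]; split; first exact: L1locJ.
move=> a b ab; rewrite cintJ//; last exact: L1loc_cig.
by rewrite -yg// rmorphB.
Qed.

Lemma ACd_const y g a b : ACd y g -> (forall x, g x = 0) -> y a = y b.
Proof.
move=> ay g0; wlog ab : a b / a <= b.
  by move=> hw; case: (leP a b) => [|/ltW] /hw // ->.
by rewrite (ACd_incr ay ab) cint0 ?addr0.
Qed.

(** Let [H] be the product minus a primitive of the expected derivative. Its increment over [[u, v]]
    is the integral of [g (z u - z t) + (y v - y t) k]. Both differences are at most the mass [N] of
    [|g| + |k|] on [[u, v]], so the increment is at most [N^2] and [sq_increment_const] makes [H]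
    constant. *)
Lemma ACdM y g z (k : R -> C) : ACd y g -> ACd z k ->
  ACd (fun x => y x * z x) (fun x => g x * z x + y x * k x).
Proof.
move=> ay az; have [Lg yg] := ay; have [Lk zk] := az.
have L : L1loc (fun x => g x * z x + y x * k x).
  apply: L1locD; last exact: ACd_L1M ay _.
  by apply: (@eq_L1loc (fun x => z x * g x)) => [x|]; [rewrite mulrC|exact: ACd_L1M az _].
split => // a b ab.
pose d x := n1 (g x) + n1 (k x).
have id u v : ig (itv u v) d by apply: igD => //; exact: L1loc_n1.
have d0 x : 0 <= d x by apply: addr_ge0; exact: n1_ge0.
have md : measurable_fun setT d.
  apply: measurable_funD; [exact: (meas_n1 (L1loc_meas Lg))|exact: (meas_n1 (L1loc_meas Lk))].
pose H x := y x * z x - prim (fun x => g x * z x + y x * k x) x.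
suff : H b = H a.
  rewrite /H => /(congr1 (fun t => t + prim (fun x => g x * z x + y x * k x) b)).
  by rewrite subrK => ->; rewrite -(prim_incr L ab); ring.
apply: (@sq_increment_const H d a b 1) => // u v au uv vb.
have -> : H v - H u = cint (itv u v) (fun t => g t * (z u - z t) + (y v - y t) * k t).
  transitivity ((y v - y u) * z u + y v * (z v - z u) -
      (prim (fun x => g x * z x + y x * k x) v -
       prim (fun x => g x * z x + y x * k x) u)).
    by rewrite /H; ring.
  rewrite (prim_incr L uv) yg// zk// -(mulrC (z u)) -!cintZ//; [|exact: L1loc_cig..].
  rewrite -cintD//; [|by apply: cigZ => //; exact: L1loc_cig..].
  rewrite -cintB//; last first.
  - exact: L1loc_cig.
  - by apply: cigD => //; apply: cigZ => //; exact: L1loc_cig.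
  by apply: eq_cint => t _; ring.
set N := RI u v d.
have hN w w1 t : ACd w w1 -> (forall x, n1 (w1 x) <= d x) -> itv u v t ->
    n1 (w u - w t) <= N /\ n1 (w v - w t) <= N.
  move=> aw wd /andP[ut tv].
  have le : RI u v (n1 \o w1) <= N.
    by apply: RI_le => // [|x _]; [exact: (L1loc_n1 _ _ (ACd_L1loc aw))|exact: wd].
  split; last exact: le_trans (n1_incr aw ut tv (lexx _)) le.
  rewrite n1BC; exact: le_trans (n1_incr aw (lexx _) ut tv) le.
apply: (@le_trans _ _ (RI u v (fun t => N * d t))); last first.
  by rewrite RintegralZl// -/N mul1r expr2.
apply: n1_cint_le => //; last 2 first.
- exact: igZ.
- move=> t ht; apply: (le_trans (n1D _ _)); rewrite /d [leRHS]mulrDr.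
  apply: lerD; apply: (le_trans (n1M _ _)).
    rewrite mulrC ler_wpM2r ?n1_ge0//.
    by apply: (hN z k t az _ ht).1 => x; rewrite /d lerDr n1_ge0.
  rewrite ler_wpM2r ?n1_ge0//.
  by apply: (hN y g t ay _ ht).2 => x; rewrite /d lerDl n1_ge0.
apply: L1loc_cig; apply: L1locD.
- apply: (@eq_L1loc (fun t => (z u - z t) * g t)) => [x|]; first by rewrite mulrC.
  exact: ACd_L1M (ACdB (ACd_cst (z u)) az) Lg.
- exact: ACd_L1M (ACdB (ACd_cst (y v)) ay) Lk.
Qed.

End AbsolutelyContinuous.

#[global] Hint Resolve L1loc_cig L1loc_meas : core.

(** * The chain rule for the exponential of an absolutely continuous function *)

Section Exponential.
Context {R : realType}.
Local Notation C := (R[i]).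
Local Notation mu := (@lebesgue_measure R).
Local Notation ig D h := (mu.-integrable D (EFin \o (h : R -> R))).
Local Notation RI a b h := (Rintegral mu (itv a b) h).
Local Notation "x %:C" := (real_complex R x).

Lemma expR_sub_le (u v M : R) : u <= M -> v <= M ->
  `|expR u - expR v| <= expR M * `|u - v|.
Proof.
wlog uv : u v / u <= v => [hw uM vM|uM vM].
  case: (leP u v) => [uv|/ltW vu]; first exact: hw.
  by rewrite distrC (distrC u); exact: hw.
have h := expR_ge1Dx (u - v).
have ev : expR u = expR v * expR (u - v) by rewrite -expRD addrC subrK.
have e0 := expR_gt0 v.
have evM : expR v <= expR M by rewrite ler_expR.
rewrite ler0_norm; last by rewrite subr_le0 ler_expR.
rewrite ler0_norm ?subr_le0// ev opprB.
have : expR v * (1 + (u - v)) <= expR v * expR (u - v) by rewrite ler_pM2l.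
have : expR v * (v - u) <= expR M * (v - u) by rewrite ler_wpM2r// subr_ge0.
lra.
Qed.

(** Two uses of [1 + x <= exp x], one based at [u] and one at [v], place the remainder between 0 and
    [(v - u) (exp v - exp u)]. *)
Lemma expR_taylor1 (u v M : R) : u <= M -> v <= M ->
  `|expR v - expR u - expR u * (v - u)| <= expR M * (v - u) ^+ 2.
Proof.
move=> uM vM.
have h1 := expR_ge1Dx (v - u); have h2 := expR_ge1Dx (u - v).
have ev : expR v = expR u * expR (v - u) by rewrite -expRD addrC subrK.
have eu : expR u = expR v * expR (u - v) by rewrite -expRD addrC subrK.
have u0 := expR_gt0 u; have v0 := expR_gt0 v.
have p : 0 <= expR v - expR u - expR u * (v - u).
  have : expR u * (1 + (v - u)) <= expR u * expR (v - u) by rewrite ler_pM2l.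
  by rewrite -ev; lra.
rewrite ger0_norm//.
have : expR v * (1 + (u - v)) <= expR v * expR (u - v) by rewrite ler_pM2l.
rewrite -eu => h3.
have := expR_sub_le vM uM.
have h4 : (v - u) * (expR v - expR u) <= `|v - u| * `|expR v - expR u|.
  by rewrite -normrM ler_norm.
move=> h5; have : `|v - u| * `|expR v - expR u| <= `|v - u| * (expR M * `|v - u|).
  by rewrite ler_wpM2l.
rewrite mulrCA -expr2 real_normK ?num_real//; lra.
Qed.

Lemma ACd_real_cRe (S s : R -> R) a b : ACd (fun x => (S x)%:C) (fun x => (s x)%:C) ->
  a <= b -> S b - S a = RI a b s.
Proof.
move=> aS ab; have := proj2 aS a b ab; rewrite cint_real => /(congr1 (@cRe R)).
by rewrite !cReImE.
Qed.

(** Again a second order estimate. The increment of [H] is the Taylor remainder of exp between [S u]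
    and [S v] plus the integral of [s t (exp (S u) - exp (S t))]; with [N] the mass of [|s|] on
    [[u, v]], each part is at most [exp M * N^2]. *)
Lemma ACd_expR (S s : R -> R) : ACd (fun x => (S x)%:C) (fun x => (s x)%:C) ->
  ACd (fun x => (expR (S x))%:C) (fun x => (s x * expR (S x))%:C).
Proof.
move=> aS; have Ls := ACd_L1loc aS.
have igs a b : ig (itv a b) s by case: (L1loc_cig a b Ls).
have ms : measurable_fun setT s by case: (L1loc_meas Ls).
have mS : measurable_fun setT S by case: (ACd_meas aS).
have mE : cmeasurable (fun x => (expR (S x))%:C).
  by apply: cmeas_real; apply: measurableT_comp.
have bE a b : exists M : R, forall x, itv a b x -> n1 ((expR (S x))%:C) <= M.
  have [M hM] := ACd_bounded a b aS; exists (expR M) => x abx.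
  rewrite n1_real ger0_norm ?expR_ge0// ler_expR.
  by have := hM x abx; rewrite n1_real; exact/le_trans/ler_norm.
have L : L1loc (fun x => (s x * expR (S x))%:C).
  apply: (@eq_L1loc _ (fun x => (expR (S x))%:C * (s x)%:C)).
    by move=> x; rewrite -rmorphM mulrC.
  exact: L1locM_bounded.
split => // a b ab.
have [M hM] := ACd_bounded a b aS.
have SM x : itv a b x -> S x <= M.
  by move=> abx; have := hM x abx; rewrite n1_real; exact/le_trans/ler_norm.
pose d (x : R) : R := `|s x|.
have igd u v : ig (itv u v) d by exact: ig_norm.
have d0 x : 0 <= d x by exact: normr_ge0.
pose H x := (expR (S x))%:C - prim (fun x => (s x * expR (S x))%:C) x.
suff : H b = H a.
  rewrite /H => /(congr1 (fun t => t + prim (fun x => (s x * expR (S x))%:C) b)).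
  by rewrite subrK => ->; rewrite -(prim_incr L ab); ring.
apply: (@sq_increment_const _ H d a b (2 * expR M)) => //.
move=> u v au uv vb.
have uab : itv a b u by rewrite /itv/= au (le_trans uv).
have vab : itv a b v by rewrite /itv/= vb (le_trans au).
set N := RI u v d.
have N0 : 0 <= N by exact: RI_ge0.
have hN t w : itv u v t -> itv u v w -> `|S t - S w| <= N.
  wlog wt : t w / w <= t.
    move=> hw ht hw'; case: (leP w t) => [|/ltW] h; first exact: hw.
    by rewrite distrC; exact: hw.
  move=> ht hw; rewrite (ACd_real_cRe aS wt).
  apply: (le_trans (le_normr_Rintegral _ (igs _ _))) => //.
  move: ht hw => /andP[_ tv] /andP[uw _].
  apply: RI_subset => //; first exact: itv_sub.
  by apply: measurableT_comp.
have igE : ig (itv u v) (fun t => s t * expR (S t)).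
  by case: (L1loc_cig u v L).
have -> : H v - H u = (expR (S v) - expR (S u) - expR (S u) * (S v - S u))%:C +
    (RI u v (fun t => s t * expR (S u) - s t * expR (S t)))%:C.
  rewrite RintegralB//; last first.
    by apply: (@eq_ig _ _ (fun t => expR (S u) * s t)); [move=> x; rewrite mulrC|exact: igZ].
  rewrite RintegralZr// -(ACd_real_cRe aS uv).
  transitivity ((expR (S v))%:C - (expR (S u))%:C -
      (prim (fun x => (s x * expR (S x))%:C) v - prim (fun x => (s x * expR (S x))%:C) u)).
    by rewrite /H; ring.
  rewrite (prim_incr L uv) cint_real -!rmorphB -!rmorphD; congr _%:C; ring.
have uu : itv u v u by rewrite /itv/= lexx.
have vv : itv u v v by rewrite /itv/= uv lexx.
apply: (le_trans (n1D _ _)); rewrite !n1_real.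
have h1 := expR_taylor1 (SM _ uab) (SM _ vab).
have h2 : `|S v - S u| ^+ 2 <= N ^+ 2 by rewrite ler_sqr ?nnegrE// hN.
rewrite real_normK ?num_real// in h2.
have h3 : expR M * (S v - S u) ^+ 2 <= expR M * N ^+ 2 by rewrite ler_pM2l ?expR_gt0.
have ms1 : measurable_fun setT (fun t => s t * expR (S u) - s t * expR (S t)).
  by apply: measurable_funB; apply: measurable_funM => //; exact: measurableT_comp.
have dom t : itv u v t -> `|s t * expR (S u) - s t * expR (S t)| <= expR M * N * d t.
  move=> ut; have abt : itv a b t by exact: itv_sub ut.
  rewrite -mulrBr normrM mulrC ler_wpM2r//.
  apply: (le_trans (expR_sub_le (SM _ uab) (SM _ abt))).
  by rewrite ler_wpM2l ?expR_ge0// hN.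
have igZd : ig (itv u v) (fun t => expR M * N * d t) by exact: igZ.
have ig1 := ig_dom (meas_itv u v) ms1 dom igZd.
have : `|RI u v (fun t => s t * expR (S u) - s t * expR (S t))| <= expR M * N * N.
  apply: (le_trans (le_normr_Rintegral _ ig1)) => //.
  have <- : RI u v (fun t => expR M * N * d t) = expR M * N * N.
    by rewrite RintegralZl.
  by apply: RI_le => //; exact: ig_norm.
rewrite -/N; lra.
Qed.

End Exponential.

(** * Linear systems with locally integrable coefficients *)

Section GeometricLimit.
Context {R : realType}.
Local Notation C := (R[i]).

(** The intervals of radius [2 B / 2^n] around [u n] are nested, so the supremum of their left ends
    lies in all of them; this gives the limit together with its rate. *)
Lemma geo_limit_real (u : nat -> R) (B : R) :
  (forall n, `|u n.+1 - u n| <= B / 2 ^+ n) ->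
  exists l, forall n, `|l - u n| <= 2 * B / 2 ^+ n.
Proof.
move=> hu.
have hS n : 2 * B / 2 ^+ n.+1 = B / 2 ^+ n by rewrite exprS; field; rewrite expf_neq0.
have B0 : 0 <= B by have := le_trans (normr_ge0 _) (hu 0%N); rewrite expr0 divr1.
have B2 n : 0 <= B / 2 ^+ n by rewrite divr_ge0// exprn_ge0.
have B2' n : 2 * B / 2 ^+ n = 2 * (B / 2 ^+ n) by rewrite mulrA.
pose lo n := u n - 2 * B / 2 ^+ n; pose hi n := u n + 2 * B / 2 ^+ n.
have loS n : lo n <= lo n.+1.
  by rewrite /lo hS B2'; have := hu n; rewrite ler_norml => /andP[]; lra.
have hiS n : hi n.+1 <= hi n.
  by rewrite /hi hS B2'; have := hu n; rewrite ler_norml => /andP[]; lra.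
have lohi n : lo n <= hi n by rewrite /lo /hi B2'; have := B2 n; lra.
have lom n k : lo n <= lo (n + k)%N.
  by elim: k => [|k IH]; rewrite ?addn0// addnS (le_trans IH).
have him n k : hi (n + k)%N <= hi n.
  by elim: k => [|k IH]; rewrite ?addn0// addnS (le_trans _ IH).
have lh n k : lo n <= hi k.
  by rewrite (le_trans (lom n k))// (le_trans (lohi _))// addnC him.
have hs : has_sup (range lo).
  split; first by exists (lo 0%N); exists 0%N.
  by exists (hi 0%N) => _ [n _ <-].
exists (sup (range lo)) => n.
have h1 : lo n <= sup (range lo) by apply: ub_le_sup; [exact: hs.2|exists n].
have h2 : sup (range lo) <= hi n.
  by apply: ge_sup => [|_ [k _ <-]]; [exact: hs.1|exact: lh].
by rewrite ler_norml; move: h1 h2; rewrite /lo /hi => h1 h2; apply/andP; split; lra.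
Qed.

Lemma geo_limit (u : nat -> C) (B : R) :
  (forall n, n1 (u n.+1 - u n) <= B / 2 ^+ n) ->
  exists l, forall n, n1 (l - u n) <= 4 * B / 2 ^+ n.
Proof.
move=> hu.
have [l1 h1] : exists l, forall n, `|l - cRe (u n)| <= 2 * B / 2 ^+ n.
  apply: geo_limit_real => n; rewrite -cReN -cReD.
  exact: le_trans (cRe_n1 _) (hu n).
have [l2 h2] : exists l, forall n, `|l - cIm (u n)| <= 2 * B / 2 ^+ n.
  apply: geo_limit_real => n; rewrite -cImN -cImD.
  exact: le_trans (cIm_n1 _) (hu n).
exists (Complex l1 l2) => n; rewrite /n1 !cReImE /=.
apply: (le_trans (lerD (h1 n) (h2 n))).
by rewrite -mulrDl -mulrDl (_ : 2 + 2 = 4)//; lra.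
Qed.

Lemma geo_small (B q : R) : 0 <= q -> (forall n, q <= B / 2 ^+ n) -> q = 0.
Proof.
move=> q0 hq; apply: dyadic_small => // e e0.
have B0 : 0 <= B by have := le_trans q0 (hq 0%N); rewrite expr0 divr1.
pose n := Num.truncn (B / e).
have nB : B / e < n.+1%:R by exact: truncnS_gt.
have n2 : n.+1%:R <= (2 : R) ^+ n.+1 by rewrite -natrX ler_nat ltnW// ltn_expl.
apply: (le_trans (hq n.+1)); rewrite ler_pdivrMr ?exprn_gt0//.
by move: nB; rewrite ltr_pdivrMr// => nB; rewrite (le_trans (ltW nB))// mulrC ler_pM2l.
Qed.

Lemma geo_cvg0 (B : R) : (B / 2 ^+ n) @[n --> \oo] --> (0 : R).
Proof.
have -> : (fun n => B / 2 ^+ n) = (fun n => B * (2^-1) ^+ n).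
  by apply/funext => n; rewrite exprVn.
rewrite -[X in _ --> X](mulr0 B); apply: cvgMr; apply: cvg_expr.
by rewrite ger0_norm// invf_lt1// ltr1n.
Qed.

Lemma geo_cvg (u : nat -> R) (l B : R) : (forall n, `|l - u n| <= B / 2 ^+ n) ->
  u @ \oo --> l.
Proof.
move=> hu; apply/cvgrPdist_le => e e0.
have /cvgrPdist_le/(_ e e0) := geo_cvg0 B.
apply: filterS => n; rewrite sub0r normrN => h.
by apply: (le_trans (hu n)); apply: (le_trans _ h); exact: ler_norm.
Qed.

Lemma cmeas_geo (f : nat -> R -> C) (g : R -> C) (B : R -> R) :
  (forall n, cmeasurable (f n)) ->
  (forall x n, n1 (g x - f n x) <= B x / 2 ^+ n) -> cmeasurable g.
Proof.
move=> mf fg; split.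
- apply: (@measurable_fun_cvg _ _ _ _ (fun n => cRe \o f n)).
    by move=> n; case: (mf n).
  move=> x _; apply: (@geo_cvg _ _ (B x)) => n /=.
  by rewrite -cReN -cReD; exact: le_trans (cRe_n1 _) (fg x n).
- apply: (@measurable_fun_cvg _ _ _ _ (fun n => cIm \o f n)).
    by move=> n; case: (mf n).
  move=> x _; apply: (@geo_cvg _ _ (B x)) => n /=.
  by rewrite -cImN -cImD; exact: le_trans (cIm_n1 _) (fg x n).
Qed.

End GeometricLimit.

(** * Global existence for linear systems by Picard iteration in a weighted sup norm *)

Section LinearSystem.
Context {R : realType}.
Local Notation C := (R[i]).
Local Notation mu := (@lebesgue_measure R).
Local Notation ig D h := (mu.-integrable D (EFin \o (h : R -> R))).
Local Notation "x %:C" := (real_complex R x).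

Section Weight.
Variables (m : R -> R).
Hypotheses (m0 : forall x, 0 <= m x) (Lm : L1loc (fun x => (m x)%:C)).

(* [weight_prim] is a primitive of [m * weight] bounded by [weight / 2], so Picard
   iteration contracts by 1/2 in the norm [sup |f| / weight] on the whole line. *)
Definition mass x := cRe (prim (fun x => (m x)%:C) x).
Definition weight x := expR (2 * mass x) + expR (- (2 * mass x)).
Definition weight_prim x := (expR (2 * mass x) - expR (- (2 * mass x))) / 2.

Lemma mass_ACd : ACd (fun x => (mass x)%:C) (fun x => (m x)%:C).
Proof.
apply: eq_ACd (ACd_prim Lm) => // x; apply: ceq; rewrite /mass !cReImE//.
by rewrite /prim !cint_real !cReImE subrr.
Qed.

Lemma weight_ge1 x : 1 <= weight x.
Proof.
rewrite /weight.
have := expR_ge1Dx (2 * mass x); have := expR_ge1Dx (- (2 * mass x)); lra.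
Qed.

Lemma weight_prim_le x : `|weight_prim x| <= weight x / 2.
Proof.
rewrite /weight_prim /weight; have := expR_gt0 (2 * mass x).
have := expR_gt0 (- (2 * mass x)) => h1 h2.
by rewrite ler_norml; apply/andP; split; lra.
Qed.

Lemma weight_prim_ACd :
  ACd (fun x => (weight_prim x)%:C) (fun x => (m x * weight x)%:C).
Proof.
have a1 : ACd (fun x => (2 * mass x)%:C) (fun x => (2 * m x)%:C).
  by apply: eq_ACd (ACdZ (2%:C) mass_ACd) => x; rewrite -rmorphM.
have a2 : ACd (fun x => (- (2 * mass x))%:C) (fun x => (- (2 * m x))%:C).
  by apply: eq_ACd (ACdN a1) => x; rewrite -rmorphN.
have := ACdZ ((2^-1)%:C) (ACdB (ACd_expR a1) (ACd_expR a2)).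
apply: eq_ACd => x.
  by rewrite -rmorphB -rmorphM; congr _%:C; rewrite /weight_prim mulrC.
by rewrite -rmorphB -rmorphM; congr _%:C; rewrite /weight; field.
Qed.

Lemma weight_bounded a b : exists M : R, forall x, itv a b x -> weight x <= M.
Proof.
have [M hM] := ACd_bounded a b mass_ACd.
exists (expR (2 * M) + expR (2 * M)) => x abx.
have := hM x abx; rewrite n1_real ler_norml => /andP[h1 h2].
by apply: lerD; rewrite ler_expR; lra.
Qed.

Lemma cint_weight (f : R -> C) (c : R) a b : L1loc f -> a <= b ->
  (forall t, n1 (f t) <= c * (m t * weight t)) ->
  n1 (cint (itv a b) f) <= c * (weight_prim b - weight_prim a).
Proof.
move=> Lf ab hf; have aw := weight_prim_ACd.
have igw : ig (itv a b) (fun t => m t * weight t).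
  by case: (L1loc_cig a b (ACd_L1loc aw)).
rewrite (ACd_real_cRe aw ab) -RintegralZl//.
by apply: n1_cint_le => //; [exact: L1loc_cig|exact: igZ].
Qed.

Lemma prim_weight (f : R -> C) (c : R) x : L1loc f -> 0 <= c ->
  (forall t, n1 (f t) <= c * (m t * weight t)) ->
  n1 (prim f x) <= c * weight x / 2.
Proof.
move=> Lf c0 hf.
have V0 : weight_prim 0 = 0.
  by rewrite /weight_prim /mass prim0 cRe0 mulr0 oppr0 subrr mul0r.
have := weight_prim_le x; rewrite ler_norml -mulrA => /andP[h1 h2].
case: (leP 0 x) => [x0|/ltW x0].
  rewrite -[prim f x]subr0 -(prim0 f) (prim_incr Lf x0).
  by apply: (le_trans (cint_weight Lf x0 hf)); rewrite ler_wpM2l// V0 subr0.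
rewrite -n1N -[- prim f x]add0r -(prim0 f) (prim_incr Lf x0).
by apply: (le_trans (cint_weight Lf x0 hf)); rewrite ler_wpM2l// V0 sub0r lerNl.
Qed.

End Weight.

Lemma primB (f g : R -> C) x : L1loc f -> L1loc g ->
  prim f x - prim g x = prim (fun t => f t - g t) x.
Proof.
move=> Lf Lg; rewrite /prim !cintB//; try exact: L1loc_cig.
by rewrite !opprB; ring.
Qed.

Variables (a11 a12 a21 a22 : R -> C).
Hypotheses (L11 : L1loc a11) (L12 : L1loc a12) (L21 : L1loc a21) (L22 : L1loc a22).
Variables (y0 u0 : C).

Let m (x : R) : R := n1 (a11 x) + n1 (a12 x) + n1 (a21 x) + n1 (a22 x).

Fixpoint picard n : (R -> C) * (R -> C) :=
  if n is n'.+1 then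
    let: (y, u) := picard n' in
    (fun x => y0 + prim (fun t => a11 t * y t + a12 t * u t) x,
     fun x => u0 + prim (fun t => a21 t * y t + a22 t * u t) x)
  else (fun=> y0, fun=> u0).

(** The class preserved by the iteration: a measurable, locally bounded factor times an L^1_loc
    coefficient is again L^1_loc. *)
Let locb (f : R -> C) := cmeasurable f /\
  forall a b, exists M : R, forall x, itv a b x -> n1 (f x) <= M.

Lemma locb_L1 b1 b2 (f g : R -> C) : L1loc b1 -> L1loc b2 -> locb f -> locb g ->
  L1loc (fun t => b1 t * f t + b2 t * g t).
Proof.
move=> L1 L2 [mf bf] [mg bg]; apply: L1locD.
- apply: (@eq_L1loc _ (fun t => f t * b1 t)); first by move=> t; rewrite mulrC.
  exact: L1locM_bounded.
- apply: (@eq_L1loc _ (fun t => g t * b2 t)); first by move=> t; rewrite mulrC.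
  exact: L1locM_bounded.
Qed.

Lemma locb_prim (f : R -> C) c : L1loc f -> locb (fun x => c + prim f x).
Proof.
move=> Lf; have a := ACdD (ACd_cst c) (ACd_prim Lf).
by split; [exact: ACd_meas a|move=> ? ?; exact: ACd_bounded a].
Qed.

Lemma picard_locb n : locb (picard n).1 /\ locb (picard n).2.
Proof.
elim: n => [|n]; last first.
  rewrite /=; case: (picard n) => y u /= [by_ bu].
  by split; apply: locb_prim; exact: locb_L1.
by split; (split; first exact: cmeas_cst) => a b; [exists (n1 y0)|exists (n1 u0)].
Qed.

Lemma m_L1loc : L1loc (fun x => (m x)%:C).
Proof.
have mr f : L1loc f -> L1loc (fun x => (n1 (f x))%:C).
  move=> Lf; apply/L1locP; split.
    by apply: cmeas_real; exact: meas_n1 (L1loc_meas Lf).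
  move=> a b; apply: (@cig_dom _ _ _ (n1 \o f)) => //.
  - by apply: cmeas_real; exact: meas_n1 (L1loc_meas Lf).
  - by move=> x _; rewrite n1_real ger0_norm ?n1_ge0.
  - exact: L1loc_n1.
apply: (@eq_L1loc _ (fun x => (n1 (a11 x))%:C + (n1 (a12 x))%:C + (n1 (a21 x))%:C + (n1 (a22 x))%:C)).
  by move=> x; rewrite -!rmorphD.
by do 3 (apply: L1locD; last exact: mr); exact: mr.
Qed.

Lemma m_ge0 x : 0 <= m x.
Proof. by rewrite /m !addr_ge0// n1_ge0. Qed.

Let w := weight m.

Lemma row1_le t (y u : C) (B : R) : n1 y <= B -> n1 u <= B ->
  n1 (a11 t * y + a12 t * u) <= m t * B.
Proof.
move=> hy hu; have B0 := le_trans (n1_ge0 y) hy.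
apply: (le_trans (n1D _ _)); apply: (le_trans (lerD (n1M _ _) (n1M _ _))).
apply: (@le_trans _ _ ((n1 (a11 t) + n1 (a12 t)) * B)).
  by rewrite [leRHS]mulrDl lerD// ler_wpM2l ?n1_ge0.
by rewrite ler_wpM2r// /m; have := n1_ge0 (a21 t); have := n1_ge0 (a22 t); lra.
Qed.

Lemma row2_le t (y u : C) (B : R) : n1 y <= B -> n1 u <= B ->
  n1 (a21 t * y + a22 t * u) <= m t * B.
Proof.
move=> hy hu; have B0 := le_trans (n1_ge0 y) hy.
apply: (le_trans (n1D _ _)); apply: (le_trans (lerD (n1M _ _) (n1M _ _))).
apply: (@le_trans _ _ ((n1 (a21 t) + n1 (a22 t)) * B)).
  by rewrite [leRHS]mulrDl lerD// ler_wpM2l ?n1_ge0.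
by rewrite ler_wpM2r// /m; have := n1_ge0 (a11 t); have := n1_ge0 (a12 t); lra.
Qed.

Let K := n1 y0 + n1 u0.

Lemma prim_step b1 b2 (y y' u u' : R -> C) (B : R) x :
  L1loc b1 -> L1loc b2 -> locb y -> locb y' -> locb u -> locb u' ->
  (forall t (z v : C) (q : R), n1 z <= q -> n1 v <= q ->
     n1 (b1 t * z + b2 t * v) <= m t * q) -> 0 <= B ->
  (forall t, n1 (y t - y' t) <= B * w t) -> (forall t, n1 (u t - u' t) <= B * w t) ->
  n1 (prim (fun t => b1 t * y t + b2 t * u t) x -
      prim (fun t => b1 t * y' t + b2 t * u' t) x) <= B / 2 * w x.
Proof.
move=> L1 L2 ly ly' lu lu' hb B0 hy hu; rewrite primB; [|exact: locb_L1..].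
rewrite mulrAC; apply: (@prim_weight m m_L1loc _ B x _ B0).
  by apply: L1locB; exact: locb_L1.
move=> t; have -> : b1 t * y t + b2 t * u t - (b1 t * y' t + b2 t * u' t) =
  b1 t * (y t - y' t) + b2 t * (u t - u' t) by ring.
by rewrite mulrCA; exact: hb.
Qed.

(** The initial data are bounded by [K] and the weight is at least 1, which gives the first
    difference; [prim_step] halves the bound at each later stage. *)
Lemma picard_step n x :
  n1 ((picard n.+1).1 x - (picard n).1 x) <= K / 2 ^+ n * w x /\
  n1 ((picard n.+1).2 x - (picard n).2 x) <= K / 2 ^+ n * w x.
Proof.
have K0 : 0 <= K by rewrite /K addr_ge0// n1_ge0.
have w1 t : 1 <= w t by exact: weight_ge1.
elim: n x => [|n IH] x.
  have [[l1 l2]] := picard_locb 0.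
  rewrite /= expr0 divr1 ![_ + _ - _]addrAC !subrr !add0r.
  have le : K * w x / 2 <= K * w x.
    by rewrite ler_piMr ?mulr_ge0// ?(le_trans _ (w1 x))//; lra.
  have b0 t : m t * K <= K * (m t * w t).
    by rewrite mulrC; apply: ler_wpM2l => //; apply: ler_peMr; [exact: m_ge0|exact: w1].
  split; (apply: (le_trans _ le); apply: (@prim_weight m m_L1loc _ K x _ K0)).
  - exact: locb_L1.
  - by move=> t; apply: (le_trans _ (b0 t)); apply: row1_le; rewrite /K ?lerDl ?lerDr n1_ge0.
  - exact: locb_L1.
  - by move=> t; apply: (le_trans _ (b0 t)); apply: row2_le; rewrite /K ?lerDl ?lerDr n1_ge0.
have e : K / 2 ^+ n.+1 = K / 2 ^+ n / 2 by rewrite exprSr invfM [LHS]mulrA.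
have B0 : 0 <= K / 2 ^+ n by rewrite divr_ge0// exprn_ge0.
move: IH (picard_locb n) (picard_locb n.+1); rewrite /=.
case: (picard n) => y u /= IH [ly lu] [ly' lu'].
have cancel (c p q : C) : c + p - (c + q) = p - q by ring.
rewrite e !cancel.
by split; apply: prim_step => //; [exact: row1_le|move=> t; exact: (IH t).1|
  move=> t; exact: (IH t).2|exact: row2_le|move=> t; exact: (IH t).1|move=> t; exact: (IH t).2].
Qed.

(** The differences of the iterates are at most [K * weight / 2^n] on the whole line, so one limit
    exists everywhere and no local solutions have to be glued. Measurability and local boundedness
    pass to the limit, and the limit satisfies the integral equation because its defect is smaller
    than every term of a geometric sequence. *)
Lemma linear_system_exists : exists y u : R -> C,
  [/\ ACd y (fun t => a11 t * y t + a12 t * u t),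
      ACd u (fun t => a21 t * y t + a22 t * u t), y 0 = y0 & u 0 = u0].
Proof.
have K0 : 0 <= K by rewrite /K addr_ge0// n1_ge0.
have w0 t : 0 <= w t by apply: le_trans (weight_ge1 _ t).
have swap n t : K / 2 ^+ n * w t = K * w t / 2 ^+ n by rewrite mulrAC.
have [y hy] : {y : R -> C & forall x n, n1 (y x - (picard n).1 x) <= 4 * (K * w x) / 2 ^+ n}.
  apply: (@choice _ _ (fun x l => forall n, n1 (l - (picard n).1 x) <= 4 * (K * w x) / 2 ^+ n)).
  by move=> x; apply: geo_limit => n; rewrite -swap; exact: (picard_step n x).1.
have [u hu] : {u : R -> C & forall x n, n1 (u x - (picard n).2 x) <= 4 * (K * w x) / 2 ^+ n}.
  apply: (@choice _ _ (fun x l => forall n, n1 (l - (picard n).2 x) <= 4 * (K * w x) / 2 ^+ n)).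
  by move=> x; apply: geo_limit => n; rewrite -swap; exact: (picard_step n x).2.
have lim_locb (z : R -> C) (p : nat -> R -> C) : (forall n, locb (p n)) ->
    (forall x n, n1 (z x - p n x) <= 4 * (K * w x) / 2 ^+ n) -> locb z.
  move=> lp hz; split; first by apply: cmeas_geo hz => n; case: (lp n).
  move=> a b; have [M1 h1] := (lp 0%N).2 a b.
  have [M2 h2] := weight_bounded m_L1loc a b.
  exists (4 * (K * M2) + M1) => x abx.
  rewrite -[z x](subrK (p 0%N x)) (le_trans (n1D _ _))// lerD ?h1//.
  apply: (le_trans (hz x 0%N)); rewrite expr0 divr1 ler_pM2l// ler_wpM2l//.
  exact: h2.
have ly : locb y by apply: (lim_locb y (fun n => (picard n).1)) => // n; exact: (picard_locb n).1.
have lu : locb u by apply: (lim_locb u (fun n => (picard n).2)) => // n; exact: (picard_locb n).2.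
have fixp b1 b2 c (z : R -> C) (q : nat -> R -> C) : L1loc b1 -> L1loc b2 ->
    (forall t (p v : C) (B : R), n1 p <= B -> n1 v <= B ->
      n1 (b1 t * p + b2 t * v) <= m t * B) ->
    (forall x n, n1 (z x - q n x) <= 4 * (K * w x) / 2 ^+ n) ->
    (forall n x, q n.+1 x =
      c + prim (fun t => b1 t * (picard n).1 t + b2 t * (picard n).2 t) x) ->
    forall x, z x = c + prim (fun t => b1 t * y t + b2 t * u t) x.
  move=> L1 L2 hb hz qS x; apply/eqP; rewrite -subr_eq0; apply/eqP/n1_eq0.
  rewrite (@geo_small _ (4 * (K * w x)) (n1 _))// ?n1_ge0// => n.
  have := hz x n.+1; rewrite qS; have [lp lq] := picard_locb n.
  set F := prim _ x => h3; set G := prim _ x.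
  (* One more contraction, applied to the limit and its iterates. This bound and the distance from
     iterate [n + 1] to the limit are each half of what [geo_small] asks for. *)
  have h4 : n1 (F - G) <= 4 * K / 2 ^+ n / 2 * w x.
    rewrite n1BC; apply: prim_step => //.
    - by rewrite divr_ge0// ?exprn_ge0// mulr_ge0.
    - by move=> t; apply: (le_trans (hy t n)); rewrite mulrA mulrAC.
    - by move=> t; apply: (le_trans (hu t n)); rewrite mulrA mulrAC.
  have -> : z x - (c + G) = z x - (c + F) + (F - G) by ring.
  apply: (le_trans (n1D _ _)); apply: (le_trans (lerD h3 h4)).
  have -> : 4 * (K * w x) / 2 ^+ n.+1 = 4 * (K * w x) / 2 ^+ n / 2.
    by rewrite exprSr invfM [LHS]mulrA.
  have -> : 4 * K / 2 ^+ n / 2 * w x = 4 * (K * w x) / 2 ^+ n / 2.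
    by field; rewrite expf_neq0.
  lra.
have fix1 x : y x = y0 + prim (fun t => a11 t * y t + a12 t * u t) x.
  by apply: (fixp a11 a12 y0 y _ L11 L12 row1_le hy) => n t /=; case: (picard n).
have fix2 x : u x = u0 + prim (fun t => a21 t * y t + a22 t * u t) x.
  by apply: (fixp a21 a22 u0 u _ L21 L22 row2_le hu) => n t /=; case: (picard n).
have A1 := ACdD (ACd_cst y0) (ACd_prim (locb_L1 L11 L12 ly lu)).
have A2 := ACdD (ACd_cst u0) (ACd_prim (locb_L1 L21 L22 ly lu)).
exists y, u; split.
- by apply: eq_ACd A1 => x; rewrite ?add0r.
- by apply: eq_ACd A2 => x; rewrite ?add0r.
- by rewrite fix1 prim0 addr0.
- by rewrite fix2 prim0 addr0.
Qed.

End LinearSystem.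

(** * Translations and square integrable functions *)

Section Translation.
Context {R : realType}.
Local Notation C := (R[i]).
Local Notation mu := (@lebesgue_measure R).
Implicit Types (c : R) (D : set R).

Lemma measurable_shift c : measurable_fun setT (fun x : R => x + c).
Proof. by apply: measurable_funD => //; exact: measurable_id. Qed.

Lemma shift_preimage_itv c (a b : R) :
  (fun x : R => x + c) @^-1` (itv (a + c) (b + c)) = itv a b.
Proof. by apply/seteqP; split => x /=; rewrite /itv /= !lerD2r. Qed.

(** The pushforward under a translation gives half-open intervals their length, so it is Lebesgue
    measure by uniqueness. *)
Lemma lebesgue_measure_shift c (A : set R) : measurable A ->
  pushforward mu ((fun x : R => x + c) : _ -> measurableTypeR R) A = mu A.
Proof.
move=> mA; apply/esym; apply: lebesgue_measure_unique => //=.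
  exact: measurable_shift.
move=> _ _ [[a b]] _ <-; rewrite /pushforward.
rewrite (_ : (fun x : R => x + c) @^-1` _ = `]a - c, b - c]%classic); last first.
  by apply/seteqP; split => x /=; rewrite !in_itv/= ltrBlDr lerBrDr.
rewrite !lebesgue_measure_itv/= !lte_fin ltrD2r; case: ifP => // _.
by congr EFin; ring.
Qed.

Lemma ge0_integral_shift c D (f : R -> \bar R) : measurable D ->
  measurable_fun setT f -> (forall x, 0 <= f x)%E ->
  (\int[mu]_(x in D) f x = \int[mu]_(x in (fun x => (x + c)%R) @^-1` D) f (x + c)%R)%E.
Proof.
move=> mD mf f0.
pose phi : R -> measurableTypeR R := fun x : R => x + c.
have mphi : measurable_fun setT phi := measurable_shift c.
rewrite -[RHS]/(\int[mu]_(x in phi @^-1` D) (f \o phi) x)%E.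
rewrite -[RHS]ge0_integral_pushforward//; last exact: measurable_funTS.
apply: eq_measure_integral => A mA _.
by apply/esym/lebesgue_measure_shift.
Qed.

Lemma integral_shift c D (f : R -> \bar R) : measurable D ->
  measurable_fun setT f ->
  (\int[mu]_(x in D) f x = \int[mu]_(x in (fun x => (x + c)%R) @^-1` D) f (x + c)%R)%E.
Proof.
move=> mD mf; rewrite integralE [RHS]integralE; congr (_ - _)%E.
- rewrite (ge0_integral_shift c mD (measurable_funepos mf) (funepos_ge0 f)).
  by apply: eq_integral => x _; rewrite !funeposE.
- rewrite (ge0_integral_shift c mD (measurable_funeneg mf) (funeneg_ge0 f)).
  by apply: eq_integral => x _; rewrite !funenegE.
Qed.

Lemma RI_shift c a b (h : R -> R) : measurable_fun setT h ->
  Rintegral mu (itv a b) (fun x => h (x + c)) = Rintegral mu (itv (a + c) (b + c)) h.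
Proof.
move=> mh; have mh2 : measurable_fun setT (fun x => (h x)%:E) by apply/measurable_EFinP.
congr fine; rewrite [RHS](integral_shift c)//.
by rewrite shift_preimage_itv.
Qed.

Lemma cmeas_shift c (f : R -> C) : cmeasurable f -> cmeasurable (fun x => f (x + c)).
Proof.
by move=> [m1 m2]; split; [apply: (measurableT_comp m1)|apply: (measurableT_comp m2)];
  exact: measurable_shift.
Qed.

Lemma cint_shift c a b (f : R -> C) : cmeasurable f ->
  cint (itv a b) (fun x => f (x + c)) = cint (itv (a + c) (b + c)) f.
Proof. by move=> [m1 m2]; apply: ceq => /=; exact: RI_shift. Qed.

Lemma ig_shift c a b (h : R -> R) : measurable_fun setT h ->
  mu.-integrable (itv (a + c) (b + c)) (EFin \o h) ->
  mu.-integrable (itv a b) (EFin \o (fun x => h (x + c))).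
Proof.
move=> mh /integrableP[_ ih]; apply/integrableP; split.
  apply/measurable_EFinP; apply: measurable_funTS.
  exact: (measurableT_comp mh (measurable_shift c)).
move: ih; rewrite (ge0_integral_shift c)//.
- by rewrite shift_preimage_itv.
- by apply: measurableT_comp => //; exact/measurable_EFinP.
Qed.

Lemma L1loc_shift c (f : R -> C) : L1loc f -> L1loc (fun x => f (x + c)).
Proof.
move=> /L1locP[mf lf]; apply/L1locP; split; first exact: cmeas_shift.
move=> a b; have [l1 l2] := lf (a + c) (b + c); have [m1 m2] := mf.
by split; [exact: (@ig_shift c a b (cRe \o f))|exact: (@ig_shift c a b (cIm \o f))].
Qed.

Lemma ACd_shift c (y g : R -> C) : ACd y g ->
  ACd (fun x => y (x + c)) (fun x => g (x + c)).
Proof.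
move=> [Lg yg]; split; first exact: L1loc_shift.
by move=> a b ab; rewrite cint_shift ?yg ?lerD2r//; exact: L1loc_meas.
Qed.

End Translation.

(** * L^2 and L^2_loc: exhaustion by intervals, Cauchy-Schwarz, truncated integrals *)

Section SquareIntegrable.
Context {R : realType}.
Local Notation C := (R[i]).
Local Notation mu := (@lebesgue_measure R).
Local Notation ig D h := (mu.-integrable D (EFin \o (h : R -> R))).
Local Notation RI a b h := (Rintegral mu (itv a b) h).
Implicit Types (f g : R -> C) (h : R -> R) (D : set R).

Lemma ig_fin D h : measurable D -> ig D h ->
  (\int[mu]_(x in D) (h x)%:E)%E \is a fin_num.
Proof. by move=> mD ih; apply: integrable_fin_num ih. Qed.

(** Monotone convergence. It turns bounds that are uniform over compact intervals into integrability
    on rays and on the line. *)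
Lemma ige0_sup (F : nat -> set R) h (B : R) : (forall i, measurable (F i)) ->
  (forall i j, (i <= j)%N -> F i `<=` F j) -> measurable_fun setT h ->
  (forall x, 0 <= h x) -> (forall i, ig (F i) h) ->
  (forall i, Rintegral mu (F i) h <= B) ->
  ig (\bigcup_i F i) h /\ Rintegral mu (\bigcup_i F i) h <= B.
Proof.
move=> mF ndF mh h0 ih hB.
have mU : measurable (\bigcup_i F i) by exact: bigcupT_measurable.
have ndF' : nondecreasing_seq F by move=> i j ij; apply/subsetPset/ndF.
have cv : (\int[mu]_(x in F i) (h x)%:E @[i --> \oo] -->
    \int[mu]_(x in \bigcup_i F i) (h x)%:E)%E.
  apply: ge0_nondecreasing_set_cvg_integral => //.
  - by move=> i; apply/measurable_EFinP; exact: measurable_funTS.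
  - by move=> i x _; rewrite lee_fin.
have le : (\int[mu]_(x in \bigcup_i F i) (h x)%:E <= B%:E)%E.
  rewrite -(cvg_lim _ cv)//; apply: lime_le; first by apply/cvg_ex; eexists; exact: cv.
  apply: nearW => i; rewrite -[leLHS]fineK; last exact: ig_fin.
  by rewrite lee_fin; exact: hB.
have iU : ig (\bigcup_i F i) h.
  by apply/(ge0_ig mU mh h0); exact: (le_lt_trans le (ltry _)).
split => //; rewrite -lee_fin fineK//; exact: ig_fin.
Qed.

Lemma bigcup_itvT : \bigcup_i itv (- (i%:R : R)) i%:R = setT.
Proof.
apply/seteqP; split => // x _; exists (Num.truncn `|x|).+1 => //.
by have := truncnS_gt `|x|; rewrite ltr_norml => /andP[/ltW h1 /ltW h2]; apply/andP.
Qed.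

Lemma ige0T_sup h (B : R) : measurable_fun setT h -> (forall x, 0 <= h x) ->
  (forall a b, ig (itv a b) h) -> (forall i : nat, RI (- i%:R) i%:R h <= B) ->
  ig setT h /\ Rintegral mu setT h <= B.
Proof.
move=> mh h0 ih hB; rewrite -bigcup_itvT; apply: ige0_sup => // i j ij.
by apply: itv_sub; rewrite ?lerN2 ler_nat.
Qed.

Lemma bigcup_itv_ray (x : R) : \bigcup_i itv (- (i%:R : R)) x = `]-oo, x]%classic.
Proof.
apply/seteqP; split => t /=.
  by move=> [i _ /andP[_ tx]]; rewrite in_itv.
rewrite in_itv/= => tx; exists (Num.truncn `|t|).+1 => //.
have := truncnS_gt `|t|; rewrite ltr_norml => /andP[/ltW h1 _].
by apply/andP.
Qed.

Lemma bigcup_itv_ray_right (x : R) : \bigcup_i itv x (i%:R : R) = `[x, +oo[%classic.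
Proof.
apply/seteqP; split => t /=.
  by move=> [i _ /andP[tx _]]; rewrite in_itv/= andbT.
rewrite in_itv/= andbT => tx; exists (Num.truncn `|t|).+1 => //.
have := truncnS_gt `|t|; rewrite ltr_norml => /andP[_ /ltW h1].
by apply/andP.
Qed.

Definition N2 f : R := Rintegral mu setT (sqmod \o f).

Lemma L2P f : L2 f <-> cmeasurable f /\ ig setT (sqmod \o f).
Proof.
split => -[mf]; split => //.
  by apply/(ge0_ig measurableT (meas_sqmod mf)) => // x; exact: sqmod_ge0.
by apply/(ge0_ig measurableT (meas_sqmod mf)) => // x; exact: sqmod_ge0.
Qed.

Lemma L2_meas f : L2 f -> cmeasurable f. Proof. by case. Qed.
Lemma L2_ig f : L2 f -> ig setT (sqmod \o f). Proof. by move=> /L2P[]. Qed.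

Lemma N2_ge0 f : 0 <= N2 f.
Proof. by apply: Rintegral_ge0 => x _; exact: sqmod_ge0. Qed.

Lemma l2norm_sqr f : l2norm f ^+ 2 = N2 f.
Proof. by rewrite sqr_sqrtr// N2_ge0. Qed.

Lemma L2_dom f h : cmeasurable f -> (forall x, sqmod (f x) <= h x) ->
  ig setT h -> L2 f.
Proof.
move=> mf fh ih; apply/L2P; split => //.
apply: ig_dom ih => //; first exact: meas_sqmod.
by move=> x _ /=; rewrite ger0_norm ?sqmod_ge0.
Qed.

Lemma L2D f g : L2 f -> L2 g -> L2 (fun x => f x + g x).
Proof.
move=> Lf Lg.
apply: (@L2_dom _ (fun x => 2 * sqmod (f x) + 2 * sqmod (g x))).
- by apply: cmeasD; exact: L2_meas.
- by move=> x; exact: sqmodD_le.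
- by apply: igD => //; apply: igZ => //; exact: L2_ig.
Qed.

Lemma L2Z c f : L2 f -> L2 (fun x => c * f x).
Proof.
move=> Lf; apply: (@L2_dom _ (fun x => sqmod c * sqmod (f x))).
- by apply: cmeasZ; exact: L2_meas.
- by move=> x; rewrite sqmodM.
- by apply: igZ => //; exact: L2_ig.
Qed.

Lemma eq_L2 f g : f =1 g -> L2 f -> L2 g.
Proof. by move=> /funext ->. Qed.

Lemma L2N f : L2 f -> L2 (fun x => - f x).
Proof. by move=> /(L2Z (-1)); apply: eq_L2 => x; rewrite mulN1r. Qed.

Lemma L2B f g : L2 f -> L2 g -> L2 (fun x => f x - g x).
Proof. by move=> Lf Lg; apply: L2D => //; exact: L2N. Qed.

Lemma L2J f : L2 f -> L2 (fun x => (f x)^*).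
Proof.
move=> Lf; apply: (@L2_dom _ (sqmod \o f)).
- by apply: cmeasJ; exact: L2_meas.
- by move=> x; rewrite sqmodJ.
- exact: L2_ig.
Qed.

Lemma L2_0 : L2 (fun=> 0 : C).
Proof.
apply/L2P; split; first exact: cmeas_cst.
rewrite (_ : _ \o _ = cst 0); first exact: integrable0.
by apply/funext => x /=; rewrite sqmod0.
Qed.

Lemma ae_eq_sym f g : Defs.ae_eq f g -> Defs.ae_eq g f.
Proof. exact: ae_imp. Qed.

Lemma ae_eq_trans f g k : Defs.ae_eq f g -> Defs.ae_eq g k -> Defs.ae_eq f k.
Proof. by move=> fg gk; apply: ae_imp (ae_and fg gk) => x [-> ->]. Qed.

Lemma ae_eq_refl f g : f =1 g -> Defs.ae_eq f g.
Proof. exact: ae_all. Qed.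

Lemma L2_ae f g : cmeasurable g -> Defs.ae_eq f g -> L2 f -> L2 g.
Proof.
move=> mg fg Lf; apply/L2P; split => //.
apply: ig_ae (L2_ig Lf) => //; first exact: meas_sqmod.
by apply: ae_imp fg => x /= ->.
Qed.

Lemma N2_ae f g : cmeasurable f -> cmeasurable g -> Defs.ae_eq f g -> N2 f = N2 g.
Proof.
move=> mf mg fg; apply: RI_ae => //; [exact: meas_sqmod|exact: meas_sqmod|].
by apply: ae_imp fg => x /= ->.
Qed.

Lemma N2BC f g : N2 (fun x => f x - g x) = N2 (fun x => g x - f x).
Proof. by apply: eq_Rintegral => x _ /=; rewrite sqmodBC. Qed.

Lemma N2J f : N2 (fun x => (f x)^*) = N2 f.
Proof. by apply: eq_Rintegral => x _ /=; rewrite sqmodJ. Qed.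

Lemma N2D_le f g : L2 f -> L2 g -> N2 (fun x => f x + g x) <= 2 * N2 f + 2 * N2 g.
Proof.
move=> Lf Lg; have i1 := igZ 2 measurableT (L2_ig Lf).
have i2 := igZ 2 measurableT (L2_ig Lg).
have e k : L2 k -> 2 * N2 k = Rintegral mu setT (fun x => 2 * (sqmod \o k) x).
  by move=> Lk; rewrite RintegralZl//; exact: L2_ig.
rewrite !e// -RintegralD//; apply: RI_le => //.
- exact: L2_ig (L2D Lf Lg).
- exact: igD.
- by move=> x _ /=; exact: sqmodD_le.
Qed.

Lemma N2_eq0 f : L2 f -> N2 f = 0 -> Defs.ae_eq f (fun=> 0).
Proof.
move=> Lf f0; have i := L2_ig Lf.
have : (\int[mu]_x `|(EFin \o (sqmod \o f)) x| = 0)%E.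
  under eq_integral do rewrite /= ger0_norm ?sqmod_ge0//.
  rewrite -[LHS]fineK; last exact: ig_fin.
  by congr EFin.
move/(ae_eq_integral_abs mu measurableT (measurable_int mu i)) => h.
by apply: ae_imp h => x /= /(_ I) [] /sqmod_eq0.
Qed.

Lemma N2_ae0 f : cmeasurable f -> Defs.ae_eq f (fun=> 0) -> N2 f = 0.
Proof.
move=> mf /(N2_ae mf (cmeas_cst 0)) ->.
by rewrite /N2 (_ : _ \o _ = cst 0) ?Rintegral_cst ?mul0r//; apply/funext => x /=; rewrite sqmod0.
Qed.

(** Cauchy-Schwarz from a family of AM-GM bounds. The choice [t = q / (2 A)] gives the result
    without extracting a square root; for [A = 0], a large [t] would contradict [q > 0]. *)
Lemma amgm_opt (q A B : R) : 0 <= q -> 0 <= A -> 0 <= B ->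
  (forall t : R, 0 < t -> q <= t * A + B / t) -> q ^+ 2 <= 4 * A * B.
Proof.
move=> q0 A0 B0 h; have [->|qn0] := eqVneq q 0; first by rewrite expr0n mulr_ge0// mulr_ge0.
have qp : 0 < q by rewrite lt_neqAle eq_sym qn0.
have [Az|An0] := eqVneq A 0.
  have tp : 0 < 2 * B / q + 1 by rewrite ltr_wpDl// divr_ge0// mulr_ge0.
  have := h _ tp.
  rewrite Az mulr0 add0r ler_pdivlMr// mulrDr mulrC divfK// mulr1; lra.
have Ap : 0 < A by rewrite lt_neqAle eq_sym An0.
have tp : 0 < q / (2 * A) by rewrite divr_gt0// mulr_gt0.
have := h _ tp.
have -> : q / (2 * A) * A + B / (q / (2 * A)) = (q ^+ 2 + 4 * A * B) / (2 * q).
  by field; rewrite qn0 An0.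
rewrite ler_pdivlMr ?mulr_gt0// => h1; move: h1; rewrite mulrCA -expr2; lra.
Qed.

Lemma n1M_le (z w : C) (t : R) : 0 < t -> n1 (z * w) <= t * sqmod z + sqmod w / t.
Proof.
move=> t0; apply: (le_trans (n1M _ _)).
have h1 := n1_sqmod z; have h2 := n1_sqmod w.
have s : 0 <= (t * n1 z - n1 w) ^+ 2 by rewrite sqr_ge0.
rewrite -(ler_pM2r t0) [leRHS]mulrDl divfK ?gt_eqF//.
have : t ^+ 2 * n1 z ^+ 2 <= t ^+ 2 * (2 * sqmod z) by rewrite ler_pM2l// exprn_gt0.
move: s; rewrite sqrrB exprMn; lra.
Qed.

Definition L2on D f := cmeasurable f /\ ig D (sqmod \o f).

Lemma L2onM D f g : measurable D -> L2on D f -> L2on D g -> cig D (fun x => f x * g x).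
Proof.
move=> mD [mf iF] [mg ig_]; apply: (@cig_dom _ _ _ (fun x => sqmod (f x) + sqmod (g x))) => //.
- exact: cmeasM.
- by move=> x _; have := n1M_le (f x) (g x) ltr01; rewrite mul1r divr1.
- exact: igD.
Qed.

Lemma cauchy_schwarz D f g : measurable D -> L2on D f -> L2on D g ->
  n1 (cint D (fun x => f x * g x)) ^+ 2 <=
  4 * Rintegral mu D (sqmod \o f) * Rintegral mu D (sqmod \o g).
Proof.
move=> mD Lf Lg; have [mf iF] := Lf; have [mg ig_] := Lg.
apply: amgm_opt; first exact: n1_ge0.
- by apply: Rintegral_ge0 => x _; exact: sqmod_ge0.
- by apply: Rintegral_ge0 => x _; exact: sqmod_ge0.
move=> t t0; rewrite (mulrC _ t^-1) -!RintegralZl// -RintegralD//; [|exact: igZ..].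
apply: n1_cint_le => //; first exact: L2onM.
- by apply: igD => //; exact: igZ.
- by move=> x _; rewrite (mulrC t^-1); exact: n1M_le.
Qed.

Lemma L2_on D f : measurable D -> L2 f -> L2on D f.
Proof. by move=> mD /L2P[mf iF]; split => //; exact: igS iF. Qed.

Lemma L2locP f : L2loc f <-> cmeasurable f /\ forall a b, L2on (itv a b) f.
Proof.
split => -[mf hf]; split => // a b; last first.
  apply/(ge0_ig (meas_itv a b) (meas_sqmod mf)); first by move=> x; exact: sqmod_ge0.
  exact: (hf a b).2.
split => //; apply/(ge0_ig (meas_itv a b) (meas_sqmod mf)) => // x; exact: sqmod_ge0.
Qed.

Lemma L2_loc f : L2 f -> L2loc f.
Proof. by move=> Lf; apply/L2locP; split => [|a b]; [case: Lf|exact: L2_on]. Qed.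

Lemma L2locM f g : L2loc f -> L2loc g -> L1loc (fun x => f x * g x).
Proof.
move=> /L2locP[mf hf] /L2locP[mg hg]; apply/L1locP; split; first exact: cmeasM.
by move=> a b; exact: L2onM.
Qed.

Lemma L2loc_L1 f : L2loc f -> L1loc f.
Proof.
move=> Lf; apply: (@eq_L1loc _ (fun x => f x * 1)) => [x|]; first by rewrite mulr1.
apply: L2locM => //; apply/L2locP; split => [|a b]; first exact: cmeas_cst.
by split; [exact: cmeas_cst|exact: ig_cst].
Qed.

Lemma L2_L1 f : L2 f -> L1loc f. Proof. by move=> /L2_loc/L2loc_L1. Qed.

Lemma L2M f g : L2 f -> L2 g -> cig setT (fun x => f x * g x).
Proof. by move=> Lf Lg; apply: L2onM => //; exact: L2_on. Qed.

Lemma cint_cvgT f : cig setT f -> forall e : R, 0 < e -> exists N : nat,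
  forall n, (N <= n)%N -> n1 (cint setT f - cint (itv (- n%:R) n%:R) f) <= e.
Proof.
have key h : ig setT h -> RI (- n%:R) n%:R h @[n --> \oo] --> Rintegral mu setT h.
  move=> ih.
  have ip := integrable_funrpos measurableT ih.
  have in_ := integrable_funrneg measurableT ih.
  have mono k : (forall x, 0 <= k x) -> ig setT k ->
      RI (- n%:R) n%:R k @[n --> \oo] --> Rintegral mu setT k.
    move=> k0 ik; apply: fine_cvg; rewrite fineK; last exact: ig_fin.
    rewrite -[X in (\int[mu]_(x in X) _)%E]bigcup_itvT.
    apply: ge0_nondecreasing_set_cvg_integral => //.
    - move=> i j ij; apply/subsetPset/itv_sub; by rewrite ?lerN2 ler_nat.
    - by move=> i; apply: measurable_funTS; exact: (measurable_int mu ik).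
    - by move=> i x _; rewrite lee_fin.
  have split D : measurable D -> Rintegral mu D h = Rintegral mu D h^\+ - Rintegral mu D h^\-.
    move=> mD; rewrite -RintegralB//; [|exact: igS ip|exact: igS in_].
    by apply: eq_Rintegral => x _; rewrite -{1}(funrposBneg h).
  rewrite split//; under eq_fun do rewrite split//.
  by apply: cvgB; apply: mono.
move=> [i1 i2] e e0.
have e2 : 0 < e / 2 by lra.
have /cvgrPdist_le/(_ _ e2)[N1 _ h1] := key _ i1.
have /cvgrPdist_le/(_ _ e2)[N2 _ h2] := key _ i2.
exists (maxn N1 N2) => n; rewrite geq_max => /andP[n1n n2n].
rewrite /n1 !cReImE [leRHS]splitr; exact: lerD (h1 n n1n) (h2 n n2n).
Qed.

End SquareIntegrable.

(** * The first order system and its period map *)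

Section HillSystem.
Context {R : realType}.
Local Notation C := (R[i]).
Local Notation mu := (@lebesgue_measure R).
Local Notation ig D h := (mu.-integrable D (EFin \o (h : R -> R))).
Local Notation RI a b h := (Rintegral mu (itv a b) h).
Implicit Types (k : C) (Q h y u z w : R -> C).

(* With [k = Cc - lam] and [u = y' - Q y], [isol k Q h y u] is the first order
   form of [(L(v) - lam) y = h]. *)
Definition isol k Q h y u :=
  ACd y (fun x => Q x * y x + u x) /\
  ACd u (fun x => (k - Q x ^+ 2) * y x - Q x * u x - h x).

Definition hsol k Q y u :=
  ACd y (fun x => Q x * y x + u x) /\
  ACd u (fun x => (k - Q x ^+ 2) * y x - Q x * u x).

Lemma hsol_isol k Q y u : hsol k Q y u -> isol k Q (fun=> 0) y u.
Proof. by move=> [a1 a2]; split => //; apply: eq_ACd a2 => // x; rewrite subr0. Qed.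

Lemma isol_hsol k Q y u : isol k Q (fun=> 0) y u -> hsol k Q y u.
Proof. by move=> [a1 a2]; split => //; apply: eq_ACd a2 => // x; rewrite subr0. Qed.

Lemma isolD k Q h h' y u z w : isol k Q h y u -> isol k Q h' z w ->
  isol k Q (fun x => h x + h' x) (fun x => y x + z x) (fun x => u x + w x).
Proof.
move=> [a1 a2] [b1 b2]; split.
- by apply: eq_ACd (ACdD a1 b1) => // x; ring.
- by apply: eq_ACd (ACdD a2 b2) => // x; ring.
Qed.

Lemma isolZ c k Q h y u : isol k Q h y u ->
  isol k Q (fun x => c * h x) (fun x => c * y x) (fun x => c * u x).
Proof.
move=> [a1 a2]; split.
- by apply: eq_ACd (ACdZ c a1) => // x; ring.
- by apply: eq_ACd (ACdZ c a2) => // x; ring.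
Qed.

Lemma eq_isol k Q h h' y y' u u' : h =1 h' -> y =1 y' -> u =1 u' ->
  isol k Q h y u -> isol k Q h' y' u'.
Proof. by move=> /funext -> /funext -> /funext ->. Qed.

Lemma isolB k Q h h' y u z w : isol k Q h y u -> isol k Q h' z w ->
  isol k Q (fun x => h x - h' x) (fun x => y x - z x) (fun x => u x - w x).
Proof.
by move=> s1 /(isolZ (-1)) /(isolD s1); apply: eq_isol => x; rewrite mulN1r.
Qed.

Lemma hsolZ c k Q y u : hsol k Q y u -> hsol k Q (fun x => c * y x) (fun x => c * u x).
Proof.
move=> /hsol_isol /(isolZ c) h; apply: isol_hsol; apply: eq_isol h => // x.
by rewrite mulr0.
Qed.

Lemma hsolD k Q y u z w : hsol k Q y u -> hsol k Q z w ->
  hsol k Q (fun x => y x + z x) (fun x => u x + w x).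
Proof.
move=> /hsol_isol h1 /hsol_isol h2; apply: isol_hsol.
by apply: eq_isol (isolD h1 h2) => // x; rewrite addr0.
Qed.

Lemma eq_hsol k Q y y' u u' : y =1 y' -> u =1 u' -> hsol k Q y u -> hsol k Q y' u'.
Proof. by move=> /funext -> /funext ->. Qed.

Lemma hsolB k Q y u z w : hsol k Q y u -> hsol k Q z w ->
  hsol k Q (fun x => y x - z x) (fun x => u x - w x).
Proof.
by move=> s1 /(hsolZ (-1)) /(hsolD s1); apply: eq_hsol => x; rewrite mulN1r.
Qed.

Lemma hsol_shift c k Q y u : (forall x, Q (x + c) = Q x) -> hsol k Q y u ->
  hsol k Q (fun x => y (x + c)) (fun x => u (x + c)).
Proof.
move=> Qc [a1 a2]; split.
- by apply: eq_ACd (ACd_shift c a1) => // x; rewrite Qc.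
- by apply: eq_ACd (ACd_shift c a2) => // x; rewrite Qc.
Qed.

(** Lagrange's identity in derivative form. With the quasi-derivative [u] in place of [y'], every
    term in [Q] cancels, so the rough potential does not appear in the derivative. Uniqueness, the
    determinant of the period map and the symmetry of [L(v)] all come from here. *)
Lemma wronskian_ACd k1 k2 Q h1 h2 y1 u1 y2 u2 :
  isol k1 Q h1 y1 u1 -> isol k2 Q h2 y2 u2 ->
  ACd (fun x => y1 x * u2 x - u1 x * y2 x)
    (fun x => (k2 - k1) * (y1 x * y2 x) - y1 x * h2 x + h1 x * y2 x).
Proof.
move=> [a1 a2] [b1 b2]; apply: eq_ACd (ACdB (ACdM a1 b2) (ACdM a2 b1)) => // x; ring.
Qed.

Lemma wronskian_const k Q y1 u1 y2 u2 a b : hsol k Q y1 u1 -> hsol k Q y2 u2 ->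
  y1 a * u2 a - u1 a * y2 a = y1 b * u2 b - u1 b * y2 b.
Proof.
move=> /hsol_isol s1 /hsol_isol s2.
apply: (ACd_const a b (wronskian_ACd s1 s2)) => x; ring.
Qed.

Lemma hsol_exists k Q (y0 u0 : C) : L2loc Q ->
  exists y u, [/\ hsol k Q y u, y 0 = y0 & u 0 = u0].
Proof.
move=> LQ; have L1Q := L2loc_L1 LQ.
have L2 : L1loc (fun x => k - Q x ^+ 2).
  by apply: L1locB; [exact: L1loc_cst|exact: L2locM].
have [y [u [a1 a2 e1 e2]]] :=
  linear_system_exists L1Q (L1loc_cst (1 : C)) L2 (L1locN L1Q) y0 u0.
exists y, u; split => //; split.
- by apply: eq_ACd a1 => // x; rewrite mul1r.
- by apply: eq_ACd a2 => // x; rewrite mulNr.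
Qed.

(** Cramer's rule in the fundamental system at 0, whose wronskian is 1 at every point. *)
Lemma hsol_exists_at k Q (a : R) (y0 u0 : C) : L2loc Q ->
  exists y u, [/\ hsol k Q y u, y a = y0 & u a = u0].
Proof.
move=> LQ; have [f1 [v1 [s1 e1 e2]]] := hsol_exists k 1 0 LQ.
have [f2 [v2 [s2 e3 e4]]] := hsol_exists k 0 1 LQ.
have W : f1 a * v2 a - v1 a * f2 a = 1.
  by rewrite (wronskian_const a 0 s1 s2) e1 e2 e3 e4; ring.
pose c1 := y0 * v2 a - u0 * f2 a; pose c2 := u0 * f1 a - y0 * v1 a.
exists (fun x => c1 * f1 x + c2 * f2 x), (fun x => c1 * v1 x + c2 * v2 x); split.
- by apply: hsolD; exact: hsolZ.
- by rewrite -[RHS]mulr1 -W /c1 /c2; ring.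
- by rewrite -[RHS]mulr1 -W /c1 /c2; ring.
Qed.

Lemma ACd_const_on y g a b : ACd y g ->
  (forall x, itv a b x \/ itv b a x -> g x = 0) -> y b = y a.
Proof.
move=> ay g0; case: (leP a b) => [ab|/ltW ba].
  by rewrite (ACd_incr ay ab) cint0 ?addr0// => x xi; apply: g0; left.
by rewrite (ACd_incr ay ba) cint0 ?addr0// => x xi; apply: g0; right.
Qed.

(** Uniqueness without Gronwall's inequality: the wronskian of the difference with a homogeneous
    solution is constant between [a] and [b], hence 0 at [b]; two such solutions with wronskian 1
    determine the difference. As [h] has to vanish only between [a] and [b], a solution can be
    continued beyond the support of its right-hand side. *)
Lemma isol_agree k Q h y u z w a b : L2loc Q -> isol k Q h y u -> hsol k Q z w ->
  (forall x, itv a b x \/ itv b a x -> h x = 0) -> y a = z a -> u a = w a ->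
  y b = z b /\ u b = w b.
Proof.
move=> LQ s0 t h0 ya ua.
have s : isol k Q h (fun x => y x - z x) (fun x => u x - w x).
  by apply: eq_isol (isolB s0 (hsol_isol t)) => // x; rewrite subr0.
have [f1 [v1 [s1 e1 e2]]] := hsol_exists k 1 0 LQ.
have [f2 [v2 [s2 e3 e4]]] := hsol_exists k 0 1 LQ.
have W : f1 b * v2 b - v1 b * f2 b = 1.
  by rewrite (wronskian_const b 0 s1 s2) e1 e2 e3 e4; ring.
have key f v : hsol k Q f v -> f b * (u b - w b) - v b * (y b - z b) = 0.
  move=> /hsol_isol s'.
  have /= -> := ACd_const_on (a := a) (b := b) (wronskian_ACd s' s).
    by rewrite ya ua !subrr !mulr0 subrr.
  by move=> x /h0 ->; ring.
have k1 := key _ _ s1; have k2 := key _ _ s2.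
have dy : y b - z b = 0.
  rewrite -[LHS]mul1r -W.
  transitivity (f2 b * (f1 b * (u b - w b) - v1 b * (y b - z b)) -
                f1 b * (f2 b * (u b - w b) - v2 b * (y b - z b))); first by ring.
  by rewrite k1 k2 !mulr0 subrr.
have du : u b - w b = 0.
  rewrite -[LHS]mul1r -W.
  transitivity (v2 b * (f1 b * (u b - w b) - v1 b * (y b - z b)) -
                v1 b * (f2 b * (u b - w b) - v2 b * (y b - z b))); first by ring.
  by rewrite k1 k2 !mulr0 subrr.
by split; apply/eqP; rewrite -subr_eq0; apply/eqP.
Qed.

Lemma hsol_uniq k Q y u a b : L2loc Q -> hsol k Q y u -> y a = 0 -> u a = 0 ->
  y b = 0 /\ u b = 0.
Proof.
move=> LQ s ya ua; have t := hsolZ 0 s.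
have := isol_agree (a := a) (b := b) LQ (hsol_isol s) t.
by rewrite ya ua !mul0r; apply.
Qed.

(** The coefficients [(y2 a, - y1 a)] or [(u2 a, - u1 a)] give a relation at [a] when the wronskian
    is 0 there; if both [y2 a] and [u2 a] vanish, the second solution is itself 0. Uniqueness
    carries the relation to all points. *)
Lemma hsol_wronskian_indep k Q y1 u1 y2 u2 a : L2loc Q -> hsol k Q y1 u1 ->
  hsol k Q y2 u2 -> y1 a * u2 a - u1 a * y2 a = 0 ->
  exists c1 c2 : C, (c1 != 0) || (c2 != 0) /\
    forall x, c1 * y1 x + c2 * y2 x = 0 /\ c1 * u1 x + c2 * u2 x = 0.
Proof.
move=> LQ s1 s2 W0.
have uq c1 c2 : c1 * y1 a + c2 * y2 a = 0 -> c1 * u1 a + c2 * u2 a = 0 ->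
    forall x, c1 * y1 x + c2 * y2 x = 0 /\ c1 * u1 x + c2 * u2 x = 0.
  move=> h1 h2 x.
  exact: (@hsol_uniq _ _ _ _ a x LQ (hsolD (hsolZ c1 s1) (hsolZ c2 s2)) h1 h2).
have [y20|y20] := eqVneq (y2 a) 0; last first.
  exists (y2 a), (- y1 a); split; first by rewrite y20.
  by apply: uq; [ring|rewrite -[RHS]oppr0 -W0; ring].
have [u20|u20] := eqVneq (u2 a) 0; last first.
  exists (u2 a), (- u1 a); split; first by rewrite u20.
  by apply: uq; [rewrite -[RHS]W0; ring|ring].
exists 0, 1; split; first by rewrite oner_neq0 orbT.
by apply: uq; rewrite ?y20 ?u20; ring.
Qed.

(** * Periodic coefficients: the period map and the Liouville property *)

Section Periodic.
Variables (k : C) (Q : R -> C).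
Hypotheses (Qpi : forall x, Q (x + pi) = Q x) (LQ : L2loc Q).

Lemma Qpi' x : Q (x - pi) = Q x.
Proof. by rewrite -[in RHS](subrK pi x) Qpi. Qed.

Variables (f1 v1 f2 v2 : R -> C).
Hypotheses (s1 : hsol k Q f1 v1) (s2 : hsol k Q f2 v2).
Hypotheses (e1 : f1 0 = 1) (e2 : v1 0 = 0) (e3 : f2 0 = 0) (e4 : v2 0 = 1).

Let D := f1 pi + v2 pi.

Lemma hsol_basis y u x : hsol k Q y u ->
  y x = y 0 * f1 x + u 0 * f2 x /\ u x = y 0 * v1 x + u 0 * v2 x.
Proof.
move=> s; have t := hsolD (hsolZ (y 0) s1) (hsolZ (u 0) s2).
have := isol_agree (a := 0) (b := x) LQ (hsol_isol s) t.
by apply => //; rewrite ?e1 ?e2 ?e3 ?e4; ring.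
Qed.

(** Cayley-Hamilton for the period map, of trace [D] and determinant 1: the left-hand sides form a
    homogeneous solution whose data at 0 are multiples of [1 - det]. *)
Lemma floquet_recurrence y u x : hsol k Q y u ->
  y (x + pi + pi) - D * y (x + pi) + y x = 0 /\
  u (x + pi + pi) - D * u (x + pi) + u x = 0.
Proof.
move=> s; have t := hsol_shift Qpi s; have t2 := hsol_shift Qpi t.
have z := hsolD (hsolB t2 (hsolZ D t)) s.
have W : f1 pi * v2 pi - v1 pi * f2 pi = 1.
  by rewrite (wronskian_const pi 0 s1 s2) e1 e2 e3 e4; ring.
apply: (@hsol_uniq _ _ _ _ 0 x LQ z); rewrite /= !add0r.
- have [-> _] := hsol_basis pi t; have [p1 p2] := hsol_basis pi s.
  rewrite /= !add0r p1 p2.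
  rewrite /D; transitivity (y 0 * (1 - (f1 pi * v2 pi - v1 pi * f2 pi))); first by ring.
  by rewrite W subrr mulr0.
- have [_ ->] := hsol_basis pi t; have [p1 p2] := hsol_basis pi s.
  rewrite /= !add0r p1 p2.
  rewrite /D; transitivity (u 0 * (1 - (f1 pi * v2 pi - v1 pi * f2 pi))); first by ring.
  by rewrite W subrr mulr0.
Qed.

Definition energy y u (x : R) : R := sqmod (y x) + sqmod (u x).

Lemma energy_ge0 y u x : 0 <= energy y u x.
Proof. by rewrite addr_ge0// sqmod_ge0. Qed.

Lemma sqmod_ig_AC y g a b : ACd y g -> ig (itv a b) (sqmod \o y).
Proof.
move=> ay; have [M hM] := ACd_bounded a b ay.
apply: (@ig_dom _ _ _ (fun=> M ^+ 2)) => //; last exact: ig_cst.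
  exact: meas_sqmod (ACd_meas ay).
move=> x abx /=; rewrite ger0_norm ?sqmod_ge0// (le_trans (sqmod_n1 _))//.
have := hM x abx; have := n1_ge0 (y x) => p q.
by rewrite lerXn2r// nnegrE (le_trans p).
Qed.

Lemma energy_ig y u a b : hsol k Q y u -> ig (itv a b) (energy y u).
Proof. by move=> [a1 a2]; apply: igD => //; [exact: sqmod_ig_AC a1|exact: sqmod_ig_AC a2]. Qed.

Lemma energy_meas y u : hsol k Q y u -> measurable_fun setT (energy y u).
Proof.
by move=> [a1 a2]; apply: measurable_funD;
  [exact: meas_sqmod (ACd_meas a1)|exact: meas_sqmod (ACd_meas a2)].
Qed.

(** A nonnegative function of integral 0 vanishes almost everywhere on [[0, pi]], hence at some
    point because [pi > 0]; uniqueness does the rest. *)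
Lemma energy_eq0 y u : hsol k Q y u -> RI 0 pi (energy y u) = 0 ->
  forall x, y x = 0 /\ u x = 0.
Proof.
move=> s I0.
have [x0 h0] : exists x0, energy y u x0 = 0.
  have i := energy_ig 0 pi s.
  have : (\int[mu]_(x in itv 0 pi) `|(EFin \o energy y u) x| = 0)%E.
    under eq_integral do rewrite /= ger0_norm ?energy_ge0//.
    rewrite -[LHS]fineK; last exact: ig_fin.
    by congr EFin.
  move/(ae_eq_integral_abs mu (meas_itv 0 pi) (measurable_int mu i)) => h.
  apply: contrapT => nex.
  have : mu (itv 0 pi) = 0%E.
    apply: (measure_negligible (mu := mu)) => //.
    apply: negligibleS h => x xi /= /(_ xi) [] ex; apply: nex; by exists x.
  rewrite mu_itv pi_gt0 subr0 => -[] /eqP.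
  by rewrite gt_eqF// pi_gt0.
have [y0 u0] : y x0 = 0 /\ u x0 = 0.
  move/eqP: h0; rewrite paddr_eq0 ?sqmod_ge0// => /andP[/eqP h1 /eqP h2].
  by split; exact: sqmod_eq0.
by move=> x; exact: (hsol_uniq x LQ s y0 u0).
Qed.

Lemma const_sum_bounded (a B : R) : 0 <= a -> (forall N : nat, a *+ N <= B) -> a = 0.
Proof.
move=> a0 h; apply/eqP; rewrite eq_le a0 andbT leNgt; apply/negP => ap.
have := h (Num.truncn (B / a)).+1; have := truncnS_gt (B / a).
by rewrite ltr_pdivrMr// mulr_natl => h1 /(lt_le_trans h1); rewrite ltxx.
Qed.

Lemma sqmod_iter_shift (f : R -> C) (c : R) (r : C) (n : nat) x : sqmod r = 1 ->
  (forall x, f (x + c) = r * f x) -> sqmod (f (x + c *+ n)) = sqmod (f x).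
Proof.
move=> r1 h; elim: n => [|n IH]; first by rewrite mulr0n addr0.
by rewrite (mulrSr c) addrA h sqmodM r1 mul1r.
Qed.

(* [w = y(. + c) - rho y] satisfies [w(. + c) = rho^-1 w]; for |rho| = 1 the
   energy of [w] per period is constant, hence 0, and then so is that of [y]. *)
Lemma liouville (rho : C) (c B : R) y u : sqmod rho = 1 ->
  (forall x, Q (x + c) = Q x) -> hsol k Q y u ->
  (forall z w x, hsol k Q z w ->
    z (x + c + c) - (rho + rho^-1) * z (x + c) + z x = 0 /\
    w (x + c + c) - (rho + rho^-1) * w (x + c) + w x = 0) ->
  (forall N : nat, \sum_(n < N) RI 0 pi (fun x => energy y u (x + c *+ n)) <= B) ->
  forall x, y x = 0 /\ u x = 0.
Proof.
move=> rho1 Qc s rec hB.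
have rho0 : rho != 0.
  by apply/eqP => r0; move: rho1; rewrite r0 sqmod0 => /esym/eqP; rewrite oner_eq0.
have rhoV1 : sqmod rho^-1 = 1.
  have : sqmod (rho * rho^-1) = 1 by rewrite divff// sqmod1.
  by rewrite sqmodM rho1 mul1r.
have Qcn n x : Q (x + c *+ n) = Q x.
  by elim: n => [|n IH]; rewrite ?mulr0n ?addr0// mulrSr addrA Qc.
have iE n : ig (itv 0 pi) (fun x => energy y u (x + c *+ n)).
  exact: (energy_ig 0 pi (hsol_shift (Qcn n) s)).
have E0 n : 0 <= RI 0 pi (fun x => energy y u (x + c *+ n)).
  by apply: RI_ge0 => x; exact: energy_ge0.
pose z x := y (x + c) - rho * y x; pose w x := u (x + c) - rho * u x.
have sw : hsol k Q z w by apply: hsolB; [exact: hsol_shift|exact: hsolZ].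
have zc x : z (x + c) = rho^-1 * z x.
  have [r _] := rec _ _ x s; apply/eqP; rewrite -subr_eq0 -[0]r /z.
  by apply/eqP; field.
have wc x : w (x + c) = rho^-1 * w x.
  have [_ r] := rec _ _ x s; apply/eqP; rewrite -subr_eq0 -[0]r /w.
  by apply/eqP; field.
(* The constant [4 * B]: [|z|^2] is at most [2 |y(. + c)|^2 + 2 |rho y|^2], likewise for [w], and
   the shifted and unshifted sums of energies are each at most [B]. *)
have zw0 : forall x, z x = 0 /\ w x = 0.
  apply: (energy_eq0 sw); apply: (@const_sum_bounded _ (4 * B)).
    by apply: RI_ge0 => x; exact: energy_ge0.
  move=> N.
  have e n : RI 0 pi (energy z w) <=
      2 * RI 0 pi (fun x => energy y u (x + c *+ n.+1)) +
      2 * RI 0 pi (fun x => energy y u (x + c *+ n)).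
    rewrite -!RintegralZl// -RintegralD//; [|exact: igZ..].
    apply: RI_le => //; first exact: energy_ig.
      by apply: igD => //; exact: igZ.
    move=> x _.
    have -> : energy z w x = energy z w (x + c *+ n).
      rewrite /energy; congr (_ + _); apply/esym.
        exact: sqmod_iter_shift rhoV1 zc.
      exact: sqmod_iter_shift rhoV1 wc.
    rewrite /energy /z /w (mulrSr c) (addrA x).
    have := sqmodB_le (y (x + c *+ n + c)) (rho * y (x + c *+ n)).
    have := sqmodB_le (u (x + c *+ n + c)) (rho * u (x + c *+ n)).
    by rewrite !(sqmodM rho) rho1 !mul1r; lra.
  have -> : RI 0 pi (energy z w) *+ N = \sum_(i < N) RI 0 pi (energy z w).
    by rewrite sumr_const card_ord.
  have le1 : \sum_(i < N) RI 0 pi (fun x => energy y u (x + c *+ i.+1)) <= B.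
    have := hB N.+1; rewrite big_ord_recl /= => h.
    by apply: (le_trans _ h); rewrite lerDr.
  have le2 := hB N.
  apply: (@le_trans _ _ (2 * (\sum_(i < N) RI 0 pi (fun x => energy y u (x + c *+ i.+1))) +
     2 * \sum_(i < N) RI 0 pi (fun x => energy y u (x + c *+ i)))); last by lra.
  rewrite !mulr_sumr -big_split/=; apply: ler_sum => i _; exact: e.
have yc x : y (x + c) = rho * y x.
  by apply/eqP; rewrite -subr_eq0; apply/eqP; exact: (zw0 x).1.
have uc x : u (x + c) = rho * u x.
  by apply/eqP; rewrite -subr_eq0; apply/eqP; exact: (zw0 x).2.
apply: (energy_eq0 s); apply: (@const_sum_bounded _ B).
  by apply: RI_ge0 => x; exact: energy_ge0.
move=> N; apply: (le_trans _ (hB N)).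
have -> : RI 0 pi (energy y u) *+ N = \sum_(i < N) RI 0 pi (energy y u).
  by rewrite sumr_const card_ord.
apply: ler_sum => i _; rewrite le_eqVlt; apply/orP; left; apply/eqP.
apply: eq_Rintegral => x _; rewrite /energy; congr (_ + _); apply/esym.
  exact: sqmod_iter_shift rho1 yc.
exact: sqmod_iter_shift rho1 uc.
Qed.

Lemma sum_RI_right y u (N : nat) : hsol k Q y u ->
  \sum_(n < N) RI 0 pi (fun x => energy y u (x + pi *+ n)) = RI 0 (pi *+ N) (energy y u).
Proof.
move=> s; elim: N => [|N IH]; first by rewrite big_ord0 mulr0n RI_itv1.
rewrite big_ord_recr /= IH (@RI_split _ 0 (pi *+ N) (pi *+ N.+1)).
- by rewrite RI_shift ?add0r ?mulrS//; exact: energy_meas s.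
- by rewrite mulrn_wge0// pi_ge0.
- by rewrite mulrSr lerDl pi_ge0.
- exact: energy_ig s.
Qed.

Lemma sum_RI_left y u (N : nat) : hsol k Q y u ->
  \sum_(n < N) RI 0 pi (fun x => energy y u (x + (- pi) *+ n)) =
  RI (pi - pi *+ N) pi (energy y u).
Proof.
move=> s; elim: N => [|N IH]; first by rewrite big_ord0 mulr0n subr0 RI_itv1.
rewrite big_ord_recr /= IH (@RI_split _ (pi - pi *+ N.+1) (pi - pi *+ N) pi).
- rewrite addrC RI_shift; last exact: energy_meas s.
  by rewrite add0r mulNrn mulrS opprD addrA subrr add0r.
- by rewrite lerD2l lerN2 mulrSr lerDl pi_ge0.
- by rewrite gerBl mulrn_wge0// pi_ge0.
- exact: energy_ig s.
Qed.

Variable (rho : C).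
Hypotheses (rho1 : sqmod rho = 1) (rhoD : rho + rho^-1 = D).

Lemma liouville_right y u (B : R) : hsol k Q y u ->
  (forall b, 0 <= b -> RI 0 b (energy y u) <= B) -> forall x, y x = 0 /\ u x = 0.
Proof.
move=> s hB; apply: (@liouville rho pi B) => //.
  by move=> z w x; rewrite rhoD; exact: floquet_recurrence.
by move=> N; rewrite sum_RI_right// hB// mulrn_wge0// pi_ge0.
Qed.

Lemma liouville_left y u (B : R) : hsol k Q y u ->
  (forall a, a <= 0 -> RI a 0 (energy y u) <= B) -> forall x, y x = 0 /\ u x = 0.
Proof.
(* The translates of [[0, pi]] by [- pi *+ n] start with [[0, pi]] itself, hence the additional
   energy of one period in the bound. *)
move=> s hB; apply: (@liouville rho (- pi) (B + RI 0 pi (energy y u))) => //.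
- exact: Qpi'.
(* The outer coefficients of the recurrence are both 1, so it reads the same backwards. *)
- move=> z w x t; rewrite rhoD.
  have := floquet_recurrence (x - pi - pi) t; rewrite !subrK => -[h1 h2].
  by split; [rewrite -[RHS]h1; ring|rewrite -[RHS]h2; ring].
- have p0 : 0 <= RI 0 pi (energy y u) by apply: RI_ge0 => x; exact: energy_ge0.
  have B0 : 0 <= B by have := hB 0 (lexx _); rewrite RI_itv1.
  move=> [|N]; first by rewrite big_ord0 addr_ge0.
  have le0 : pi - pi *+ N.+1 <= 0 :> R.
    by rewrite mulrS opprD addrA subrr add0r oppr_le0 mulrn_wge0// pi_ge0.
  rewrite sum_RI_left// (@RI_split _ _ 0 pi)//.
  + by rewrite lerD2r hB.
  + exact: pi_ge0.
  + exact: energy_ig s.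
Qed.

End Periodic.
End HillSystem.

(** * Floquet solutions *)

Section Multipliers.
Context {R : realType}.
Local Notation C := (R[i]).
Local Notation "x %:C" := (real_complex R x).
Implicit Types (r D : C).

Lemma multiplier_exists D : exists r, r != 0 /\ r + r^-1 = D.
Proof.
pose s := sqrtc (D ^+ 2 - 4); have s2 : s ^+ 2 = D ^+ 2 - 4 by exact: sqr_sqrtc.
pose r := (D + s) / 2.
have rr : r * (D - r) = 1.
  transitivity ((D ^+ 2 - s ^+ 2) / 4); first by rewrite /r; field.
  by rewrite s2; field.
have r0 : r != 0.
  by apply/eqP => r0; move/eqP: rr; rewrite r0 mul0r eq_sym oner_eq0.
exists r; split => //.
have -> : r^-1 = D - r by apply: (mulfI r0); rewrite divff// rr.
by rewrite addrC subrK.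
Qed.

Lemma sqmodV r : r != 0 -> sqmod r^-1 = (sqmod r)^-1.
Proof.
move=> r0; have s0 : sqmod r != 0.
  by apply/eqP => /sqmod_eq0 e; move: r0; rewrite e eqxx.
by apply: (mulfI s0); rewrite -sqmodM !divff// sqmod1.
Qed.

Lemma multiplier_le1 D : exists r, [/\ r != 0, r + r^-1 = D & sqmod r <= 1].
Proof.
have [r [r0 rD]] := multiplier_exists D.
case: (leP (sqmod r) 1) => h; first by exists r.
exists r^-1; split; first by rewrite invr_eq0.
  by rewrite invrK addrC.
by rewrite sqmodV// invf_le1 ?ltW// (lt_trans ltr01).
Qed.

(** On the unit circle [r^-1] is the conjugate of [r], so the sum is [2 Re r], and [theta] is the
    arc cosine of [Re r], which already lies in [[0, pi]]. *)
Lemma unimodular_cos r : sqmod r = 1 ->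
  exists theta : R, 0 <= theta < 2 * pi /\ r + r^-1 = (2 * cos theta)%:C.
Proof.
move=> r1.
have r0 : r != 0 by apply/eqP => e; move/eqP: r1; rewrite e sqmod0 eq_sym oner_eq0.
have rV : r^-1 = r^* by apply: (mulfI r0); rewrite divff// mulJ_sqmod r1.
have le : -1 <= cRe r <= 1.
  have : cRe r ^+ 2 <= 1 by rewrite -r1 lerDl sqr_ge0.
  by move: (cRe r) => a h; apply/andP; split; nra.
exists (acos (cRe r)); split.
  rewrite acos_ge0//=; apply: (le_lt_trans (acos_lepi le)).
  by have := pi_gt0 R; lra.
rewrite acosK ?in_itv//= rV; apply: ceq; rewrite !cReImE /=; ring.
Qed.

(** [r] is a root of [X^2 - 2 cos(theta) X + 1], which factors over [exp(i theta)] and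
    [exp(- i theta)]. *)
Lemma cos_unimodular r (theta : R) : r != 0 -> r + r^-1 = (2 * cos theta)%:C ->
  sqmod r = 1.
Proof.
move=> r0 rD.
have : (r - Complex (cos theta) (sin theta)) * (r - Complex (cos theta) (- sin theta)) = 0.
  have -> : (r - Complex (cos theta) (sin theta)) * (r - Complex (cos theta) (- sin theta)) =
     r ^+ 2 - r * (Complex (cos theta) (sin theta) + Complex (cos theta) (- sin theta)) +
     Complex (cos theta) (sin theta) * Complex (cos theta) (- sin theta) by ring.
  have -> : Complex (cos theta) (sin theta) + Complex (cos theta) (- sin theta) = r + r^-1.
    by rewrite rD; apply: ceq; rewrite !cReImE /=; ring.
  have -> : Complex (cos theta) (sin theta) * Complex (cos theta) (- sin theta) = 1.
    apply: ceq; rewrite !cReImE /=; last by ring.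
    by rewrite mulrN opprK -!expr2 cos2Dsin2.
  by field.
have cs s : s ^+ 2 = sin theta ^+ 2 -> r - Complex (cos theta) s = 0 -> sqmod r = 1.
  move=> s2 /eqP; rewrite subr_eq0 => /eqP ->.
  by rewrite /sqmod /= s2 cos2Dsin2.
by move/eqP; rewrite mulf_eq0 => /orP[] /eqP; apply: cs; rewrite ?sqrrN.
Qed.

End Multipliers.

(** * Solutions multiplied by a constant over each period, and their absence on the unit circle *)

Section FloquetSolutions.
Context {R : realType}.
Local Notation C := (R[i]).
Local Notation mu := (@lebesgue_measure R).
Local Notation ig D h := (mu.-integrable D (EFin \o (h : R -> R))).
Local Notation RI a b h := (Rintegral mu (itv a b) h).
Local Notation "x %:C" := (real_complex R x).

Lemma L2locD (f g : R -> C) : L2loc f -> L2loc g -> L2loc (fun x => f x + g x).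
Proof.
move=> /L2locP[mf hf] /L2locP[mg hg]; apply/L2locP; split; first exact: cmeasD.
move=> a b; split; first exact: cmeasD.
apply: (@ig_dom _ _ _ (fun x => 2 * sqmod (f x) + 2 * sqmod (g x))) => //.
- by apply: meas_sqmod; exact: cmeasD.
- by move=> x _ /=; rewrite ger0_norm ?sqmod_ge0// sqmodD_le.
- by apply: igD => //; apply: igZ => //; [exact: (hf a b).2|exact: (hg a b).2].
Qed.

Lemma ACd_L2loc (y g : R -> C) : ACd y g -> L2loc y.
Proof.
move=> ay; apply/L2locP; split=> [|a b]; first exact: ACd_meas ay.
by split; [exact: ACd_meas ay|exact: sqmod_ig_AC ay].
Qed.

Lemma ACd_L2locM (y g f : R -> C) : ACd y g -> L2loc f -> L2loc (fun x => f x * y x).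
Proof.
move=> ay /L2locP[mf hf]; have my := ACd_meas ay.
have m : cmeasurable (fun x => f x * y x) by exact: cmeasM.
apply/L2locP; split => // a b; split => //.
have [M hM] := ACd_bounded a b ay.
apply: (@ig_dom _ _ _ (fun x => M ^+ 2 * sqmod (f x))) => //.
- exact: meas_sqmod.
- move=> x abx /=; rewrite ger0_norm ?sqmod_ge0// sqmodM mulrC ler_wpM2r ?sqmod_ge0//.
  apply: (le_trans (sqmod_n1 _)); have p := n1_ge0 (y x); have := hM x abx => q.
  by rewrite lerXn2r// nnegrE (le_trans p).
- by apply: igZ => //; exact: (hf a b).2.
Qed.

Variable (Q : R -> C).
Hypotheses (Qpi : forall x, Q (x + pi) = Q x) (LQ : L2loc Q).

Definition multiplicative (r : C) (y u : R -> C) :=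
  (forall x, y (x + pi) = r * y x) /\ (forall x, u (x + pi) = r * u x).

Section Fixed.
Variable k : C.
Variables (f1 v1 f2 v2 : R -> C).
Hypotheses (s1 : hsol k Q f1 v1) (s2 : hsol k Q f2 v2).
Hypotheses (e1 : f1 0 = 1) (e2 : v1 0 = 0) (e3 : f2 0 = 0) (e4 : v2 0 = 1).

(** With [M] the period map, the recurrence says [(M - r) (M - r^-1) = 0]. Anything in the image of
    [M - r^-1] is therefore multiplied by [r]; if this image is 0, then [M] is the scalar [r^-1]. *)
Lemma floquet_dichotomy (r : C) : r != 0 -> r + r^-1 = f1 pi + v2 pi ->
  (exists y u x, [/\ hsol k Q y u, multiplicative r y u & (y x != 0) || (u x != 0)]) \/
  (forall y u, hsol k Q y u -> multiplicative r^-1 y u).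
Proof.
move=> r0 rD.
have [[y [u [x [s ne]]]]|nex] := pselect (exists y u x, hsol k Q y u /\
    ((y (x + pi) - r^-1 * y x != 0) || (u (x + pi) - r^-1 * u x != 0))).
  left; exists (fun x => y (x + pi) - r^-1 * y x), (fun x => u (x + pi) - r^-1 * u x), x.
  split => //; first by apply: hsolB; [exact: hsol_shift|exact: hsolZ].
  have rec t := floquet_recurrence Qpi LQ s1 s2 e1 e2 e3 e4 t s.
  split => t; apply/eqP; rewrite -subr_eq0; apply/eqP.
    by have [<- _] := rec t; rewrite -rD; field.
  by have [_ <-] := rec t; rewrite -rD; field.
right => y u s; split => x; apply/eqP; rewrite -subr_eq0; apply/negPn/negP => h;
  by apply: nex; exists y, u, x; rewrite h ?orbT.
Qed.

(** A scalar period map [r^-1] would have trace [2 r^-1], which forces [r = r^-1]. *)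
Lemma floquet_exists (r : C) : r != 0 -> r + r^-1 = f1 pi + v2 pi -> r != r^-1 ->
  exists y u x, [/\ hsol k Q y u, multiplicative r y u & (y x != 0) || (u x != 0)].
Proof.
move=> r0 rD rr; have [//|h] := floquet_dichotomy r0 rD.
have [h1 _] := h _ _ s1; have [_ h2] := h _ _ s2.
move: rD; rewrite -[in f1 pi](add0r pi) -[in v2 pi](add0r pi) h1 h2 e1 e4 mulr1.
by move=> /addIr e; move: rr; rewrite -e eqxx.
Qed.

(** The version that also covers [r = r^-1]: either branch of the dichotomy supplies a nonzero
    solution for one of the two multipliers. *)
Lemma floquet_exists_any (r : C) : r != 0 -> r + r^-1 = f1 pi + v2 pi ->
  exists y u x r', [/\ hsol k Q y u, multiplicative r' y u, r' = r \/ r' = r^-1 &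
    (y x != 0) || (u x != 0)].
Proof.
move=> r0 rD; have [[y [u [x [s m ne]]]]|h] := floquet_dichotomy r0 rD.
  by exists y, u, x, r; split => //; left.
exists f1, v1, 0, r^-1; split => //; [exact: h|by right|by rewrite e1 oner_neq0].
Qed.

End Fixed.

(** AM-GM weighted so that the perturbation consumes only half of the term [|g|^2] of the energy
    form. *)
Lemma cRe_mulJ_le (q g y : C) :
  `|cRe (q * (g * y^* + y * g^*))| <= sqmod g / 2 + 2 * (sqmod q * sqmod y).
Proof.
have -> : cRe (q * (g * y^* + y * g^*)) = 2 * cRe q * (cRe g * cRe y + cIm g * cIm y).
  by rewrite !cReImE; ring.
have h : cRe q ^+ 2 * sqmod y <= sqmod q * sqmod y.
  by rewrite ler_wpM2r ?sqmod_ge0// lerDl sqr_ge0.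
rewrite /sqmod in h *.
move: h; move: (cRe q) (cIm q) (cRe g) (cIm g) (cRe y) (cIm y) => a a' b b' c c' h.
rewrite ler_norml; apply/andP; split.
  have := sqr_ge0 (b + 2 * a * c); have := sqr_ge0 (b' + 2 * a * c'); nra.
have := sqr_ge0 (b - 2 * a * c); have := sqr_ge0 (b' - 2 * a * c'); nra.
Qed.

(** Here [q y + u] is [y'], and the left-hand side is the real part of the derivative of
    [u * conj y]. The last term is [Re (Q (|y|^2)')], that is, the potential [Q'] integrated by
    parts. *)
Lemma energy_identity (K : R) (q y u : C) :
  cRe (((K%:C - q ^+ 2) * y - q * u) * y^* + u * (q * y + u)^*) =
  K * sqmod y + sqmod (q * y + u) - cRe (q * ((q * y + u) * y^* + y * (q * y + u)^*)).
Proof. by rewrite /sqmod (expr2 q) !cReImE; ring. Qed.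

Lemma sqmod_sup_le (y g : R -> C) (e x : R) : 0 < e -> ACd y g -> L2loc g ->
  itv 0 pi x ->
  sqmod (y x) <= RI 0 pi (sqmod \o y) / pi +
    (e * RI 0 pi (sqmod \o g) + RI 0 pi (sqmod \o y) / e) * 2.
Proof.
move=> e0 ay /L2locP[mg hg] xi.
have ig_g := (hg 0 pi).2; have ig_y := sqmod_ig_AC 0 pi ay.
have p0 : 0 < pi :> R := pi_gt0 R.
have aJ := ACdJ ay; have ayy := ACdM ay aJ.
set B := (X in _ <= _ + X).
have hk t : n1 (g t * (y t)^* + y t * (g t)^*) <=
    (e * sqmod (g t) + sqmod (y t) / e) * 2.
  apply: (le_trans (n1D _ _)); rewrite [leRHS]mulr_natr mulr2n; apply: lerD.
    by rewrite -(sqmodJ (y t)) n1M_le.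
  by rewrite mulrC -(sqmodJ (g t)) n1M_le.
have igB : ig (itv 0 pi) (fun t => (e * sqmod (g t) + sqmod (y t) / e) * 2).
  apply: (@eq_ig _ _ (fun t => 2 * (e * sqmod (g t) + e^-1 * sqmod (y t)))).
    by move=> t; rewrite mulrC (mulrC e^-1).
  by apply: igZ => //; apply: igD => //; exact: igZ.
have EB : RI 0 pi (fun t => (e * sqmod (g t) + sqmod (y t) / e) * 2) = B.
  rewrite /B; transitivity (RI 0 pi (fun t => 2 * (e * sqmod (g t) + e^-1 * sqmod (y t)))).
    by apply: eq_Rintegral => t _; rewrite mulrC (mulrC e^-1).
  rewrite RintegralZl//; last by apply: igD => //; exact: igZ.
  rewrite RintegralD//; [|exact: igZ|exact: igZ].
  by rewrite !RintegralZl// [RHS]mulrC (mulrC e^-1).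
have le t : itv 0 pi t -> sqmod (y x) <= sqmod (y t) + B.
  move=> ti.
  have inc a b : 0 <= a -> a <= b -> b <= pi -> `|sqmod (y b) - sqmod (y a)| <= B.
    move=> a0 ab bp.
    have -> : sqmod (y b) - sqmod (y a) = cRe (y b * (y b)^* - y a * (y a)^*).
      by rewrite !mulJ_sqmod -rmorphB cRe_real.
    apply: (le_trans (cRe_n1 _)); apply: (le_trans (n1_incr ayy a0 ab bp)).
    rewrite -EB; apply: RI_le => //; first exact: L1loc_n1 (ACd_L1loc ayy).
    by move=> s _; exact: hk.
  have [xt|/ltW tx] := leP x t.
    move: xi ti => /andP[x0 _] /andP[_ tp].
    by have := inc _ _ x0 xt tp; rewrite ler_norml => /andP[]; lra.
  move: xi ti => /andP[_ xp] /andP[t0 _].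
  by have := inc _ _ t0 tx xp; rewrite ler_norml => /andP[]; lra.
have := @RI_le _ (itv 0 pi) (fun=> sqmod (y x)) (fun t => sqmod (y t) + B)
  (meas_itv _ _) (ig_cst _ _ _) (igD (meas_itv _ _) ig_y (ig_cst _ _ _)) le.
rewrite RI_cst ?(ltW p0)// RintegralD//; last exact: ig_cst.
rewrite RI_cst ?(ltW p0)// subr0.
move=> h; rewrite -(ler_pM2r p0) [leRHS]mulrDl divfK ?gt_eqF//; exact: h.
Qed.

(** For a unimodular multiplier the real part of the energy form over one period is 0, while for
    large [K] the form is coercive in [y] and [y']. *)
Lemma floquet_no_unimodular : exists K0 : R, forall K : R, K0 <= K ->
  forall (r : C) (y u : R -> C), sqmod r = 1 -> hsol K%:C Q y u ->
  multiplicative r y u -> forall x, y x = 0 /\ u x = 0.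
Proof.
have p0 : 0 < pi :> R := pi_gt0 R.
have [mQ hQ] := (L2locP Q).1 LQ.
set q := RI 0 pi (sqmod \o Q).
have q0 : 0 <= q by apply: RI_ge0 => x; exact: sqmod_ge0.
(* This [e] keeps the coefficient [1/2 - 4 q e] of [G] at least [1/4]; the threshold for [K] below
   makes the coefficient of [A] at least 1. *)
pose e : R := (16 * q + 1)^-1.
have e0 : 0 < e by rewrite invr_gt0; lra.
exists (2 * q / pi + 4 * q / e + 1) => K hK r y u r1 s [my mu_].
have [a1 a2] := s.
pose g x := Q x * y x + u x.
have Lg : L2loc g by apply: L2locD; [exact: ACd_L2locM a1 LQ|exact: ACd_L2loc a2].
set A := RI 0 pi (sqmod \o y); set G := RI 0 pi (sqmod \o g).
have A0 : 0 <= A by apply: RI_ge0 => x; exact: sqmod_ge0.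
have G0 : 0 <= G by apply: RI_ge0 => x; exact: sqmod_ge0.
pose S := A / pi + (e * G + A / e) * 2.
have iy := sqmod_ig_AC 0 pi a1.
have ig_g := ((L2locP g).1 Lg).2 0 pi.
have iQ := hQ 0 pi.
have hS x : itv 0 pi x -> sqmod (y x) <= S by exact: sqmod_sup_le.
have aW := ACdM a2 (ACdJ a1).
pose w x := K * sqmod (y x) + sqmod (g x) - cRe (Q x * (g x * (y x)^* + y x * (g x)^*)).
have iQy : ig (itv 0 pi) (fun x => sqmod (Q x) * sqmod (y x)).
  by apply: eq_ig ((((L2locP _).1 (ACd_L2locM a1 LQ)).2 0 pi).2) => x /=; rewrite sqmodM.
have mQgy : cmeasurable (fun x => Q x * (g x * (y x)^* + y x * (g x)^*)).
  have m1 := ACd_meas a1; have m2 : cmeasurable g by case: Lg.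
  by apply: cmeasM => //; apply: cmeasD; apply: cmeasM => //; exact: cmeasJ.
have ibd : ig (itv 0 pi) (fun x => sqmod (g x) / 2 + 2 * (sqmod (Q x) * sqmod (y x))).
  apply: igD => //; last exact: igZ.
  by apply: (@eq_ig _ _ (fun x => 2^-1 * sqmod (g x))) => [x|]; [rewrite mulrC|exact: igZ ig_g.2].
have iC : ig (itv 0 pi) (fun x => cRe (Q x * (g x * (y x)^* + y x * (g x)^*))).
  apply: ig_dom ibd => //; first by case: mQgy.
  by move=> x _; exact: cRe_mulJ_le.
(* [u * conj y] is multiplied by [|r|^2 = 1] over a period, so its increment is 0. *)
have W0 : RI 0 pi w = 0.
  have := congr1 (@cRe R) (ACd_incr aW (ltW p0)).
  rewrite -[in u pi](add0r pi) -[in y pi](add0r pi) my mu_.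
  have -> : r * u 0 * (r * y 0)^* = u 0 * (y 0)^*.
    rewrite rmorphM; transitivity ((r * r^*) * (u 0 * (y 0)^*)); first by ring.
    by rewrite mulJ_sqmod r1 mul1r.
  rewrite cReD -[X in X = _ -> _]addr0 => /addrI/esym E.
  rewrite -[RHS]E /=.
  by apply: eq_Rintegral => x _ /=; rewrite energy_identity.
have iKy : ig (itv 0 pi) (fun x => K * sqmod (y x)) by exact: (igZ K (meas_itv 0 pi) iy).
have igg : ig (itv 0 pi) (fun x => sqmod (g x)) by exact: ig_g.2.
have iKg := igD (meas_itv 0 pi) iKy igg.
have iQ2 : ig (itv 0 pi) (fun x => 2 * (sqmod (Q x) * sqmod (y x))).
  by exact: (igZ 2 (meas_itv 0 pi) iQy).
have W1 : K * A + G / 2 - 2 * RI 0 pi (fun x => sqmod (Q x) * sqmod (y x)) <= 0.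
  rewrite -[leRHS]W0.
  have -> : K * A + G / 2 - 2 * RI 0 pi (fun x => sqmod (Q x) * sqmod (y x)) =
    RI 0 pi (fun x => K * sqmod (y x) + sqmod (g x) -
      (sqmod (g x) / 2 + 2 * (sqmod (Q x) * sqmod (y x)))).
    have ih : ig (itv 0 pi) (fun x => sqmod (g x) / 2).
      by apply: (@eq_ig _ _ (fun x => 2^-1 * sqmod (g x))) => [x|]; [rewrite mulrC|exact: igZ ig_g.2].
    have ED : RI 0 pi (fun x => K * sqmod (y x) + sqmod (g x)) =
        RI 0 pi (fun x => K * sqmod (y x)) + RI 0 pi (fun x => sqmod (g x)) by rewrite RintegralD.
    have ED' : RI 0 pi (fun x => sqmod (g x) / 2 + 2 * (sqmod (Q x) * sqmod (y x))) =
        RI 0 pi (fun x => sqmod (g x) / 2) + RI 0 pi (fun x => 2 * (sqmod (Q x) * sqmod (y x))).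
      by rewrite RintegralD.
    rewrite RintegralB// ED ED'.
    have EK : RI 0 pi (fun x => K * sqmod (y x)) = K * A by rewrite RintegralZl.
    have EQ : RI 0 pi (fun x => 2 * (sqmod (Q x) * sqmod (y x))) =
        2 * RI 0 pi (fun x => sqmod (Q x) * sqmod (y x)) by rewrite RintegralZl.
    have EG : RI 0 pi (fun x => sqmod (g x) / 2) = G / 2 by rewrite RintegralZr.
    have EG1 : RI 0 pi (fun x => sqmod (g x)) = G by [].
    by rewrite EK EQ EG EG1; field.
  apply: RI_le => //.
  - exact: igB.
  - exact: igB.
  - move=> x _; rewrite /w; have := cRe_mulJ_le (Q x) (g x) (y x).
    by rewrite ler_norml => /andP[_]; lra.
have QyS : RI 0 pi (fun x => sqmod (Q x) * sqmod (y x)) <= q * S.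
  rewrite /q -RintegralZr//; last exact: iQ.2.
  apply: RI_le => //.
  - by apply: (@eq_ig _ _ (fun x => S * sqmod (Q x))) => [x|]; [rewrite mulrC|exact: igZ iQ.2].
  - by move=> x xi /=; rewrite ler_wpM2l ?sqmod_ge0// hS.
have eq1 : 16 * q * e <= 1.
  by rewrite /e ler_pdivrMr ?ltr_wpDl ?mulr_ge0// mul1r lerDl.
have key : (K - 2 * q / pi - 4 * q / e) * A + (1 / 2 - 4 * q * e) * G <= 0.
  apply: (le_trans _ W1).
  have -> : (K - 2 * q / pi - 4 * q / e) * A + (1 / 2 - 4 * q * e) * G =
     K * A + G / 2 - 2 * (q * S).
    have gen (t z : R) : t != 0 -> z != 0 -> (K - 2 * q / t - 4 * q / z) * A +
        (1 / 2 - 4 * q * z) * G = K * A + G / 2 - 2 * (q * (A / t + (z * G + A / z) * 2)).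
      by move=> t0 z0; field; rewrite t0 z0.
    by apply: gen; rewrite gt_eqF.
  lra.
have c1 : A <= (K - 2 * q / pi - 4 * q / e) * A by rewrite ler_peMl//; lra.
have c2 : 1 / 4 * G <= (1 / 2 - 4 * q * e) * G by rewrite ler_wpM2r//; lra.
have Az : A = 0 by apply/eqP; rewrite eq_le A0 andbT; lra.
have Gz : G = 0 by apply/eqP; rewrite eq_le G0 andbT; lra.
have y0 x : itv 0 pi x -> y x = 0.
  move=> xi; apply: sqmod_eq0; apply/eqP; rewrite eq_le sqmod_ge0 andbT.
  by apply: (le_trans (hS x xi)); rewrite /S Az Gz !mul0r mulr0 !addr0 mul0r.
apply: (energy_eq0 LQ s).
rewrite -[RHS]Gz; apply: eq_Rintegral => x /set_mem xi /=.
by rewrite /energy /g y0// mulr0 sqmod0 !add0r.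
Qed.

End FloquetSolutions.

(** * The resolvent *)

Section Resolvent.
Context {R : realType}.
Local Notation C := (R[i]).
Local Notation mu := (@lebesgue_measure R).
Local Notation ig D h := (mu.-integrable D (EFin \o (h : R -> R))).
Local Notation RI a b h := (Rintegral mu (itv a b) h).
Local Notation "x %:C" := (real_complex R x).
Local Notation rayL x := (`]-oo, (x : R)]%classic).
Local Notation rayR x := (`[(x : R), +oo[%classic).

Lemma meas_rayL (x : R) : measurable (rayL x). Proof. exact: measurable_itv. Qed.
Lemma meas_rayR (x : R) : measurable (rayR x). Proof. exact: measurable_itv. Qed.
Hint Resolve meas_rayL meas_rayR : core.

Lemma cint_rayL_incr (f : R -> C) a b : a <= b -> cig (rayL b) f ->
  cint (rayL b) f - cint (rayL a) f = cint (itv a b) f.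
Proof.
have key (h : R -> R) : a <= b -> ig (rayL b) h ->
    Rintegral mu (rayL b) h - Rintegral mu (rayL a) h = RI a b h.
  move=> ab ih; rewrite Rintegral_itvB//.
  rewrite Rintegral_itv_obnd_cbnd//; apply: igS ih => // x /=.
  by rewrite !in_itv/= => /andP[].
by move=> ab [i1 i2]; apply: ceq; rewrite !cReImE; exact: key.
Qed.

Lemma cint_rayR_incr (f : R -> C) a b : a <= b -> cig (rayR a) f ->
  cint (rayR b) f - cint (rayR a) f = - cint (itv a b) f.
Proof.
have key (h : R -> R) : a <= b -> ig (rayR a) h ->
    Rintegral mu (rayR b) h - Rintegral mu (rayR a) h = - RI a b h.
  move=> ab ih; have := @Rintegral_itvB _ h (BLeft a) (BInfty _ false) b ih.
  rewrite !bnd_simp => /(_ ab isT) e.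
  rewrite -Rintegral_itv_obnd_cbnd; last first.
    apply: igS ih => // x /=.
    by rewrite !in_itv/= !andbT => /ltW; exact: le_trans.
  by rewrite -e; ring.
by move=> ab [i1 i2]; apply: ceq; rewrite !cReImE; exact: key.
Qed.

Lemma periodic_le (h : R -> R) (B : R) : (forall x, h (x + pi) = h x) ->
  (forall x, itv 0 pi x -> h x <= B) -> forall x, h x <= B.
Proof.
move=> hp hB; have p0 : 0 < pi :> R := pi_gt0 R.
have hn n x : h (x + pi *+ n) = h x.
  by elim: n => [|n IH]; rewrite ?mulr0n ?addr0// (mulrSr pi) addrA hp.
have pos x : 0 <= x -> h x <= B.
  move=> x0; pose n := Num.truncn (x / pi).
  have /andP[h1 h2] := truncn_itv (divr_ge0 x0 (ltW p0)).
  rewrite -(subrK (pi *+ n) x) hn; apply: hB; rewrite /itv/=.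
  move: h1 h2; rewrite -/n ler_pdivlMr// ltr_pdivrMr// !mulr_natl (mulrSr pi) => h1 h2.
  by apply/andP; split; lra.
move=> x; have h1 := truncnS_gt (`|x| / pi).
rewrite -(hn (Num.truncn (`|x| / pi)).+1 x); apply: pos.
move: h1; rewrite ltr_pdivrMr// mulr_natl => /ltW h1.
by have := ler_norm (- x); rewrite normrN; lra.
Qed.

Lemma cRe_mulJ_amgm (z w : C) (t : R) : 0 < t ->
  2 * cRe (z^* * w) <= t * sqmod z + t^-1 * sqmod w.
Proof.
move=> t0; rewrite -(ler_pM2r t0).
have -> : (t * sqmod z + t^-1 * sqmod w) * t = t ^+ 2 * sqmod z + sqmod w.
  by field; rewrite gt_eqF.
rewrite /sqmod !cReImE; move: (cRe z) (cIm z) (cRe w) (cIm w) => a a' b b'.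
have := sqr_ge0 (t * a - b); have := sqr_ge0 (t * a' - b'); nra.
Qed.

(** For [q = |Q|^2] and [t = |y|^2]: the weight [kap (1 + |Q|^2)] dominates both [|y|^2] and
    [|Q y|^2]. *)
Lemma le_weightM (kap q t : R) : 0 <= kap -> 0 <= q -> 0 <= t ->
  t * kap <= kap * (1 + q) * t /\ q * t * kap <= kap * (1 + q) * t.
Proof.
move=> kap0 q0 t0; have h1 := mulr_ge0 kap0 t0; have h2 := mulr_ge0 q0 h1.
by split; lra.
Qed.

(* One-sided energy estimate: [F = |alpha|^2 exp(-2T)] with [T' = sg s] obeys
   [s F <= - sg F' + (K / kap) |h|^2]. *)
Lemma weighted_energy (alpha bet h : R -> C) (T s : R -> R) (sg kap K B : R) :
  sg ^+ 2 = 1 -> 0 < kap -> 0 <= K -> 0 <= B -> (forall x, kap <= s x) ->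
  ACd (fun x => (T x)%:C) (fun x => (sg * s x)%:C) ->
  ACd alpha (fun x => sg%:C * (bet x * h x)) -> cmeasurable bet -> L2 h ->
  (forall x, sqmod (bet x) <= K * expR (2 * T x)) ->
  (forall x, sqmod (alpha x) * expR (- (2 * T x)) <= B) ->
  ig setT (fun x => s x * (sqmod (alpha x) * expR (- (2 * T x)))) /\
  Rintegral mu setT (fun x => s x * (sqmod (alpha x) * expR (- (2 * T x)))) <=
    B + K / kap * N2 h.
Proof.
move=> sg1 kap0 K0 B0 hs aT aa mb Lh hbet hB.
have aE : ACd (fun x => (expR (- (2 * T x)))%:C)
    (fun x => (- (2 * (sg * s x)) * expR (- (2 * T x)))%:C).
  apply: ACd_expR; apply: eq_ACd (ACdZ ((-2)%:C) aT) => x; rewrite -rmorphM; congr _%:C; ring.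
have aF := ACdM (ACdM aa (ACdJ aa)) aE.
pose F x := sqmod (alpha x) * expR (- (2 * T x)).
have F0 x : 0 <= F x by rewrite mulr_ge0// ?sqmod_ge0// expR_ge0.
pose d x := cRe ((sg%:C * (bet x * h x) * (alpha x)^* + alpha x * (sg%:C * (bet x * h x))^*) *
   (expR (- (2 * T x)))%:C + alpha x * (alpha x)^* *
   (- (2 * (sg * s x)) * expR (- (2 * T x)))%:C).
have Fd a b : a <= b -> F b - F a = RI a b d.
  move=> ab; have := congr1 (@cRe R) (proj2 aF a b ab).
  rewrite cReD cReN /= => <-.
  by rewrite /F !mulJ_sqmod -!rmorphM !cRe_real.
have id a b : ig (itv a b) d by case: (L1loc_cig a b (ACd_L1loc aF)).
have iL a b : ig (itv a b) (sqmod \o h) by exact: (L2_on _ Lh).2.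
have sE x : d x = sg * (2 * cRe ((alpha x)^* * (bet x * h x)) * expR (- (2 * T x)))
     - 2 * sg * (s x * F x).
  rewrite /d mulJ_sqmod -rmorphM cReD cRe_real /F; congr (_ + _); last by ring.
  rewrite !cReImE; ring.
(* The cross term is split by AM-GM with parameter [kap <= s]; of the [2 s F] produced by the
   exponential, at least [s F] remains. The growth of [bet] is cancelled by [exp(-2T)]. *)
have point x : s x * F x <= - sg * d x + K / kap * sqmod (h x).
  rewrite sE; set e := expR (- (2 * T x)); have e0 : 0 < e by exact: expR_gt0.
  set m := cRe _.
  have -> : - sg * (sg * (2 * m * e) - 2 * sg * (s x * F x)) =
      sg ^+ 2 * (2 * (s x * F x) - 2 * m * e) by ring.
  rewrite sg1 mul1r.
  have hm : 2 * m * e <= kap * F x + K / kap * sqmod (h x).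
    have h1 : 2 * m <= kap * sqmod (alpha x) + kap^-1 * (sqmod (bet x) * sqmod (h x)).
      by rewrite -(sqmodM (bet x)); exact: cRe_mulJ_amgm.
    have h2 : sqmod (bet x) * e <= K.
      apply: (@le_trans _ _ (K * expR (2 * T x) * e)); first by apply: ler_wpM2r; [exact: ltW|exact: hbet].
      by rewrite -mulrA -expRD subrr expR0 mulr1.
    have h3 : sqmod (bet x) * e * sqmod (h x) <= K * sqmod (h x).
      by rewrite ler_wpM2r ?sqmod_ge0.
    have h4 : kap^-1 * (sqmod (bet x) * e * sqmod (h x)) <= kap^-1 * (K * sqmod (h x)).
      by rewrite ler_pM2l ?invr_gt0.
    have h5 : 2 * m * e <= (kap * sqmod (alpha x) + kap^-1 * (sqmod (bet x) * sqmod (h x))) * e.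
      by apply: ler_wpM2r => //; exact: ltW.
    apply: (le_trans h5).
    have -> : (kap * sqmod (alpha x) + kap^-1 * (sqmod (bet x) * sqmod (h x))) * e =
       kap * F x + kap^-1 * (sqmod (bet x) * e * sqmod (h x)) by rewrite /F -/e; ring.
    by rewrite lerD2l (mulrC K) -[leRHS]mulrA.
  have : kap * F x <= s x * F x by rewrite ler_wpM2r.
  lra.
have ms : measurable_fun setT s.
  have m1 : measurable_fun setT (fun x => sg * s x).
    by case: (L1loc_meas (ACd_L1loc aT)).
  have -> : s = (fun x => sg * (sg * s x)).
    by apply/funext => x; rewrite mulrA -expr2 sg1 mul1r.
  by apply: measurable_funM.
have mT : measurable_fun setT T by case: (ACd_meas aT).
have mF : measurable_fun setT F.
  apply: measurable_funM; first exact: meas_sqmod (ACd_meas aa).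
  apply: measurableT_comp => //; apply: measurableT_comp => //.
  exact: measurable_funM.
have msF : measurable_fun setT (fun x => s x * F x) by exact: measurable_funM.
have sF0 x : 0 <= s x * F x by rewrite mulr_ge0// (le_trans (ltW kap0)).
have idh a b : ig (itv a b) (fun x => - sg * d x + K / kap * sqmod (h x)).
  by apply: igD => //; apply: igZ => //; exact: iL.
have isF a b : ig (itv a b) (fun x => s x * F x).
  by apply: ig_dom (idh a b) => // x _; rewrite ger0_norm// point.
apply: ige0T_sup => // i.
apply: (@le_trans _ _ (RI (- i%:R) i%:R (fun x => - sg * d x + K / kap * sqmod (h x)))).
  by apply: RI_le => // x _; exact: point.
have ii : - (i%:R : R) <= i%:R by rewrite (le_trans (_ : _ <= 0))// oppr_le0.
have iL' := igZ (K / kap) (meas_itv (- i%:R) i%:R) (iL _ _).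
have id' := igZ (- sg) (meas_itv (- i%:R) i%:R) (id _ _).
have eL : RI (- i%:R) i%:R (fun x => K / kap * sqmod (h x)) =
    K / kap * RI (- i%:R) i%:R (sqmod \o h).
  by rewrite -RintegralZl//; exact: iL.
have ed : RI (- i%:R) i%:R (fun x => - sg * d x) = - sg * RI (- i%:R) i%:R d.
  by rewrite RintegralZl.
rewrite RintegralD// eL ed.
apply: lerD; last first.
  rewrite ler_wpM2l ?divr_ge0 ?(ltW kap0)//.
  by apply: RI_subset => //; [exact: meas_sqmod (L2_meas Lh)|move=> x; exact: sqmod_ge0|exact: L2_ig].
(* For either sign, one end value of [F] enters negatively and is dropped, and the other is at most
   [B]. *)
rewrite -Fd//.
have := F0 i%:R; have := F0 (- i%:R); have := hB i%:R; have := hB (- i%:R).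
rewrite -/(F _) -/(F _).
move/eqP: sg1; rewrite sqrf_eq1 => /orP[] /eqP ->; lra.
Qed.

Variable (Q : R -> C).
Hypotheses (Qpi : forall x, Q (x + pi) = Q x) (LQ : L2loc Q).

Section Weight.
Variable (L : R).
Hypothesis L0 : 0 < L.

(** [S] is a primitive of [s], and periodicity of [s] makes its increment over a period independent
    of the starting point. Dividing [L] by the integral of [1 + |Q|^2] over a period gives the [kap]
    for which this increment is [L]. *)
Lemma period_weight : exists (kap : R) (s S : R -> R), [/\ 0 < kap,
  forall x, s x = kap * (1 + sqmod (Q x)),
  ACd (fun x => (S x)%:C) (fun x => (s x)%:C) & forall x, S (x + pi) = S x + L].
Proof.
have p0 : 0 < pi :> R := pi_gt0 R.
have [mQ hQ] := (L2locP Q).1 LQ.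
have i1 a b : ig (itv a b) (fun x => 1 + sqmod (Q x)).
  by apply: igD => //; [exact: ig_cst|exact: (hQ a b).2].
have m1 : measurable_fun setT (fun x => 1 + sqmod (Q x)).
  by apply: measurable_funD => //; exact: meas_sqmod.
set q := RI 0 pi (fun x => 1 + sqmod (Q x)).
have q0 : 0 < q.
  apply: (lt_le_trans p0).
  have := @RI_le _ (itv 0 pi) (fun=> 1) (fun x => 1 + sqmod (Q x)) (meas_itv _ _)
    (ig_cst _ _ _) (i1 _ _).
  rewrite (RI_cst 1 (ltW p0)) mul1r subr0; apply => x _.
  by rewrite lerDl sqmod_ge0.
pose kap := L / q; pose s x := kap * (1 + sqmod (Q x)).
have Ls : L1loc (fun x => (s x)%:C).
  apply/L1locP; split.
    by apply: cmeas_real; apply: measurable_funM => //.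
  move=> a b; split; first exact: igZ.
  by apply: (@eq_ig _ _ (fun=> 0)) => //; exact: ig_cst.
have aS := mass_ACd Ls.
exists kap, s, (mass s); split => //; first exact: divr_gt0.
have aS' := ACdB (ACd_shift pi aS) aS.
move=> x.
have e : mass s (x + pi) - mass s x = mass s pi - mass s 0.
  have g0 t : (s (t + pi))%:C - (s t)%:C = 0 by rewrite /s Qpi subrr.
  have := ACd_const x 0 aS' g0; rewrite add0r -!rmorphB => /(congr1 (@cRe R)).
  by rewrite !cRe_real.
apply: subr0_eq; rewrite opprD addrA e (ACd_real_cRe aS (ltW p0)).
have -> : RI 0 pi s = kap * q by rewrite /s /q RintegralZl.
by apply/eqP; rewrite subr_eq0 /kap divfK// gt_eqF.
Qed.

End Weight.

(** As [s >= kap], the exponential is at most [1 / (2 kap)] times [sg] times its own derivative,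
    which integrates exactly. *)
Lemma expR_mass_int (S s : R -> R) (sg kap a b : R) : 0 < kap -> (forall x, kap <= s x) ->
  ACd (fun x => (S x)%:C) (fun x => (s x)%:C) -> sg ^+ 2 = 1 -> a <= b ->
  ig (itv a b) (fun x => expR (2 * (sg * S x))) /\
  RI a b (fun x => expR (2 * (sg * S x))) <=
    sg * (expR (2 * (sg * S b)) - expR (2 * (sg * S a))) / (2 * kap).
Proof.
move=> kap0 hs aS sg1 ab.
have aE : ACd (fun x => (expR (2 * (sg * S x)))%:C)
    (fun x => (2 * (sg * s x) * expR (2 * (sg * S x)))%:C).
  by apply: ACd_expR; apply: eq_ACd (ACdZ ((2 * sg)%:C) aS) => x;
    rewrite -rmorphM; congr _%:C; ring.
have iE : ig (itv a b) (fun x => 2 * (sg * s x) * expR (2 * (sg * S x))).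
  by case: (L1loc_cig a b (ACd_L1loc aE)).
have iE1 : ig (itv a b) (fun x => sg * (2 * (sg * s x) * expR (2 * (sg * S x)))) by exact: igZ.
have le x : expR (2 * (sg * S x)) <=
    (2 * kap)^-1 * (sg * (2 * (sg * s x) * expR (2 * (sg * S x)))).
  have -> : (2 * kap)^-1 * (sg * (2 * (sg * s x) * expR (2 * (sg * S x)))) =
     (2 * kap)^-1 * (sg ^+ 2 * 2 * s x) * expR (2 * (sg * S x)) by ring.
  rewrite ler_peMl ?expR_ge0// sg1 mul1r mulrC ler_pdivlMr ?mulr_gt0// mul1r.
  by rewrite ler_pM2l.
have mE : measurable_fun setT (fun x => expR (2 * (sg * S x))) by case: (ACd_meas aE).
have ii : ig (itv a b) (fun x => expR (2 * (sg * S x))).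
  by apply: ig_dom (igZ (2 * kap)^-1 (meas_itv a b) iE1) => // x _; rewrite ger0_norm ?expR_ge0.
split => //.
apply: (@le_trans _ _ (RI a b (fun x => (2 * kap)^-1 * (sg * (2 * (sg * s x) * expR (2 * (sg * S x))))))).
  by apply: RI_le => //; exact: igZ.
by rewrite !RintegralZl// -(ACd_real_cRe aE ab) mulrC.
Qed.

(* [multiplicative r] solutions have size [exp(-S)], with [S(x + pi) = S(x) + L]. *)
Lemma multiplicative_bound (k r : C) (y u : R -> C) (S s : R -> R) (sg L : R) :
  hsol k Q y u -> multiplicative r y u ->
  ACd (fun x => (S x)%:C) (fun x => (s x)%:C) ->
  (forall x, S (x + pi) = S x + L) -> sqmod r = expR (2 * (sg * L)) ->
  exists K : R, 0 <= K /\ forall x, sqmod (y x) <= K * expR (2 * (sg * S x)) /\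
    sqmod (u x) <= K * expR (2 * (sg * S x)).
Proof.
move=> [a1 a2] [my mu_] aS SL rE.
(* The energy divided by its expected size is periodic, so a bound on [[0, pi]] holds everywhere. *)
pose e x := energy y u x * expR (- (2 * (sg * S x))).
have ep x : e (x + pi) = e x.
  rewrite /e /energy my mu_ !sqmodM SL rE -mulrDr.
  rewrite [X in X * _]mulrC -mulrA -expRD; congr (_ * expR _); ring.
have [B hB] : exists B, forall x, itv 0 pi x -> e x <= B.
  have [M1 h1] := ACd_bounded 0 pi a1; have [M2 h2] := ACd_bounded 0 pi a2.
  have [M3 h3] := ACd_bounded 0 pi aS.
  exists ((M1 ^+ 2 + M2 ^+ 2) * expR (2 * (`|sg| * M3))) => x xi.
  have sq (z M : _) : n1 z <= M -> sqmod z <= M ^+ 2.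
    move=> zM; apply: (le_trans (sqmod_n1 _)); have p := n1_ge0 z.
    by rewrite lerXn2r// nnegrE (le_trans p).
  rewrite ler_pM ?energy_ge0 ?expR_ge0//.
    by apply: lerD; apply: sq; [exact: h1|exact: h2].
  rewrite ler_expR -mulrN ler_pM2l//.
  have := h3 x xi; rewrite n1_real => h4.
  apply: (@le_trans _ _ (`|sg| * `|S x|)); last by rewrite ler_wpM2l.
  by rewrite -normrM -normrN ler_norm.
have hB' := periodic_le ep hB.
have B0 : 0 <= B by apply: le_trans (hB' 0); rewrite mulr_ge0 ?energy_ge0 ?expR_ge0.
exists B; split => // x; have := hB' x; rewrite /e expRN ler_pdivrMr ?expR_gt0// /energy => h.
by split; apply: (le_trans _ h); rewrite ?lerDl ?lerDr sqmod_ge0.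
Qed.

(** * Variation of constants when the multipliers lie off the unit circle *)

Section Hyperbolic.
Variable k : C.
Variables (f1 v1 f2 v2 : R -> C).
Hypotheses (s1 : hsol k Q f1 v1) (s2 : hsol k Q f2 v2).
Hypotheses (e1 : f1 0 = 1) (e2 : v1 0 = 0) (e3 : f2 0 = 0) (e4 : v2 0 = 1).
Variable r : C.
Hypotheses (r0 : r != 0) (rD : r + r^-1 = f1 pi + v2 pi) (r1 : sqmod r < 1).

Lemma hyperbolic_neq : r != r^-1.
Proof.
apply/eqP => e; move: (r1); have : sqmod (r * r^-1) = 1 by rewrite divff// sqmod1.
rewrite sqmodM -e; have := sqmod_ge0 r; nra.
Qed.

(** A linear relation between the two solutions, read at [x] and at [x + pi], separates into two
    because the multipliers differ; one of the solutions would then vanish. *)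
Lemma hyperbolic_basis : exists p P m M : R -> C,
  [/\ hsol k Q p P, multiplicative r p P, hsol k Q m M, multiplicative r^-1 m M &
   p 0 * M 0 - P 0 * m 0 != 0].
Proof.
have [p [P [x1 [sp mp np]]]] := floquet_exists Qpi LQ s1 s2 e1 e2 e3 e4 r0 rD hyperbolic_neq.
have r0' : r^-1 != 0 by rewrite invr_eq0.
have rD' : r^-1 + r^-1^-1 = f1 pi + v2 pi by rewrite invrK addrC.
have rr' : r^-1 != r^-1^-1 by rewrite invrK eq_sym hyperbolic_neq.
have [m [M [x2 [sm mm nm]]]] := floquet_exists Qpi LQ s1 s2 e1 e2 e3 e4 r0' rD' rr'.
exists p, P, m, M; split => //; apply/eqP => W0.
have [c1 [c2 [cne hc]]] := hsol_wronskian_indep LQ sp sm W0.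
have [p1 p2] := mp; have [m1 m2] := mm.
have dr : r - r^-1 != 0 by rewrite subr_eq0 hyperbolic_neq.
have sep (a b : C) : a + b = 0 -> r * a + r^-1 * b = 0 -> a = 0 /\ b = 0.
  move=> h1 h2; have a0 : a = 0.
    apply: (mulfI dr); rewrite mulr0 -[RHS]h2 -[LHS]addr0 -(mulr0 r^-1) -[in X in _ + X]h1; ring.
  by split => //; move: h1; rewrite a0 add0r.
have z x : c1 * p x = 0 /\ c2 * m x = 0.
  have [h1 _] := hc x; have [h2 _] := hc (x + pi).
  by apply: sep => //; rewrite -[RHS]h2 p1 m1; ring.
have z' x : c1 * P x = 0 /\ c2 * M x = 0.
  have [_ h1] := hc x; have [_ h2] := hc (x + pi).
  by apply: sep => //; rewrite -[RHS]h2 p2 m2; ring.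
case/orP: cne => c0.
- have [/eqP h1 _] := z x1; have [/eqP h2 _] := z' x1.
  by move: h1 h2 np; rewrite !mulf_eq0 (negbTE c0) /= => -> ->.
- have [_ /eqP h1] := z x2; have [_ /eqP h2] := z' x2.
  by move: h1 h2 nm; rewrite !mulf_eq0 (negbTE c0) /= => -> ->.
Qed.

(** The Green's function is built from [p], of size [exp(-S)] and decaying to the right, and [m], of
    size [exp(S)] and decaying to the left: [y = (a p + b m) / W], where [a] integrates [m h] from
    minus infinity and [b] integrates [p h] to plus infinity. [weighted_energy] bounds [a] against
    [exp(S)] and [b] against [exp(-S)], so that the products with [p] and [m] are controlled in L^2
    with weight [s]. *)
Lemma resolvent_solution : exists M0 : R, 0 <= M0 /\ forall h, L2 h ->
  exists y u, [/\ isol k Q h y u, L2 y, L2 u, L2 (fun x => Q x * y x) &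
    N2 y <= M0 * N2 h].
Proof.
have [p [P [m [M [sp mp sm mm W0]]]]] := hyperbolic_basis.
have sr0 : 0 < sqmod r.
  by rewrite lt_neqAle sqmod_ge0 andbT eq_sym; apply/eqP => /sqmod_eq0 e; move: r0; rewrite e eqxx.
(* Chosen so that [|r| = exp(-L)]. *)
pose L : R := - ln (sqmod r) / 2.
have L0 : 0 < L by rewrite divr_gt0// oppr_gt0 ln_lt0// sr0.
have [kap [s [S [kap0 sE aS SL]]]] := period_weight L0.
have hs x : kap <= s x by rewrite sE ler_peMr ?(ltW kap0)// lerDl sqmod_ge0.
have sr : sqmod r = expR (2 * (-1 * L)).
  by rewrite (_ : 2 * (-1 * L) = ln (sqmod r)) ?lnK//; rewrite /L; field.
have sr' : sqmod r^-1 = expR (2 * (1 * L)).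
  by rewrite sqmodV// sr -expRN; congr expR; ring.
have [K1 [K10 hp]] := multiplicative_bound sp mp aS SL sr.
have [K2 [K20 hm]] := multiplicative_bound sm mm aS SL sr'.
pose K := K1 + K2; have K0 : 0 <= K by rewrite addr_ge0.
have {}hp x : sqmod (p x) <= K * expR (2 * (-1 * S x)) /\ sqmod (P x) <= K * expR (2 * (-1 * S x)).
  have [h1 h2] := hp x; have le : K1 * expR (2 * (-1 * S x)) <= K * expR (2 * (-1 * S x)).
    by rewrite ler_wpM2r ?expR_ge0// lerDl.
  by split; [exact: le_trans le|exact: le_trans le].
have {}hm x : sqmod (m x) <= K * expR (2 * (1 * S x)) /\ sqmod (M x) <= K * expR (2 * (1 * S x)).
  have [h1 h2] := hm x; have le : K2 * expR (2 * (1 * S x)) <= K * expR (2 * (1 * S x)).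
    by rewrite ler_wpM2r ?expR_ge0// lerDr.
  by split; [exact: le_trans le|exact: le_trans le].
pose W := p 0 * M 0 - P 0 * m 0.
have WE x : p x * M x - P x * m x = W by exact: wronskian_const sp sm.
have kap2 : 0 < 2 * kap by rewrite mulr_gt0.
have mexp (sg : R) : measurable_fun setT (fun x => expR (2 * (sg * S x))).
  have mS : measurable_fun setT S by case: (ACd_meas aS).
  apply: measurableT_comp => //; apply: measurable_funM => //; exact: measurable_funM.
have mm_ : cmeasurable m by exact: ACd_meas sm.1.
have mp_ : cmeasurable p by exact: ACd_meas sp.1.
have rayl x : L2on (rayL x) m /\
    Rintegral mu (rayL x) (sqmod \o m) <= K * (expR (2 * (1 * S x)) / (2 * kap)).
  have [i1 i2] : ig (rayL x) (fun x => expR (2 * (1 * S x))) /\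
      Rintegral mu (rayL x) (fun x => expR (2 * (1 * S x))) <= expR (2 * (1 * S x)) / (2 * kap).
    rewrite -bigcup_itv_ray; apply: ige0_sup => //.
    - by move=> i j ij; apply: itv_sub; rewrite ?lerN2 ?ler_nat.
    - move=> i; case: (leP (- i%:R) x) => h.
        by have [] := expR_mass_int kap0 hs aS (expr1n _ 2) h.
      by rewrite itv_set0//; exact: integrable_set0.
    - move=> i; case: (leP (- i%:R) x) => h.
        have [_ hh] := expR_mass_int kap0 hs aS (expr1n _ 2) h.
        apply: (le_trans hh); rewrite mul1r ler_pM2r ?invr_gt0//.
        by rewrite gerBl expR_ge0.
      by rewrite itv_set0// Rintegral_set0 divr_ge0 ?expR_ge0 ?ltW.
  have iK := igZ K (meas_rayL x) i1.
  have im : ig (rayL x) (sqmod \o m).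
    apply: ig_dom iK => //; first exact: meas_sqmod.
    by move=> t _ /=; rewrite ger0_norm ?sqmod_ge0//; exact: (hm t).1.
  split; first by split.
  apply: (@le_trans _ _ (Rintegral mu (rayL x) (fun x => K * expR (2 * (1 * S x))))).
    by apply: RI_le => // t _; exact: (hm t).1.
  by rewrite RintegralZl// ler_wpM2l.
have sgN : (-1 : R) ^+ 2 = 1 by rewrite sqrrN expr1n.
have rayr x : L2on (rayR x) p /\
    Rintegral mu (rayR x) (sqmod \o p) <= K * (expR (2 * (-1 * S x)) / (2 * kap)).
  have [i1 i2] : ig (rayR x) (fun x => expR (2 * (-1 * S x))) /\
      Rintegral mu (rayR x) (fun x => expR (2 * (-1 * S x))) <= expR (2 * (-1 * S x)) / (2 * kap).
    rewrite -bigcup_itv_ray_right; apply: ige0_sup => //.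
    - by move=> i j ij; apply: itv_sub; rewrite ?ler_nat.
    - move=> i; case: (leP x i%:R) => h.
        by have [] := expR_mass_int kap0 hs aS sgN h.
      by rewrite itv_set0//; exact: integrable_set0.
    - move=> i; case: (leP x i%:R) => h.
        have [_ hh] := expR_mass_int kap0 hs aS sgN h.
        apply: (le_trans hh); rewrite ler_pM2r ?invr_gt0//.
        by have := expR_ge0 (2 * (-1 * S i%:R)); lra.
      by rewrite itv_set0// Rintegral_set0 divr_ge0 ?expR_ge0 ?ltW.
  have iK := igZ K (meas_rayR x) i1.
  have im : ig (rayR x) (sqmod \o p).
    apply: ig_dom iK => //; first exact: meas_sqmod.
    by move=> t _ /=; rewrite ger0_norm ?sqmod_ge0//; exact: (hp t).1.
  split; first by split.
  apply: (@le_trans _ _ (Rintegral mu (rayR x) (fun x => K * expR (2 * (-1 * S x))))).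
    by apply: RI_le => // t _; exact: (hp t).1.
  by rewrite RintegralZl// ler_wpM2l.
pose c2 := sqmod W^-1.
have c20 : 0 <= c2 by exact: sqmod_ge0.
(* The 4 of [cauchy_schwarz] times [K / (2 kap)], the factor in the bounds for [|m|^2] and [|p|^2]
   integrated over a ray. *)
pose B0 := 4 * (K / (2 * kap)).
have B00 : 0 <= B0 by apply: mulr_ge0 => //; rewrite divr_ge0// ltW.
have Kk : 0 <= K / kap by rewrite divr_ge0// ltW.
(* The product of [2 c2 K / kap], from [comb], and [2 (B0 + K / kap)], the sum of the two energy
   estimates. *)
exists (4 * c2 * (K / kap) * (B0 + K / kap)); split.
  by apply: mulr_ge0; [apply: mulr_ge0 => //; exact: mulr_ge0|exact: addr_ge0].
move=> h Lh; have mh := L2_meas Lh.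
have sub (D : set R) : measurable D -> Rintegral mu D (sqmod \o h) <= N2 h.
  by move=> mD; apply: RI_subset => //; [exact: meas_sqmod|move=> x; exact: sqmod_ge0|exact: L2_ig].
have N0 := N2_ge0 h.
have cigl x : cig (rayL x) (fun t => m t * h t).
  by apply: L2onM => //; [exact: (rayl x).1|exact: L2_on].
have cigr x : cig (rayR x) (fun t => p t * h t).
  by apply: L2onM => //; [exact: (rayr x).1|exact: L2_on].
pose a x := cint (rayL x) (fun t => m t * h t).
pose b x := cint (rayR x) (fun t => p t * h t).
have Lmh : L1loc (fun t => m t * h t) by apply: ACd_L1M sm.1 _; exact: L2_L1.
have Lph : L1loc (fun t => p t * h t) by apply: ACd_L1M sp.1 _; exact: L2_L1.
have aa : ACd a (fun t => m t * h t).
  by split => // t t' tt'; exact: cint_rayL_incr.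
have ab : ACd b (fun t => - (p t * h t)).
  split => [|t t' tt']; first exact: L1locN.
  by rewrite /b cint_rayR_incr// cintN//; exact: L1loc_cig.
have aa' : ACd a (fun t => 1%:C * (m t * h t)) by apply: eq_ACd aa => // t; rewrite mul1r.
have ab' : ACd b (fun t => (-1)%:C * (p t * h t)).
  by apply: eq_ACd ab => // t; rewrite rmorphN rmorph1 mulN1r.
have aS1 : ACd (fun x => (1 * S x)%:C) (fun x => (1 * s x)%:C).
  by apply: eq_ACd aS => t; rewrite mul1r.
have aSN : ACd (fun x => (-1 * S x)%:C) (fun x => (-1 * s x)%:C).
  by apply: eq_ACd (ACdN aS) => t; rewrite -rmorphN mulN1r.
have bnd (z : C) (E A : R) : 0 < E -> n1 z ^+ 2 <= 4 * A * N2 h ->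
    A <= K * (E / (2 * kap)) -> sqmod z * E^-1 <= B0 * N2 h.
  move=> E0 h1 h2; rewrite ler_pdivrMr//; apply: (le_trans (sqmod_n1 _)).
  apply: (le_trans h1).
  apply: (@le_trans _ _ (4 * (K * (E / (2 * kap))) * N2 h)).
    by rewrite ler_wpM2r// ler_pM2l.
  by rewrite le_eqVlt /B0; apply/orP; left; apply/eqP; ring.
have hFa x : sqmod (a x) * expR (- (2 * (1 * S x))) <= B0 * N2 h.
  have [l1 l2] := rayl x; rewrite expRN; apply: (bnd _ _ _ _ _ l2); first exact: expR_gt0.
  apply: (le_trans (cauchy_schwarz (meas_rayL x) l1 (L2_on (meas_rayL x) Lh))).
  rewrite ler_wpM2l ?sub// mulr_ge0//; apply: Rintegral_ge0 => t _; exact: sqmod_ge0.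
have hFb x : sqmod (b x) * expR (- (2 * (-1 * S x))) <= B0 * N2 h.
  have [l1 l2] := rayr x; rewrite expRN; apply: (bnd _ _ _ _ _ l2); first exact: expR_gt0.
  apply: (le_trans (cauchy_schwarz (meas_rayR x) l1 (L2_on (meas_rayR x) Lh))).
  rewrite ler_wpM2l ?sub// mulr_ge0//; apply: Rintegral_ge0 => t _; exact: sqmod_ge0.
have BN0 : 0 <= B0 * N2 h by rewrite mulr_ge0.
have [iFa hIa] := weighted_energy (expr1n _ 2) kap0 K0 BN0 hs aS1 aa' mm_ Lh (fun x => (hm x).1) hFa.
have [iFb hIb] := weighted_energy sgN kap0 K0 BN0 hs aSN ab' mp_ Lh (fun x => (hp x).1) hFb.
pose Fa x := s x * (sqmod (a x) * expR (- (2 * (1 * S x)))).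
pose Fb x := s x * (sqmod (b x) * expR (- (2 * (-1 * S x)))).
pose y x := W^-1 * (a x * p x + b x * m x).
pose u x := W^-1 * (a x * P x + b x * M x).
have isE : isol k Q h y u.
  have [p1 p2] := sp; have [q1 q2] := sm; split.
  - apply: eq_ACd (ACdZ W^-1 (ACdD (ACdM aa p1) (ACdM ab q1))) => // x.
    by rewrite /y /u; ring.
  - apply: eq_ACd (ACdZ W^-1 (ACdD (ACdM aa p2) (ACdM ab q2))) => // x.
    rewrite /y /u.
    transitivity ((k - Q x ^+ 2) * (W^-1 * (a x * p x + b x * m x)) -
      Q x * (W^-1 * (a x * P x + b x * M x)) - W^-1 * (p x * M x - P x * m x) * h x); first by ring.
    by rewrite WE mulVf// mul1r.
(* Stated for arbitrary values of these sizes, since it serves [y] with [(p, m)] and [u] with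
   [(P, M)]. *)
have comb (z1 z2 : C) x : sqmod z1 <= K * expR (2 * (-1 * S x)) ->
    sqmod z2 <= K * expR (2 * (1 * S x)) ->
    s x * sqmod (W^-1 * (a x * z1 + b x * z2)) <= 2 * c2 * K * (Fa x + Fb x).
  move=> h1 h2; rewrite sqmodM -/c2.
  have sx : 0 <= s x by rewrite (le_trans (ltW kap0)).
  have := sqmodD_le (a x * z1) (b x * z2); rewrite !sqmodM.
  have g1 : sqmod (a x) * sqmod z1 <= K * (sqmod (a x) * expR (- (2 * (1 * S x)))).
    rewrite mulrCA ler_wpM2l ?sqmod_ge0//; apply: (le_trans h1).
    by rewrite mul1r mulN1r mulrN.
  have g2 : sqmod (b x) * sqmod z2 <= K * (sqmod (b x) * expR (- (2 * (-1 * S x)))).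
    rewrite mulrCA ler_wpM2l ?sqmod_ge0//; apply: (le_trans h2).
    by rewrite mul1r mulN1r mulrN opprK.
  move=> g3; have : sqmod (a x * z1 + b x * z2) <= 2 * K * (sqmod (a x) * expR (- (2 * (1 * S x))) +
     sqmod (b x) * expR (- (2 * (-1 * S x)))).
    apply: (le_trans g3); rewrite -mulrDr -(mulrA 2 K) ler_pM2l// (mulrDr K).
    exact: lerD g1 g2.
  move=> /(ler_wpM2l (mulr_ge0 sx c20)) g4; rewrite mulrA (le_trans g4)// le_eqVlt.
  by apply/orP; left; apply/eqP; rewrite /Fa /Fb; ring.
have iFab : ig setT (fun x => 2 * c2 * K / kap * (Fa x + Fb x)).
  by apply: igZ => //; exact: igD.
have my := ACd_meas isE.1; have mu_ := ACd_meas isE.2.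
have div (q f : R) : q * kap <= f -> q <= f / kap by move=> ?; rewrite ler_pdivlMr.
have ky x : kap * (1 + sqmod (Q x)) * sqmod (y x) <= 2 * c2 * K * (Fa x + Fb x).
  by rewrite -sE; exact: comb (hp x).1 (hm x).1.
have ku x : kap * (1 + sqmod (Q x)) * sqmod (u x) <= 2 * c2 * K * (Fa x + Fb x).
  by rewrite -sE; exact: comb (hp x).2 (hm x).2.
have yb x : sqmod (y x) <= 2 * c2 * K / kap * (Fa x + Fb x).
  rewrite mulrAC; apply: div; apply: (le_trans _ (ky x)).
  exact: (le_weightM (ltW kap0) (sqmod_ge0 _) (sqmod_ge0 _)).1.
have Ly : L2 y by exact: L2_dom yb iFab.
exists y, u; split => //.
- apply: (@L2_dom _ _ (fun x => 2 * c2 * K / kap * (Fa x + Fb x))) => // x.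
  rewrite mulrAC; apply: div; apply: (le_trans _ (ku x)).
  exact: (le_weightM (ltW kap0) (sqmod_ge0 _) (sqmod_ge0 _)).1.
- apply: (@L2_dom _ _ (fun x => 2 * c2 * K / kap * (Fa x + Fb x))) => //.
    by apply: cmeasM => //; case: LQ.
  move=> x; rewrite sqmodM mulrAC; apply: div; apply: (le_trans _ (ky x)).
  exact: (le_weightM (ltW kap0) (sqmod_ge0 _) (sqmod_ge0 _)).2.
- apply: (@le_trans _ _ (Rintegral mu setT (fun x => 2 * c2 * K / kap * (Fa x + Fb x)))).
    by apply: RI_le => // [|x _]; [exact: L2_ig|exact: yb].
  rewrite RintegralZl//; last exact: igD.
  rewrite RintegralD//.
  have cK : 0 <= 2 * c2 * K / kap by rewrite divr_ge0 ?(ltW kap0)// !mulr_ge0.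
  apply: (le_trans (ler_wpM2l cK (lerD hIa hIb))).
  by rewrite le_eqVlt; apply/orP; left; apply/eqP; field; rewrite gt_eqF.
Qed.

End Hyperbolic.
End Resolvent.

(** * The operator L(v) *)

Section Lagrange.
Context {R : realType}.
Local Notation C := (R[i]).
Local Notation mu := (@lebesgue_measure R).
Local Notation ig D h := (mu.-integrable D (EFin \o (h : R -> R))).
Local Notation RI a b h := (Rintegral mu (itv a b) h).
Local Notation "x %:C" := (real_complex R x).

Lemma tail_small (f : R -> C) (e : R) : cig setT f -> cmeasurable f -> 0 < e ->
  exists N : nat, forall a b : R, a <= b -> N%:R <= a \/ b <= - N%:R ->
    RI a b (n1 \o f) <= e.
Proof.
move=> cf mf e0; have i1 := cig_n1 measurableT cf.
have c1 : cig setT (fun x => (n1 (f x))%:C).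
  split => //; apply: (@eq_ig _ _ (fun=> 0)) => //; exact: integrable0.
have [N hN] := cint_cvgT c1 e0; exists N => a b ab hab.
have := hN N (leqnn N); rewrite !cint_real -rmorphB n1_real => /ler_normlW.
have N0 : - N%:R <= N%:R :> R by rewrite (le_trans (_ : _ <= 0))// oppr_le0.
have mn : measurable_fun setT (n1 \o f) by exact: meas_n1.
have n0 x : 0 <= (n1 \o f) x by exact: n1_ge0.
have iS u v : ig (itv u v) (n1 \o f) by exact: igS i1.
have sub u v : RI u v (n1 \o f) <= Rintegral mu setT (n1 \o f) by exact: RI_subset.
suff : RI (- N%:R) N%:R (n1 \o f) + RI a b (n1 \o f) <= Rintegral mu setT (n1 \o f).
  by rewrite -[X in _ -> X - _ <= _ -> _]/(Rintegral mu setT (n1 \o f))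
     -[X in _ -> _ - X <= _ -> _]/(RI (- N%:R) N%:R (n1 \o f)); lra.
case: hab => h.
- have := sub (- N%:R) b; rewrite (RI_split (le_trans N0 h) ab)// (RI_split N0 h)//.
  have := RI_ge0 N%:R a n0; lra.
- have h' : b <= N%:R by exact: le_trans N0.
  have := sub a N%:R; rewrite (RI_split ab h')// (RI_split h N0)//.
  have := RI_ge0 b (- N%:R) n0; lra.
Qed.

(** Far out the integral of [|g|] is at most [e / 2]. If [|W|] exceeded [e] at such a point, it
    would stay above [e / 2] from there outwards, against integrability. *)
Lemma ACd_vanish (W g : R -> C) (e : R) : ACd W g -> cig setT W -> cig setT g -> 0 < e ->
  exists N : nat, forall a : R, N%:R <= a \/ a <= - N%:R -> n1 (W a) <= e.
Proof.
move=> aW cW cg e0; have e2 : 0 < e / 2 by lra.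
have mW := ACd_meas aW; have mg := L1loc_meas (ACd_L1loc aW).
have [N hN] := tail_small cg mg e2; exists N => a ha.
rewrite leNgt; apply/negP => We.
set B := Rintegral mu setT (n1 \o W).
have iW := cig_n1 measurableT cW.
have B0 : 0 <= B by apply: Rintegral_ge0 => x _; exact: n1_ge0.
have key u v : u <= v -> (forall x, itv u v x -> e / 2 <= n1 (W x)) -> e / 2 * (v - u) <= B.
  move=> uv h; rewrite -RI_cst//.
  apply: (@le_trans _ _ (RI u v (n1 \o W))).
    by apply: RI_le => //; [exact: ig_cst|exact: igS iW].
  by apply: RI_subset => //; [exact: meas_n1|move=> x; exact: n1_ge0].
(* An interval of this length carries mass at least [B + e / 2], more than the total [B]. *)
have l0 : 0 <= 2 * B / e + 1 by rewrite addr_ge0// divr_ge0 ?mulr_ge0// ltW.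
have fin : ~ (e / 2 * (2 * B / e + 1) <= B).
  have -> : e / 2 * (2 * B / e + 1) = B + e / 2 by field; rewrite gt_eqF.
  by apply/negP; rewrite -ltNge; lra.
case: ha => ha.
- apply: fin; have := key a (a + (2 * B / e + 1)).
  rewrite (_ : a + (2 * B / e + 1) - a = 2 * B / e + 1); last by ring.
  apply; first by rewrite lerDl.
  move=> x /andP[ax _].
  have := hN a x ax (or_introl ha).
  move/(le_trans (n1_incr aW (lexx a) ax (lexx x))) => h.
  have := n1D (W a - W x) (W x); rewrite subrK n1BC; lra.
- apply: fin; have := key (a - (2 * B / e + 1)) a.
  rewrite (_ : a - (a - (2 * B / e + 1)) = 2 * B / e + 1); last by ring.
  apply; first by rewrite gerBl.
  move=> x /andP[_ xa].
  have := hN x a xa (or_intror ha).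
  move/(le_trans (n1_incr aW (lexx x) xa (lexx a))) => h.
  have := n1D (W a - W x) (W x); rewrite subrK; lra.
Qed.

Lemma ACd_int0 (W g : R -> C) : ACd W g -> cig setT W -> cig setT g -> cint setT g = 0.
Proof.
move=> aW cW cg; apply: n1_eq0.
suff -> : n1 (cint setT g) = 0 by [].
apply: dyadic_small => [|e e0]; first exact: n1_ge0.
have e3 : 0 < e / 3 by lra.
have [N1 h1] := cint_cvgT cg e3; have [N2 h2] := ACd_vanish aW cW cg e3.
pose n := maxn N1 N2.
have := h1 n (leq_maxl _ _).
have nn : - n%:R <= n%:R :> R by rewrite (le_trans (_ : _ <= 0))// oppr_le0.
have N2n : N2%:R <= n%:R :> R by rewrite ler_nat leq_maxr.
have w1 := h2 n%:R (or_introl N2n).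
have w2 : n1 (W (- n%:R)) <= e / 3 by apply: h2; right; rewrite lerN2.
rewrite -(proj2 aW)// => h3.
have := n1D (cint setT g - (W n%:R - W (- n%:R))) (W n%:R - W (- n%:R)).
rewrite subrK; have := n1B (W n%:R) (W (- n%:R)); lra.
Qed.

(** The wronskian and its derivative are sums of products of L^2 functions, hence integrable, so the
    boundary terms at infinity vanish. *)
Lemma lagrange_symmetric k (Q h1 h2 y1 u1 y2 u2 : R -> C) :
  isol k Q h1 y1 u1 -> isol k Q h2 y2 u2 -> L2 h1 -> L2 y1 -> L2 u1 ->
  L2 h2 -> L2 y2 -> L2 u2 ->
  cint setT (fun x => h1 x * y2 x) = cint setT (fun x => y1 x * h2 x).
Proof.
move=> s1 s2 Lh1 Ly1 Lu1 Lh2 Ly2 Lu2.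
have aW := wronskian_ACd s1 s2.
have aW' : ACd (fun x => y1 x * u2 x - u1 x * y2 x)
    (fun x => h1 x * y2 x - y1 x * h2 x).
  by apply: eq_ACd aW => // x; ring.
apply/eqP; rewrite -subr_eq0 -cintB//; [|exact: L2M|exact: L2M].
apply/eqP; apply: (ACd_int0 aW'); apply: cigB => //; exact: L2M.
Qed.

End Lagrange.

(** * The graph of the operator in terms of the first order system *)

Section OperatorGraph.
Context {R : realType}.
Local Notation C := (R[i]).
Local Notation "x %:C" := (real_complex R x).
Implicit Types (Cc lam : C) (Q y f h u z w : R -> C).

Lemma isol_ae k Q h h' y u : Defs.ae_eq h h' -> cmeasurable h' -> cmeasurable Q ->
  isol k Q h y u -> isol k Q h' y u.
Proof.
move=> hh' mh' mQ [a1 a2]; have my := ACd_meas a1; have mu_ := ACd_meas a2.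
split => //; apply: ACd_ae a2 _ _.
- do 2 (apply: cmeasB => //); apply: cmeasM => //.
  by apply: cmeasB; [exact: cmeas_cst|exact: cmeasM].
- by apply: ae_imp hh' => x ->.
Qed.

Lemma isol_lam Cc lam Q f y u :
  isol Cc Q f y u <-> isol (Cc - lam) Q (fun x => f x - lam * y x) y u.
Proof.
by split => -[a1 a2]; split => //; apply: eq_ACd a2 => // x; ring.
Qed.

(** The regularised derivative [p] is the unknown [u]. As [g] and [f] are tied to the other data
    only a.e., they are replaced inside the derivatives by expressions equal to them a.e. With the
    converse [isol_graph], questions about [L(v)] become questions about the system. *)
Lemma graph_isol Cc Q y f : L2loc Q -> graphL Cc Q y f -> exists yt u,
  [/\ Defs.ae_eq y yt, isol Cc Q f yt u, L2 yt, L2 u & L2 (fun x => Q x * yt x + u x)].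
Proof.
move=> LQ [Ly [Lf [yt [g [p [p' [[yyt [Lyt [Lg ag]]] [pg Lp] ap Ll fe]]]]]]].
have mQ : cmeasurable Q by case: LQ.
have gp : Defs.ae_eq g (fun x => Q x * yt x + p x).
  by apply: ae_imp pg => x ->; rewrite addrC subrK.
have myt := ACd_meas ag; have mp := ACd_meas ap.
have mg2 : cmeasurable (fun x => Q x * yt x + p x).
  by apply: cmeasD => //; exact: cmeasM.
exists yt, p; split => //; last exact: L2_ae gp Lg.
split; first exact: ACd_ae ag mg2 gp.
apply: ACd_ae ap _ _.
- do 2 (apply: cmeasB => //; last by [apply: L2_meas|apply: cmeasM]).
  by apply: cmeasM => //; apply: cmeasB; [exact: cmeas_cst|exact: cmeasM].
- by apply: ae_imp (ae_and gp fe) => x [-> ->]; ring.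
Qed.

Lemma isol_graph Cc Q y f yt u : L2 y -> L2 f -> Defs.ae_eq y yt ->
  isol Cc Q f yt u -> L2 yt -> L2 u -> L2 (fun x => Q x * yt x + u x) ->
  graphL Cc Q y f.
Proof.
move=> Ly Lf yyt [a1 a2] Lyt Lu Lg; split => //; split => //.
exists yt, (fun x => Q x * yt x + u x), u,
  (fun x => (Cc - Q x ^+ 2) * yt x - Q x * u x - f x).
have e x : f x = - ((Cc - Q x ^+ 2) * yt x - Q x * u x - f x) -
    Q x * (Q x * yt x + u x) + Cc * yt x by ring.
split => //.
- by split => //; apply: ae_eq_refl => x; rewrite addrC addKr.
- exact: eq_L2 e Lf.
- exact: ae_eq_refl.
Qed.

Lemma graphL_L2 Cc Q y f : graphL Cc Q y f -> L2 y /\ L2 f.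
Proof. by move=> [Ly [Lf _]]. Qed.

Lemma graphL_ae Cc Q y f y' f' : graphL Cc Q y f -> L2 y' -> L2 f' ->
  Defs.ae_eq y y' -> Defs.ae_eq f f' -> graphL Cc Q y' f'.
Proof.
move=> [Ly [Lf [yt [g [p [p' [[yyt h1] h2 h3 h4 fe]]]]]]] Ly' Lf' yy' ff'.
split => //; split => //; exists yt, g, p, p'; split => //.
  by split => //; exact: ae_eq_trans (ae_eq_sym yy') yyt.
exact: ae_eq_trans (ae_eq_sym ff') fe.
Qed.

Lemma graphLD Cc Q y f z h : L2loc Q -> graphL Cc Q y f -> graphL Cc Q z h ->
  graphL Cc Q (fun x => y x + z x) (fun x => f x + h x).
Proof.
move=> LQ g1 g2; have [Ly Lf] := graphL_L2 g1; have [Lz Lh] := graphL_L2 g2.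
have [yt [u [e1 s1 b1 b2 b3]]] := graph_isol LQ g1.
have [zt [w [e2 s2 c1 c2 c3]]] := graph_isol LQ g2.
apply: (isol_graph _ _ _ (isolD s1 s2)); [exact: L2D|exact: L2D| |exact: L2D|exact: L2D|].
- by apply: ae_imp (ae_and e1 e2) => x [-> ->].
- by apply: eq_L2 (L2D b3 c3) => x; ring.
Qed.

Lemma graphLZ c Cc Q y f : L2loc Q -> graphL Cc Q y f ->
  graphL Cc Q (fun x => c * y x) (fun x => c * f x).
Proof.
move=> LQ g1; have [Ly Lf] := graphL_L2 g1.
have [yt [u [e1 s1 b1 b2 b3]]] := graph_isol LQ g1.
apply: (isol_graph _ _ _ (isolZ c s1)); [exact: L2Z|exact: L2Z| |exact: L2Z|exact: L2Z|].
- by apply: ae_imp e1 => x ->.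
- by apply: eq_L2 (L2Z c b3) => x; ring.
Qed.

Lemma isolJ k Q h y u : isol k Q h y u ->
  isol k^* (fun x => (Q x)^*) (fun x => (h x)^*) (fun x => (y x)^*) (fun x => (u x)^*).
Proof.
move=> [a1 a2]; split.
- by apply: eq_ACd (ACdJ a1) => // x; rewrite rmorphD rmorphM.
- by apply: eq_ACd (ACdJ a2) => // x; rewrite !rmorphB !rmorphM rmorphB rmorphXn.
Qed.

Lemma L2locJ Q : L2loc Q -> L2loc (fun x => (Q x)^*).
Proof.
move=> /L2locP[mQ hQ]; apply/L2locP; split; first exact: cmeasJ.
move=> a b; split; first exact: cmeasJ.
by apply: eq_ig (hQ a b).2 => x /=; rewrite sqmodJ.
Qed.

Lemma graphLJ Cc Q y f : L2loc Q -> graphL Cc Q y f ->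
  graphL Cc^* (fun x => (Q x)^*) (fun x => (y x)^*) (fun x => (f x)^*).
Proof.
move=> LQ g1; have [Ly Lf] := graphL_L2 g1.
have [yt [u [e1 s1 b1 b2 b3]]] := graph_isol LQ g1.
apply: (isol_graph _ _ _ (isolJ s1)); [exact: L2J|exact: L2J| |exact: L2J|exact: L2J|].
- by apply: ae_imp e1 => x ->.
- by apply: eq_L2 (L2J b3) => x; rewrite rmorphD rmorphM.
Qed.

Lemma graphLJ_iff Cc Q y f : L2loc Q ->
  graphL Cc^* (fun x => (Q x)^*) y f <->
  graphL Cc Q (fun x => (y x)^*) (fun x => (f x)^*).
Proof.
move=> LQ.
split => [|/(graphLJ LQ)]; last by rewrite !conj_funK.
by move=> /(graphLJ (L2locJ LQ)); rewrite !conj_funK conjCK.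
Qed.

Lemma graphL_symmetric Cc Q y f z h : L2loc Q -> graphL Cc Q y f -> graphL Cc Q z h ->
  cint setT (fun x => f x * z x) = cint setT (fun x => y x * h x).
Proof.
move=> LQ g1 g2; have [Ly Lf] := graphL_L2 g1; have [Lz Lh] := graphL_L2 g2.
have [yt [u [e1 s1 b1 b2 b3]]] := graph_isol LQ g1.
have [zt [w [e2 s2 c1 c2 c3]]] := graph_isol LQ g2.
have := lagrange_symmetric s1 s2 Lf b1 b2 Lh c1 c2.
rewrite (@cint_ae _ _ (fun x => f x * zt x) (fun x => f x * z x))//; last first.
- by apply: ae_imp e2 => x ->.
- by apply: cmeasM; exact: L2_meas.
- by apply: cmeasM; exact: L2_meas.
rewrite (@cint_ae _ _ (fun x => yt x * h x) (fun x => y x * h x))//.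
- by apply: cmeasM; exact: L2_meas.
- by apply: cmeasM; exact: L2_meas.
- by apply: ae_imp e1 => x ->.
Qed.

Lemma cint_mulJ (y : R -> C) : cint setT (fun x => y x * (y x)^*) = (N2 y)%:C.
Proof. by rewrite -cint_real; apply: eq_cint => x _; rewrite mulJ_sqmod. Qed.

Lemma cint_mulJ_eq0 (y : R -> C) : L2 y -> cint setT (fun x => y x * (y x)^*) = 0 ->
  Defs.ae_eq y (fun=> 0).
Proof.
move=> Ly; rewrite cint_mulJ => /(congr1 (@cRe R)); rewrite cRe_real => h.
exact: N2_eq0.
Qed.

End OperatorGraph.

(** * Injectivity, solvability, adjoint and closedness for periodic [Q] *)

Section PeriodicOperator.
Context {R : realType}.
Local Notation C := (R[i]).
Local Notation mu := (@lebesgue_measure R).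
Local Notation RI a b h := (Rintegral mu (itv a b) h).
Local Notation "x %:C" := (real_complex R x).
Variables (Cc : C) (Q : R -> C).
Hypotheses (Qpi : forall x, Q (x + pi) = Q x) (LQ : L2loc Q).

Let mQ : cmeasurable Q. Proof. by case: LQ. Qed.

(** By uniqueness of the two solutions, the set from which [xget] chooses is a singleton. *)
Lemma LyapunovE lam (y1 u1 y2 u2 : R -> C) : hsol (Cc - lam) Q y1 u1 ->
  hsol (Cc - lam) Q y2 u2 -> y1 0 = 1 -> u1 0 = 0 -> y2 0 = 0 -> u2 0 = 1 ->
  Lyapunov Cc Q lam = y1 pi + u2 pi.
Proof.
move=> s1 s2 e1 e2 e3 e4.
have uq z w z' w' : hsol (Cc - lam) Q z w -> hsol (Cc - lam) Q z' w' -> z 0 = z' 0 ->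
    w 0 = w' 0 -> z pi = z' pi /\ w pi = w' pi.
  move=> t t' h1 h2.
  exact: (isol_agree (a := 0) (b := pi) LQ (hsol_isol t) t').
apply: xget_subset1.
  by exists y1, u1, y2, u2; split.
move=> d d' [z1 [w1 [z2 [w2 [a1 a2 [b1 b2] [b3 b4] ->]]]]].
move=> [z1' [w1' [z2' [w2' [a1' a2' [b1' b2'] [b3' b4'] ->]]]]].
have [-> _] := uq _ _ _ _ a1 a1' (etrans b1 (esym b1')) (etrans b2 (esym b2')).
by have [_ ->] := uq _ _ _ _ a2 a2' (etrans b3 (esym b3')) (etrans b4 (esym b4')).
Qed.

(** For [|r| < 1] duality replaces any study of growth: pairing [y] with an L^2 solution [z] for the
    right-hand side [conj y], symmetry gives [int |y|^2 = int 0 z = 0]. *)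
Lemma hsol_L2_eq0 k (y u : R -> C) : hsol k Q y u -> L2 y -> L2 u -> Defs.ae_eq y (fun=> 0).
Proof.
move=> s Ly Lu.
have [f1 [v1 [s1 e1 e2]]] := hsol_exists k 1 0 LQ.
have [f2 [v2 [s2 e3 e4]]] := hsol_exists k 0 1 LQ.
have [r [r0 rD]] := multiplier_le1 (f1 pi + v2 pi).
rewrite le_eqVlt => /orP[/eqP r1|r1].
- have z := liouville_right Qpi LQ s1 s2 e1 e2 e3 e4 r1 rD s (B := N2 y + N2 u).
  apply: ae_eq_refl => x; apply: (z _ x).1 => b b0.
  have iE : mu.-integrable (itv 0 b) (EFin \o energy y u) by exact: energy_ig s.
  rewrite /energy RintegralD//; [|exact: (L2_on _ Ly).2|exact: (L2_on _ Lu).2].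
  by apply: lerD; apply: RI_subset => //; try exact: L2_ig;
    try (by apply: meas_sqmod; case: Ly); try (by apply: meas_sqmod; case: Lu);
    move=> x0; exact: sqmod_ge0.
- have [M0 [_ hM]] := resolvent_solution Qpi LQ s1 s2 e1 e2 e3 e4 r0 rD r1.
  have [z [w [sz Lz Lw _ _]]] := hM _ (L2J Ly).
  have := lagrange_symmetric (hsol_isol s) sz L2_0 Ly Lu (L2J Ly) Lz Lw.
  by rewrite [LHS]cint0 => [/esym/(cint_mulJ_eq0 Ly)//|x _]; rewrite mul0r.
Qed.

Lemma graphL_injective lam (y f : R -> C) : graphL Cc Q y f ->
  Defs.ae_eq (fun x => f x - lam * y x) (fun=> 0) -> Defs.ae_eq y (fun=> 0).
Proof.
move=> g e0; have [yt [u [e1 s b1 b2 b3]]] := graph_isol LQ g.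
have s0 : isol (Cc - lam) Q (fun=> 0) yt u.
  apply: (isol_ae _ (cmeas_cst 0) mQ ((isol_lam _ lam _ _ _ _).1 s)).
  by apply: ae_imp (ae_and e1 e0) => x [<-].
exact: ae_eq_trans e1 (hsol_L2_eq0 (isol_hsol s0) b1 b2).
Qed.

Definition solvable_at lam := exists M0 : R, 0 <= M0 /\ forall h, L2 h ->
  exists y f, [/\ graphL Cc Q y f, forall x, f x - lam * y x = h x & N2 y <= M0 * N2 h].

Lemma hyperbolic_solvable lam (f1 v1 f2 v2 : R -> C) (r : C) :
  hsol (Cc - lam) Q f1 v1 -> hsol (Cc - lam) Q f2 v2 ->
  f1 0 = 1 -> v1 0 = 0 -> f2 0 = 0 -> v2 0 = 1 ->
  r != 0 -> r + r^-1 = f1 pi + v2 pi -> sqmod r < 1 -> solvable_at lam.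
Proof.
move=> s1 s2 e1 e2 e3 e4 r0 rD r1.
have [M0 [M00 hM]] := resolvent_solution Qpi LQ s1 s2 e1 e2 e3 e4 r0 rD r1.
exists M0; split => // h Lh; have [y [u [s Ly Lu LQy le]]] := hM h Lh.
exists y, (fun x => h x + lam * y x); split => //; last by move=> x; rewrite addrK.
apply: (isol_graph (yt := y) (u := u)) => //.
- by apply: L2D => //; exact: L2Z.
- exact: ae_eq_refl.
- by apply/(isol_lam _ lam); apply: eq_isol s => // x; rewrite addrK.
- exact: L2D.
Qed.

(** The bound is known for one preimage of each function; injectivity identifies it with any other
    one. [M0] bounds squared norms, hence the square root. *)
Lemma solvable_resolvent lam : solvable_at lam -> resolventL Cc Q lam.
Proof.
move=> [M0 [M00 hM]]; split.
- by move=> y f; exact: graphL_injective.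
- move=> h /hM [y [f [g e _]]]; exists y, f; split => //; exact: ae_eq_refl.
- exists (Num.sqrt M0) => y f g; have [Ly Lf] := graphL_L2 g.
  have Lh : L2 (fun x => f x - lam * y x) by apply: L2B => //; exact: L2Z.
  have [z [w [gz e le]]] := hM _ Lh.
  have [Lz Lw] := graphL_L2 gz.
  have gd : graphL Cc Q (fun x => y x + -1 * z x) (fun x => f x + -1 * w x).
    by apply: graphLD => //; exact: graphLZ.
  have yz : Defs.ae_eq y z.
    have : Defs.ae_eq (fun x => y x + -1 * z x) (fun=> 0).
      have alg (a b c d : C) : c - lam * d = a - lam * b -> a + -1 * c - lam * (b + -1 * d) = 0.
        move=> h; transitivity ((a - lam * b) - (c - lam * d)); last by rewrite h subrr.
        by ring.
      apply: (graphL_injective gd); apply: ae_eq_refl => x.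
      exact: alg (e x).
    by apply: ae_imp => x; rewrite mulN1r => /eqP; rewrite subr_eq0 => /eqP.
  rewrite /l2norm -sqrtrM// ler_wsqrtr// -[leLHS]/(N2 y) -[X in _ <= _ * X]/(N2 _).
  by rewrite (N2_ae (L2_meas Ly) (L2_meas Lz) yz).
Qed.

Lemma solvable_exists : exists lam, solvable_at lam.
Proof.
have [K hK] := floquet_no_unimodular LQ; pose lam := Cc - K%:C.
have kE : Cc - lam = K%:C by rewrite /lam opprB addrC subrK.
have [f1 [v1 [s1 e1 e2]]] := hsol_exists (Cc - lam) 1 0 LQ.
have [f2 [v2 [s2 e3 e4]]] := hsol_exists (Cc - lam) 0 1 LQ.
have [r [r0 rD p]] := multiplier_le1 (f1 pi + v2 pi).
exists lam; apply: (hyperbolic_solvable s1 s2 e1 e2 e3 e4 r0 rD).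
rewrite lt_neqAle p andbT; apply/eqP => r1.
(* [r = r^-1] is not excluded here, so the multiplier of the solution is only known to be one of the
   two; both are unimodular. *)
have [y [u [x [r' [s m rr ne]]]]] := floquet_exists_any Qpi LQ s1 s2 e1 e2 e3 e4 r0 rD.
have r'1 : sqmod r' = 1 by case: rr => ->; rewrite ?sqmodV// r1 ?invr1.
rewrite kE in s.
have [y0 u0] := hK K (lexx K) r' y u r'1 s m x.
by move: ne; rewrite y0 u0 eqxx.
Qed.

(** Let [zeta = conj z], [omega = conj w], and let [lam] be a solvable point. Solving
    [(L(v) - lam) y1 = omega - lam zeta] makes [zeta - y1] annihilate the range of [L(v) - lam]; as
    this range is all of L^2, [zeta = y1], which lies in the domain. *)
Lemma adjgraphLE (z w : R -> C) :
  adjgraphL Cc Q z w <-> graphL Cc^* (fun x => (Q x)^*) z w.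
Proof.
rewrite graphLJ_iff//; split => [[Lz [Lw adj]]|g].
- have [lam [M0 [_ hM]]] := solvable_exists.
  pose zeta x := (z x)^*; pose omega x := (w x)^*.
  have Lzeta : L2 zeta by exact: L2J.
  have Lomega : L2 omega by exact: L2J.
  have Lh : L2 (fun x => omega x - lam * zeta x) by apply: L2B => //; exact: L2Z.
  have [y1 [f1 [g1 e1 _]]] := hM _ Lh; have [Ly1 Lf1] := graphL_L2 g1.
  have Ld : L2 (fun x => zeta x - y1 x) by exact: L2B.
  (* The element of the range to test with is [conj (zeta - y1)]. *)
  have [y [f [g e _]]] := hM _ (L2J Ld); have [Ly Lf] := graphL_L2 g.
  have zy : Defs.ae_eq zeta y1.
    have : Defs.ae_eq (fun x => zeta x - y1 x) (fun=> 0).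
      apply: cint_mulJ_eq0 => //.
      have a1 := adj y f g; have a2 := graphL_symmetric LQ g g1.
      rewrite (@eq_cint _ _ _ (fun x => (f x * zeta x - y x * omega x) -
         (f x * y1 x - y x * f1 x))); last first.
        move=> x _; rewrite -e.
        have -> : f1 x = omega x - lam * zeta x + lam * y1 x by rewrite -e1 subrK.
        ring.
      have c1 : cig setT (fun x => f x * zeta x) by exact: L2M.
      have c2 : cig setT (fun x => y x * omega x) by exact: L2M.
      have c3 : cig setT (fun x => f x * y1 x) by exact: L2M.
      have c4 : cig setT (fun x => y x * f1 x) by exact: L2M.
      rewrite cintB//; [|exact: cigB|exact: cigB].
      rewrite cintB// cintB// a2 subrr subr0.
      by apply/eqP; rewrite subr_eq0; apply/eqP; exact: a1.
    by apply: ae_imp => x /eqP; rewrite subr_eq0 => /eqP.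
  apply: (graphL_ae g1) => //; first exact: ae_eq_sym.
  apply: ae_imp zy => x zx.
  have -> : f1 x = omega x - lam * zeta x + lam * y1 x by rewrite -e1 subrK.
  by rewrite zx subrK.
- have [Lz Lw] := graphL_L2 g.
  split; first by rewrite -(conj_funK z); exact: L2J.
  split; first by rewrite -(conj_funK w); exact: L2J.
  by move=> y f gy; exact: graphL_symmetric LQ gy g.
Qed.

Lemma cint_pair_cvg (f : nat -> R -> C) (g h : R -> C) :
  (forall n, L2 (f n)) -> L2 g -> L2 h ->
  l2norm (fun x => f n x - g x) @[n --> \oo] --> (0 : R) ->
  forall e : R, 0 < e -> exists N : nat, forall n, (N <= n)%N ->
    n1 (cint setT (fun x => f n x * h x) - cint setT (fun x => g x * h x)) <= e.
Proof.
move=> Lf Lg Lh cv e e0.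
have N0 := N2_ge0 h.
(* Since [4 N <= (2 (1 + N))^2], this choice absorbs the factor [4 * N2 h] of [cauchy_schwarz]. *)
pose d := e / (2 * (1 + N2 h)).
have d0 : 0 < d by rewrite divr_gt0// mulr_gt0// ltr_pwDl.
have /cvgrPdist_le/(_ _ d0)[N _ hN] := cv; exists N => n /hN /=.
rewrite sub0r normrN ger0_norm ?sqrtr_ge0// => le.
rewrite -cintB//; [|exact: L2M|exact: L2M].
rewrite (@eq_cint _ _ _ (fun x => (f n x - g x) * h x)); last by move=> x _; ring.
have Lfg : L2 (fun x => f n x - g x) by exact: L2B.
have cs := cauchy_schwarz measurableT (L2_on measurableT Lfg) (L2_on measurableT Lh).
rewrite -(@ler_sqr _ _ e) ?nnegrE ?n1_ge0 ?(ltW e0)//; apply: (le_trans cs).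
rewrite -[X in 4 * X * _]/(N2 (fun x => f n x - g x)) -[X in _ * X]/(N2 h) -l2norm_sqr.
have : l2norm (fun x => f n x - g x) ^+ 2 <= d ^+ 2.
  by rewrite ler_sqr// nnegrE ?sqrtr_ge0 ?(ltW d0).
have -> : e = d * (2 * (1 + N2 h)) by rewrite /d divfK// gt_eqF// mulr_gt0// ltr_pwDl.
move: (l2norm _) (N2 h) N0 => a b b0 h1.
apply: (@le_trans _ _ (4 * d ^+ 2 * b)); first by rewrite ler_wpM2r// ler_pM2l.
have -> : (d * (2 * (1 + b))) ^+ 2 = 4 * (d ^+ 2 * (1 + (2 * b + b ^+ 2))) by ring.
rewrite -mulrA ler_pM2l// ler_wpM2l ?sqr_ge0//; have := sqr_ge0 b; lra.
Qed.

Lemma closedLE : closedL Cc Q.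
Proof.
move=> ys fs y f g Ly Lf cy cf.
suff : graphL Cc Q (fun x => ((y x)^*)^*) (fun x => ((f x)^*)^*) by rewrite !conj_funK.
apply/graphLJ_iff => //; apply/adjgraphLE; split; first exact: L2J.
split; first exact: L2J.
move=> z w gz; have [Lz Lw] := graphL_L2 gz; rewrite /l2inner.
have Lys n : L2 (ys n) := (graphL_L2 (g n)).1.
have Lfs n : L2 (fs n) := (graphL_L2 (g n)).2.
have key : cint setT (fun x => f x * z x) = cint setT (fun x => y x * w x).
  apply: subr0_eq; apply: n1_eq0; set q := _ - _.
  suff -> : n1 q = 0 by [].
  apply: dyadic_small => [|e e0]; first exact: n1_ge0.
  have e2 : 0 < e / 2 by rewrite divr_gt0.
  have [N1 h1] := cint_pair_cvg Lfs Lf Lz cf e2.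
  have [N2 h2] := cint_pair_cvg Lys Ly Lw cy e2.
  pose n := maxn N1 N2.
  have := h1 n (leq_maxl _ _); have := h2 n (leq_maxr _ _).
  rewrite (graphL_symmetric LQ (g n) gz) [in X in _ -> X -> _]n1BC /q.
  set c := cint _ _; set c1 := cint _ _; set c2 := cint _ _ => h3 h4.
  rewrite -(subrK c c2) -addrA [leRHS]splitr; exact: le_trans (n1D _ _) (lerD h4 h3).
transitivity (cint setT (fun x => y x * w x)).
  by apply: eq_cint => x _; rewrite conjCK mulrC.
by rewrite -key; apply: eq_cint => x _; rewrite conjCK mulrC.
Qed.

Lemma half_frac_le (e G : R) : 0 < e -> 0 <= G -> e / (2 * (G + 1)) * G * 2 <= e.
Proof.
move=> e0 G0; have p : 0 < 2 * (G + 1) by lra.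
have -> : e / (2 * (G + 1)) * G * 2 = e * (2 * G) / (2 * (G + 1)) by ring.
rewrite ler_pdivrMr// ler_pM2l//; lra.
Qed.

(* An L^2 solution of [(L(v) - lam) y = 1_[0,pi] conj(f1)] vanishes outside [0, pi] by
   the Liouville property; Lagrange's identity then gives [int_0^pi |f1|^2 = 0]. *)
Lemma unimodular_not_surjective lam (f1 v1 f2 v2 : R -> C) (r : C) :
  hsol (Cc - lam) Q f1 v1 -> hsol (Cc - lam) Q f2 v2 ->
  f1 0 = 1 -> v1 0 = 0 -> f2 0 = 0 -> v2 0 = 1 ->
  sqmod r = 1 -> r + r^-1 = f1 pi + v2 pi -> ~ resolventL Cc Q lam.
Proof.
move=> s1 s2 e1 e2 e3 e4 r1 rD [_ surj _].
have p0 : 0 <= pi :> R := pi_ge0 R.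
pose h x := (\1_(itv 0 pi) x : R)%:C * (f1 x)^*.
have mf1 := ACd_meas s1.1.
have mh : cmeasurable h by apply: cmeas_indic => //; exact: cmeasJ.
have h0 x : ~ itv 0 pi x -> h x = 0.
  by move=> nx; rewrite /h indicE memNset// mul0r.
have h1 x : itv 0 pi x -> h x = (f1 x)^*.
  by move=> nx; rewrite /h indicE mem_set// mul1r.
have if1 : mu.-integrable (itv 0 pi) (EFin \o (sqmod \o f1)) := sqmod_ig_AC 0 pi s1.1.
have Lh : L2 h.
  apply/L2P; split => //.
  have /integrable_mkcond : mu.-integrable (itv 0 pi) (EFin \o (sqmod \o f1)) by [].
  move=> /(_ (meas_itv 0 pi)); apply: eq_integrable => // x _; rewrite /= patchE.
  case: ifPn => [/set_mem xi|/negP xi]; first by rewrite h1// sqmodJ.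
  by rewrite h0 ?sqmod0// => xi'; apply: xi; exact: mem_set.
have [y [f [g e]]] := surj h Lh.
have [yt [u [ey s0 Lyt Lu _]]] := graph_isol LQ g.
have s : isol (Cc - lam) Q h yt u.
  apply: (isol_ae _ mh mQ ((isol_lam _ lam _ _ _ _).1 s0)).
  by apply: ae_imp (ae_and ey e) => x [<-].
have bnd a b : RI a b (energy yt u) <= N2 yt + N2 u.
  rewrite /energy RintegralD//; [|exact: (L2_on _ Lyt).2|exact: (L2_on _ Lu).2].
  apply: lerD; apply: RI_subset => //.
  - exact: meas_sqmod (L2_meas Lyt).
  - by move=> t; exact: sqmod_ge0.
  - exact: L2_ig.
  - exact: meas_sqmod (L2_meas Lu).
  - by move=> t; exact: sqmod_ge0.
  - exact: L2_ig.
have m10 : -1 <= 0 :> R by rewrite oppr_le0.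
(* The Liouville property concerns homogeneous solutions on the whole line, so [(yt, u)] is
   continued from [x <= - 1] to such a solution; on [[- 1, 0]] the two may differ, hence the extra
   term in the bound. The point is -1 and not 0 because [h] is nonzero at 0. *)
have left : yt (- 1) = 0 /\ u (- 1) = 0.
  have [z [w [t z1 w1]]] := hsol_exists_at (Cc - lam) (- 1) (yt (- 1)) (u (- 1)) LQ.
  have agree x : x <= - 1 -> yt x = z x /\ u x = w x.
    move=> x1; apply: (isol_agree (a := - 1) LQ s t) => // q qi; apply: h0 => /andP[q0 _].
    have : q <= - 1 by case: qi => /andP[q1 q2] //; exact: le_trans x1.
    by move/(le_trans q0); rewrite oppr_ge0 ler10.
  have zw0 := liouville_left Qpi LQ s1 s2 e1 e2 e3 e4 r1 rD t
    (B := N2 yt + N2 u + RI (- 1) 0 (energy z w)).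
  rewrite -z1 -w1; apply: zw0 => a a0.
  have iE a' b' : mu.-integrable (itv a' b') (EFin \o energy z w) by exact: energy_ig t.
  have [a1|/ltW a1] := leP a (- 1).
    rewrite (RI_split a1 m10)//.
    rewrite lerD2r -(_ : RI a (- 1) (energy yt u) = RI a (- 1) (energy z w))//.
    apply: eq_Rintegral => x /set_mem /andP[_ x1].
    by rewrite /energy; have [-> ->] := agree x x1.
  apply: (@le_trans _ _ (RI (- 1) 0 (energy z w))).
    apply: RI_subset => //; first exact: itv_sub.
      exact: energy_meas t.
    by move=> x; exact: energy_ge0.
  by rewrite lerDr addr_ge0// N2_ge0.
have right : yt (pi + 1) = 0 /\ u (pi + 1) = 0.
  have [z [w [t z1 w1]]] := hsol_exists_at (Cc - lam) (pi + 1) (yt (pi + 1)) (u (pi + 1)) LQ.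
  have agree x : pi + 1 <= x -> yt x = z x /\ u x = w x.
    move=> x1; apply: (isol_agree (a := pi + 1) LQ s t) => // q qi; apply: h0 => /andP[_ qp].
    have : pi + 1 <= q by case: qi => /andP[q1 q2] //; exact: le_trans q1.
    by move=> /le_trans/(_ qp); rewrite gerDl ler10.
  have zw0 := liouville_right Qpi LQ s1 s2 e1 e2 e3 e4 r1 rD t
    (B := N2 yt + N2 u + RI 0 (pi + 1) (energy z w)).
  rewrite -z1 -w1; apply: zw0 => b b0.
  have iE a' b' : mu.-integrable (itv a' b') (EFin \o energy z w) by exact: energy_ig t.
  have p10 : 0 <= pi + 1 :> R by rewrite addr_ge0.
  have [b1|/ltW b1] := leP (pi + 1) b.
    rewrite (RI_split p10 b1)// addrC lerD2r.
    rewrite -(_ : RI (pi + 1) b (energy yt u) = RI (pi + 1) b (energy z w))//.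
    apply: eq_Rintegral => x /set_mem /andP[x1 _].
    by rewrite /energy; have [-> ->] := agree x x1.
  apply: (@le_trans _ _ (RI 0 (pi + 1) (energy z w))).
    apply: RI_subset => //; first exact: itv_sub.
      exact: energy_meas t.
    by move=> x; exact: energy_ge0.
  by rewrite lerDr addr_ge0// N2_ge0.
have aW := wronskian_ACd s (hsol_isol s1).
have le1 : -1 <= pi + 1 :> R by rewrite (le_trans (_ : _ <= 0)) ?oppr_le0// addr_ge0.
have := ACd_incr aW le1; rewrite left.1 left.2 right.1 right.2 !mul0r subrr add0r.
move=> /(congr1 (@cRe R)) /= /esym I0.
have I1 : RI (- 1) (pi + 1) (fun x => \1_(itv 0 pi) x * sqmod (f1 x)) = 0.
  rewrite -[RHS]I0; apply: eq_Rintegral => x _ /=.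
  rewrite subrr mul0r mulr0 subrr add0r /h -mulrA (mulrC _ (f1 x)) mulJ_sqmod.
  by rewrite !cReImE mulr0 subr0.
have A0 : RI 0 pi (sqmod \o f1) = 0.
  apply/eqP; rewrite eq_le; apply/andP; split; last first.
    by apply: RI_ge0 => x; exact: sqmod_ge0.
  rewrite -[leRHS]I1.
  have -> : RI 0 pi (sqmod \o f1) = RI 0 pi (fun x => \1_(itv 0 pi) x * sqmod (f1 x)).
    by apply: eq_Rintegral => x xi; rewrite indicE xi mul1r.
  have md : measurable_fun setT (fun x => \1_(itv 0 pi) x * sqmod (f1 x)).
    by apply: measurable_funM => //; exact: meas_sqmod.
  apply: RI_subset => //.
  - by apply: itv_sub; rewrite ?oppr_le0// lerDl.
  - by move=> x; rewrite mulr_ge0// sqmod_ge0.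
  - apply: (@ig_dom _ _ _ (sqmod \o f1)) => //; last exact: (sqmod_ig_AC _ _ s1.1).
    move=> x _; have [i0 i1] : (0 : R) <= \1_(itv 0 pi) x /\ \1_(itv 0 pi) x <= (1 : R).
      by rewrite indicE; case: (_ \in _).
    rewrite ger0_norm; last by apply: mulr_ge0 => //; exact: sqmod_ge0.
    by apply: ler_piMl => //; exact: sqmod_ge0.
pose g1 x := Q x * f1 x + v1 x.
have Lg1 : L2loc g1 by apply: L2locD; [exact: ACd_L2locM s1.1 LQ|exact: ACd_L2loc s1.2].
have G0 : 0 <= RI 0 pi (sqmod \o g1) by apply: RI_ge0 => x; exact: sqmod_ge0.
(* The vanishing integral reaches the point 0 through [sqmod_sup_le]: only a multiple of the free
   weight [d] is left on the right. *)
have : sqmod (f1 0) = 0.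
  apply: dyadic_small => [|ep ep0]; first exact: sqmod_ge0.
  pose d := ep / (2 * (RI 0 pi (sqmod \o g1) + 1)).
  have d0 : 0 < d by rewrite divr_gt0// mulr_gt0// ltr_wpDl.
  have z0 : itv 0 pi (0 : R) by rewrite /itv /= lexx.
  have := sqmod_sup_le d0 s1.1 Lg1 z0; rewrite A0 !mul0r add0r addr0 => /le_trans; apply.
  exact: half_frac_le.
by rewrite e1 sqmod1 => /eqP; rewrite oner_eq0.
Qed.

End PeriodicOperator.

(** * Completeness and projections in L^2 *)

Section Completeness.
Context {R : realType}.
Local Notation C := (R[i]).
Local Notation mu := (@lebesgue_measure R).
Local Notation ig D h := (mu.-integrable D (EFin \o (h : R -> R))).
Local Notation "x %:C" := (real_complex R x).

Lemma sum_half_le (n : nat) : \sum_(i < n) ((2 : R) ^+ i)^-1 <= 2.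
Proof.
suff -> : \sum_(i < n) ((2 : R) ^+ i)^-1 = 2 - 2 * ((2 : R) ^+ n)^-1.
  by rewrite gerBl mulr_ge0// invr_ge0 exprn_ge0.
elim: n => [|n IH]; first by rewrite big_ord0 expr0 invr1 mulr1 subrr.
rewrite big_ord_recr /= IH exprS invfM mulrA divff// mul1r.
by move: (2 ^+ n)^-1 => t; ring.
Qed.

(** Beppo Levi: the sum of the series is integrable, hence finite off a null set, and it dominates
    each of its terms. *)
Lemma ge0_series_integrable (d : nat -> R -> R) (B : R) :
  (forall n, measurable_fun setT (d n)) -> (forall n x, 0 <= d n x) ->
  (forall n, ig setT (d n)) ->
  (forall n, \sum_(i < n) Rintegral mu setT (d i) <= B) ->
  exists (A : set R) (b : R -> R), [/\ measurable A, mu (~` A) = 0%E, ig setT b &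
    forall x, A x -> forall n, d n x <= b x].
Proof.
move=> md d0 id dB.
pose G x := (\sum_(n <oo) (d n x)%:E)%E.
have mG : measurable_fun setT G.
  apply: ge0_emeasurable_sum => // [n x _ _|n _]; first by rewrite lee_fin.
  by apply/measurable_EFinP.
have G0 x : (0 <= G x)%E by apply: nneseries_ge0 => n _ _; rewrite lee_fin.
have IG : (\int[mu]_x G x <= B%:E)%E.
  have me n : measurable_fun setT (fun x => (d n x)%:E) by apply/measurable_EFinP.
  have e0 n x : setT x -> (0 <= (d n x)%:E)%E by rewrite lee_fin.
  rewrite (integral_nneseries mu measurableT me e0).
  apply: lime_le; first by apply: is_cvg_nneseries => n _ _; apply: integral_ge0 => x _; rewrite lee_fin.
  apply: nearW => n; rewrite big_mkord.
  rewrite (eq_bigr (fun i : 'I_n => (Rintegral mu setT (d i))%:E)); last first.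
    by move=> i _; rewrite fineK//; exact: ig_fin.
  by rewrite sumEFin lee_fin; exact: dB.
have iG : mu.-integrable setT G.
  apply/integrableP; split => //.
  under eq_integral do rewrite gee0_abs//.
  exact: le_lt_trans IG (ltry _).
have [N [mN N0 sN]] := integrable_ae measurableT iG.
exists (~` N), (fine \o G); split.
- exact: measurableC.
- by rewrite setCK.
- have mb : measurable_fun setT (fine \o G).
    by apply: measurableT_comp => //; exact: fine_measurable.
  apply: le_integrable iG => //; first by apply/measurable_EFinP.
  move=> x _ /=; have := G0 x; by case: (G x) => [t| |]//= _; rewrite leey.
- move=> x Nx n; have fG : G x \is a fin_num.
    by apply: contrapT => h; apply: Nx; apply: sN => /(_ I).
  rewrite -lee_fin fineK// /G; apply: (le_trans _ (nneseries_lim_ge n.+1 _)) => [|k _ _]; last by rewrite lee_fin.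
  by rewrite big_mkord big_ord_recr /= leeDr// sume_ge0// => i _; rewrite lee_fin.
Qed.

(* Along a sequence with [N2] increments of order 8^-n, the series
   [sum 4^n |f_{n+1} - f_n|^2] is integrable, which forces pointwise convergence. *)
Lemma L2_complete (f : nat -> R -> C) : (forall n, L2 (f n)) ->
  (forall n, N2 (fun x => f n.+1 x - f n x) <= (8 ^+ n)^-1) ->
  exists l, L2 l /\ exists B : R, forall n, N2 (fun x => l x - f n x) <= B / 4 ^+ n.
Proof.
move=> Lf hf.
pose d n x := 4 ^+ n * sqmod (f n.+1 x - f n x).
have Ld n : L2 (fun x => f n.+1 x - f n x) by exact: L2B.
have p4 n : 0 < (4 : R) ^+ n by rewrite exprn_gt0.
have sq2n n : ((2 : R) ^+ n) ^+ 2 = 4 ^+ n.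
  by rewrite -exprM mulnC exprM; congr (_ ^+ n); rewrite -natrX.
have md n : measurable_fun setT (d n).
  by apply: measurable_funM => //; exact: meas_sqmod (L2_meas (Ld n)).
have d0 n x : 0 <= d n x by rewrite mulr_ge0 ?(ltW (p4 n))// sqmod_ge0.
have id n : ig setT (d n) by exact: (igZ _ measurableT (L2_ig (Ld n))).
have dB n : \sum_(i < n) Rintegral mu setT (d i) <= 2.
  apply: (le_trans _ (sum_half_le n)); apply: ler_sum => i _.
  have -> : Rintegral mu setT (d i) = 4 ^+ i * N2 (fun x => f i.+1 x - f i x).
    by rewrite /d RintegralZl//; exact: L2_ig.
  apply: (@le_trans _ _ (4 ^+ i * (8 ^+ i)^-1)); first by rewrite ler_pM2l.
  have -> : (8 : R) = 4 * 2 by rewrite -natrM.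
  by rewrite exprMn invfM mulrA divff ?gt_eqF// mul1r.
have [A [b [mA A0 ib hA]]] := ge0_series_integrable md d0 id dB.
have b0 x : A x -> 0 <= b x by move=> Ax; exact: le_trans (d0 0%N x) (hA x Ax 0%N).
pose g n x := (\1_A x : R)%:C * f n x.
have gA n x : A x -> g n x = f n x by move=> Ax; rewrite /g indicE mem_set// mul1r.
have gnA n x : ~ A x -> g n x = 0 by move=> Ax; rewrite /g indicE memNset// mul0r.
have mg n : cmeasurable (g n) by apply: cmeas_indic => //; exact: L2_meas.
(* From [4^n |f_{n+1} - f_n|^2 <= b] and [n1_sqmod]. The factor 4 of [geo_limit] then explains the
   constant [32 = 4^2 * 2] below. *)
pose B x := Num.sqrt (2 * `|b x|).
have step x n : n1 (g n.+1 x - g n x) <= B x / 2 ^+ n.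
  have [Ax|nAx] := pselect (A x); last first.
    by rewrite !gnA// subrr n10 divr_ge0 ?sqrtr_ge0// exprn_ge0.
  rewrite !gA// ler_pdivlMr ?exprn_gt0//.
  rewrite -(@ler_sqr _ _ (B x)) ?nnegrE ?sqrtr_ge0//; last by rewrite mulr_ge0 ?n1_ge0// exprn_ge0.
  rewrite sqr_sqrtr ?mulr_ge0// exprMn sq2n ger0_norm ?b0//.
  apply: (@le_trans _ _ (2 * d n x)); last by rewrite ler_pM2l// hA.
  rewrite /d (mulrC (4 ^+ n)) mulrA; apply: ler_wpM2r; first exact: ltW.
  exact: n1_sqmod.
have [l hl] : {l : R -> C & forall x n, n1 (l x - g n x) <= 4 * B x / 2 ^+ n}.
  apply: (@choice _ _ (fun x z => forall n, n1 (z - g n x) <= 4 * B x / 2 ^+ n)) => x.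
  exact: geo_limit (step x).
have ml : cmeasurable l by exact: cmeas_geo mg hl.
have ae n : Defs.ae_eq (g n) (f n).
  exists (~` A); split => //; first exact: measurableC.
  by move=> x /= h Ax; apply: h; exact: gA.
have ibn : ig setT (fun x => `|b x|) by exact: ig_norm.
have bound n x : sqmod (l x - g n x) <= 32 / 4 ^+ n * `|b x|.
  apply: (le_trans (sqmod_n1 _)).
  have h := hl x n; have h0 := n1_ge0 (l x - g n x).
  apply: (@le_trans _ _ ((4 * B x / 2 ^+ n) ^+ 2)); first by rewrite lerXn2r// nnegrE (le_trans h0).
  rewrite exprMn exprMn sqr_sqrtr ?mulr_ge0// exprVn sq2n; move: (4 ^+ n)^-1 => t.
  by rewrite le_eqVlt; apply/orP; left; apply/eqP; ring.
have Lg n : L2 (g n) by exact: L2_ae (mg n) (ae_eq_sym (ae n)) (Lf n).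
have Llg n : L2 (fun x => l x - g n x).
  apply: (L2_dom (cmeasB ml (mg n)) (bound n)).
  exact: igZ.
exists l; split.
  by apply: eq_L2 (L2D (Llg 0%N) (Lg 0%N)) => x; rewrite subrK.
exists (32 * Rintegral mu setT (fun x => `|b x|)) => n.
have -> : N2 (fun x => l x - f n x) = N2 (fun x => l x - g n x).
  apply: N2_ae; [|exact: L2_meas|by apply: ae_imp (ae n) => x ->].
  by apply: cmeasB => //; exact: L2_meas.
rewrite mulrAC -RintegralZl//; have := L2_ig (Llg n) => i1.
have i2 : ig setT (fun x => 32 / 4 ^+ n * `|b x|) by exact: igZ.
exact: (RI_le measurableT i1 i2 (fun x _ => bound n x)).
Qed.

Lemma sqmodD_expand (z w c : C) :
  sqmod (z - c * w) = sqmod z - 2 * cRe (c^* * (z * w^*)) + sqmod c * sqmod w.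
Proof. by rewrite /sqmod !cReImE; ring. Qed.

Lemma N2_expand (f g : R -> C) (c : C) : L2 f -> L2 g ->
  N2 (fun x => f x - c * g x) =
  N2 f - 2 * cRe (c^* * cint setT (fun x => f x * (g x)^*)) + sqmod c * N2 g.
Proof.
move=> Lf Lg; have cf : cig setT (fun x => f x * (g x)^*) by exact: L2M (L2J Lg).
rewrite -cintZ//.
have -> : cRe (cint setT (fun x => c^* * (f x * (g x)^*))) =
    Rintegral mu setT (fun x => cRe (c^* * (f x * (g x)^*))) by [].
have ic : ig setT (fun x => cRe (c^* * (f x * (g x)^*))) by exact: (cigZ c^* measurableT cf).1.
have iF := L2_ig Lf; have iG := L2_ig Lg.
have e1 : 2 * Rintegral mu setT (fun x => cRe (c^* * (f x * (g x)^*))) =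
    Rintegral mu setT (fun x => 2 * cRe (c^* * (f x * (g x)^*))) by rewrite RintegralZl.
have e2 : sqmod c * N2 g = Rintegral mu setT (fun x => sqmod c * (sqmod \o g) x).
  by rewrite RintegralZl.
have i1 : ig setT (fun x => 2 * cRe (c^* * (f x * (g x)^*))) by exact: igZ.
have i2 : ig setT (fun x => sqmod c * (sqmod \o g) x) by exact: igZ.
have i3 : ig setT (fun x => (sqmod \o f) x - 2 * cRe (c^* * (f x * (g x)^*))) by exact: igB.
rewrite e1 e2 /N2 -RintegralB// -RintegralD//.
by apply: eq_Rintegral => x _ /=; rewrite sqmodD_expand.
Qed.

(** * Density of a subspace from triviality of its annihilator *)

Section Projection.
Variable V : (R -> C) -> Prop.
Hypotheses (VL : forall v, V v -> L2 v) (V0 : V (fun=> 0))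
  (VD : forall v w, V v -> V w -> V (fun x => v x + w x))
  (VZ : forall c v, V v -> V (fun x => c * v x)).

(** The projection argument for a subspace that need not be closed: a minimising sequence is Cauchy
    by the parallelogram identity, its limit [l] leaves [h - l] orthogonal to [V], and the
    hypothesis, phrased for the bilinear pairing, is applied to [conj (h - l)]. *)
Lemma dense_of_orthogonal :
  (forall g, L2 g -> (forall v, V v -> cint setT (fun x => v x * g x) = 0) ->
     Defs.ae_eq g (fun=> 0)) ->
  forall h, L2 h -> forall eps : R, 0 < eps -> exists v, V v /\ N2 (fun x => h x - v x) < eps.
Proof.
move=> orth h Lh eps eps0.
pose S := [set N2 (fun x => h x - v x) | v in V].
have hS : has_inf S.
  split; first by exists (N2 (fun x => h x - 0)), (fun=> 0).
  by exists 0 => _ [v _ <-]; exact: N2_ge0.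
set m := inf S.
have mle v : V v -> m <= N2 (fun x => h x - v x).
  by move=> Vv; apply: ge_inf; [exact: hS.2|exists v].
(* The parallelogram identity bounds the increments by [2 dl n + 2 dl (n + 1) <= 4 dl n = 8^-n], the
   rate that [L2_complete] expects. *)
pose dl n : R := (8 ^+ n)^-1 / 4.
have dl0 n : 0 < dl n by rewrite divr_gt0// invr_gt0 exprn_gt0.
have [v hv] : {v : nat -> R -> C & forall n, V (v n) /\ N2 (fun x => h x - v n x) < m + dl n}.
  apply: (@choice _ _ (fun n v => V v /\ N2 (fun x => h x - v x) < m + dl n)) => n.
  by have [_ [v Vv <-] lt] := inf_adherent (dl0 n) hS; exists v.
have Vv n : V (v n) := (hv n).1.
have Lv n : L2 (v n) := VL (Vv n).
have Lhv n : L2 (fun x => h x - v n x) by exact: L2B.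
have step n : N2 (fun x => v n.+1 x - v n x) <= (8 ^+ n)^-1.
  pose w x := 2^-1 * (v n x + v n.+1 x).
  have Vw : V w by apply: VZ; exact: VD.
  have Lhw : L2 (fun x => h x - w x) by apply: L2B => //; exact: VL.
  have Ldv : L2 (fun x => v n.+1 x - v n x) by exact: L2B.
  have par : N2 (fun x => v n.+1 x - v n x) + 4 * N2 (fun x => h x - w x) =
      2 * N2 (fun x => h x - v n x) + 2 * N2 (fun x => h x - v n.+1 x).
    have e k : L2 k -> forall c : R, c * N2 k = Rintegral mu setT (fun x => c * (sqmod \o k) x).
      by move=> Lk c; rewrite RintegralZl//; exact: L2_ig.
    have i k : L2 k -> forall c : R, ig setT (fun x => c * (sqmod \o k) x).
      by move=> Lk c; apply: igZ => //; exact: L2_ig.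
    rewrite -(mul1r (N2 (fun x => v n.+1 x - v n x))) !e// -RintegralD//; [|exact: i|exact: i].
    rewrite -RintegralD//; [|exact: i|exact: i].
    apply: eq_Rintegral => x _ /=; rewrite /w.
    move: (h x) (v n x) (v n.+1 x) => [a a'] [b b'] [c c'].
    by rewrite /sqmod /=; field.
  have := mle w Vw; have := (hv n).2; have := (hv n.+1).2.
  have : dl n.+1 <= dl n.
    rewrite /dl ler_pM2r ?invr_gt0// lef_pV2 ?posrE ?exprn_gt0//.
    by rewrite exprS ler_peMl ?exprn_ge0// ler1n.
  have : dl n * 4 = (8 ^+ n)^-1 by rewrite /dl divfK.
  move: par; move: (N2 _) (N2 _) (N2 _) (N2 _) (dl n) (dl n.+1) => a b c d e e'.
  by move=> p <-; lra.
have [l [Ll [B hB]]] := L2_complete Lv step.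
have B0 : 0 <= B by have := le_trans (N2_ge0 _) (hB 0%N); rewrite expr0 divr1.
have Lhl : L2 (fun x => h x - l x) by exact: L2B.
have ip_small n w : V w -> sqmod (cint setT (fun x => (h x - v n x) * (w x)^*)) <= dl n * (1 + N2 w).
  move=> Vw; set ip := cint _ _.
  have Lw := VL Vw; have Nw := N2_ge0 w.
  (* [v n + t ip w] competes with the infimum. The optimal step would be [1 / N2 w]; adding 1 to the
     denominator keeps it meaningful when [N2 w = 0]. *)
  pose t : R := (1 + N2 w)^-1.
  have t0 : 0 < t by rewrite invr_gt0 ltr_pwDl.
  have tN : t * (1 + N2 w) = 1 by rewrite mulVf// gt_eqF// ltr_pwDl.
  pose c := t%:C * ip.
  have Vn : V (fun x => v n x + c * w x) by apply: VD => //; exact: VZ.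
  have := mle _ Vn.
  have -> : (fun x => h x - (v n x + c * w x)) = (fun x => (h x - v n x) - c * w x).
    by apply/funext => x; rewrite opprD addrA.
  rewrite (N2_expand _ (Lhv n) Lw) -/ip.
  have -> : cRe (c^* * ip) = t * sqmod ip.
    by rewrite /c /sqmod !cReImE; ring.
  have -> : sqmod c = t ^+ 2 * sqmod ip.
    by rewrite /c sqmodM /sqmod !cReImE; ring.
  have := (hv n).2; have s0 := sqmod_ge0 ip.
  move: (N2 (fun x => h x - v n x)) => q h1 h2.
  have h3 : t * sqmod ip <= dl n.
    have : t ^+ 2 * sqmod ip * N2 w <= t * sqmod ip.
      have -> : t ^+ 2 * sqmod ip * N2 w = t * sqmod ip * (t * N2 w) by ring.
      rewrite ler_piMr ?mulr_ge0 ?(ltW t0)//.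
      by move: tN; rewrite mulrDr mulr1 => <-; rewrite lerDr ltW.
    lra.
  have -> : sqmod ip = t * sqmod ip * (1 + N2 w) by rewrite mulrAC tN mul1r.
  by rewrite ler_wpM2r// addr_ge0.
have ip0 w : V w -> cint setT (fun x => (h x - l x) * (w x)^*) = 0.
  move=> Vw; have Lw := VL Vw; have Nw := N2_ge0 w.
  set ip := cint _ _; apply: sqmod_eq0.
  apply: (@geo_small _ (2 * (1 + N2 w) + 8 * B * N2 w)) => [|n]; first exact: sqmod_ge0.
  have -> : ip = cint setT (fun x => (h x - v n x) * (w x)^*) -
      cint setT (fun x => (l x - v n x) * (w x)^*).
    rewrite -cintB//; [|exact: L2M (L2J Lw)|exact: L2M (L2B Ll (Lv n)) (L2J Lw)].
    by apply: eq_cint => x _; ring.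
  apply: (le_trans (sqmodB_le _ _)).
  have c1 := ip_small n w Vw.
  have Llv : L2 (fun x => l x - v n x) by exact: L2B.
  have c2 := cauchy_schwarz measurableT (L2_on measurableT Llv) (L2_on measurableT (L2J Lw)).
  have c3 := le_trans (sqmod_n1 _) c2.
  have e1 : Rintegral mu setT (sqmod \o (fun x => (w x)^*)) = N2 w by exact: N2J.
  have e2 : Rintegral mu setT (sqmod \o (fun x => l x - v n x)) = N2 (fun x => l x - v n x) by [].
  rewrite e1 e2 in c3.
  have p2 : (4 ^+ n)^-1 <= ((2 : R) ^+ n)^-1.
    by rewrite lef_pV2 ?posrE ?exprn_gt0// lerXn2r ?nnegrE// ler_nat.
  have p3 : dl n <= ((2 : R) ^+ n)^-1.
    apply: (@le_trans _ _ (8 ^+ n)^-1); first by rewrite ler_pdivrMr// ler_peMr ?invr_ge0 ?exprn_ge0// ler1n.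
    by rewrite lef_pV2 ?posrE ?exprn_gt0// lerXn2r ?nnegrE// ler_nat.
  have c4 : N2 (fun x => l x - v n x) <= B * ((2 : R) ^+ n)^-1.
    by apply: (le_trans (hB n)); rewrite ler_wpM2l.
  have c5 : dl n * (1 + N2 w) <= ((2 : R) ^+ n)^-1 * (1 + N2 w) by rewrite ler_wpM2r// addr_ge0.
  have c6 : 4 * N2 (fun x => l x - v n x) * N2 w <= 4 * (B * ((2 : R) ^+ n)^-1) * N2 w.
    by rewrite ler_wpM2r// ler_pM2l.
  move: c1 c3 c5 c6; move: (sqmod _) (sqmod _) (N2 (fun x => l x - v n x)) => a b c.
  move: (2 ^+ n)^-1 (N2 w) (dl n) => t q e.
  lra.
have gz : Defs.ae_eq (fun x => (h x - l x)^*) (fun=> 0).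
  apply: orth; first exact: L2J.
  move=> w Vw; have := congr1 (fun z : C => z^*) (ip0 w Vw); rewrite -cintJ//; last exact: L2M (L2J (VL Vw)).
  rewrite rmorph0 => <-; apply: eq_cint => x _.
  by rewrite mulrC -{1}(conjCK (w x)) -rmorphM.
have N0 : N2 (fun x => h x - l x) = 0.
  by rewrite -N2J; apply: N2_ae0 => //; apply: cmeasJ; exact: L2_meas.
have [n hn] : exists n, 2 * B / 4 ^+ n < eps.
  apply: contrapT => nex.
  have : eps / 2 = 0.
    apply: (@geo_small _ (2 * B)) => [|n]; first by rewrite divr_ge0// ltW.
    have : eps <= 2 * B / 4 ^+ n by rewrite leNgt; apply/negP => lt; apply: nex; exists n.
    move=> le; apply: (@le_trans _ _ eps); first by rewrite ler_pdivrMr// mulr_natr mulr2n lerDl ltW.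
    apply: (le_trans le); rewrite ler_wpM2l ?mulr_ge0//.
    by rewrite lef_pV2 ?posrE ?exprn_gt0// lerXn2r ?nnegrE// ler_nat.
  by move/eqP; rewrite mulf_eq0 invr_eq0 gt_eqF//= pnatr_eq0.
exists (v n); split => //; apply: le_lt_trans hn.
have -> : (fun x => h x - v n x) = (fun x => (h x - l x) + (l x - v n x)).
  by apply/funext => x; rewrite addrA subrK.
apply: (le_trans (N2D_le Lhl (L2B Ll (Lv n)))).
by rewrite N0 mulr0 add0r -mulrA ler_pM2l.
Qed.

End Projection.
End Completeness.

(** * Density and the spectrum *)

Section Vanishing.
Context {R : realType}.
Local Notation C := (R[i]).
Local Notation mu := (@lebesgue_measure R).
Local Notation ig D h := (mu.-integrable D (EFin \o (h : R -> R))).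

(** Truncation to [[-n, n]] makes [f] integrable on rays; its primitive there is identically 0, and
    Lebesgue differentiation recovers [f] a.e. *)
Lemma ae_eq0_of_RI (f : R -> R) : (forall a b, ig (itv a b) f) ->
  (forall a b, a <= b -> Rintegral mu (itv a b) f = 0) -> {ae mu, forall x, f x = 0}.
Proof.
move=> fi f0.
pose fn (n : nat) := f \_ (itv (- n%:R) n%:R).
have ifn n : ig setT (fn n).
  have /integrable_mkcond := fi (- n%:R) n%:R.
  by rewrite restrict_EFin; apply; exact: meas_itv.
have Fn0 n x : Rintegral mu `]-oo, x] (fn n) = 0.
  rewrite /fn -Rintegral_mkcondr.
  have -> : `]-oo, x]%classic `&` itv (- n%:R) n%:R = itv (- n%:R) (Num.min x n%:R).
    apply/seteqP; split => t /=; rewrite /itv /= in_itv/= le_min.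
      by move=> [-> /andP[-> ->]].
    by move=> /andP[-> /andP[-> ->]].
  have [h|h] := leP (- n%:R) (Num.min x n%:R); first exact: f0.
  rewrite (_ : itv _ _ = set0) ?Rintegral_set0//.
  by apply/seteqP; split => t //=; rewrite /itv /= => /andP[a b]; move: h; rewrite ltNge (le_trans a b).
have aen n : {ae mu, forall x, fn n x = 0}.
  have loc : locally_integrable setT (fn n).
    split; [by have /integrableP[/measurable_EFinP] := ifn n|exact: openT|].
    move=> K _ cK.
    have : mu.-integrable K (EFin \o fn n).
      by apply: integrableS (ifn n) => //; exact: compact_measurable.
    by move=> /integrableP[_].
  have iy y : mu.-integrable `]-oo, y]%classic (EFin \o fn n).
    by apply: integrableS (ifn n).
  have := FTC1Ny iy loc; apply: ae_imp => x [_ <-].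
  rewrite (_ : (fun x0 => _) = cst 0) ?derive1_cst//.
  by apply/funext => t; exact: Fn0.
have : {ae mu, forall x, forall n, fn n x = 0} by exact: ae_foralln.
apply: ae_imp => x h; pose n := (Num.truncn `|x|).+1.
have : itv (- n%:R) n%:R x by rewrite /itv /= -ler_norml ltW// truncnS_gt.
by have := h n; rewrite /fn patchE => e xn; rewrite mem_set in e.
Qed.

Lemma ACd_cst_ae (c : C) (y g : R -> C) : ACd y g -> (forall x, y x = c) ->
  Defs.ae_eq g (fun=> 0).
Proof.
move=> ay y0.
have h a b : a <= b -> cint (itv a b) g = 0 by move=> ab; rewrite -(ay.2 a b ab) !y0 subrr.
have Lg := ACd_L1loc ay.
have r0 : {ae mu, forall x, cRe (g x) = 0}.
  apply: ae_eq0_of_RI => [a b|a b /h /(congr1 (@cRe R))] //.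
  by case: (L1loc_cig a b Lg).
have i0 : {ae mu, forall x, cIm (g x) = 0}.
  apply: ae_eq0_of_RI => [a b|a b /h /(congr1 (@cIm R))] //.
  by case: (L1loc_cig a b Lg).
by apply: ae_imp (ae_and r0 i0) => x []; case: (g x) => a b /= -> ->.
Qed.

Lemma continuous_ae0 (f : R -> R) : continuous f -> {ae mu, forall x, f x = 0} ->
  forall x, f x = 0.
Proof.
move=> cf [N [mN N0 sN]] x; apply: contrapT => /eqP fx.
have [e /= e0 he] : exists2 e : R, 0 < e & forall t, `|x - t| < e -> f t != 0.
  have nb : nbhs (f x) [set z | z != 0].
    by apply: open_nbhs_nbhs; split => //; exact: open_neq.
  by have /nbhs_ballP[e e0 he] := cf x _ nb; exists e.
have sub : itv x (x + e / 2) `<=` N.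
  move=> t /andP[a b]; apply: sN => /= ft; have := he t; rewrite ft eqxx => /(_ _)/negP; apply => //.
  rewrite distrC ger0_norm ?subr_ge0//; lra.
have : (mu (itv x (x + e / 2)) <= mu N)%E by apply: le_measure; rewrite ?inE//; exact: meas_itv.
by rewrite N0 mu_itv ltrDl divr_gt0// addrAC subrr add0r lee_fin leNgt divr_gt0.
Qed.

Lemma ACd_ae0 (y g : R -> C) : ACd y g -> Defs.ae_eq y (fun=> 0) -> forall x, y x = 0.
Proof.
move=> ay y0 x.
have r0 := continuous_ae0 (ACd_cRe ay) (ae_imp (fun t (h : y t = 0) => congr1 (@cRe R) h) y0) x.
have i0 := continuous_ae0 (ACd_cIm ay) (ae_imp (fun t (h : y t = 0) => congr1 (@cIm R) h) y0) x.
by move: r0 i0 => /=; case: (y x) => a b /= -> ->.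
Qed.

(** The continuous representative of [y] vanishes everywhere, so its derivative, which is now [u],
    vanishes a.e. and by continuity everywhere; then the derivative of [u], which is now [- g],
    vanishes a.e. *)
Lemma graphL0_ae (Cc : C) (Q g : R -> C) : L2loc Q -> graphL Cc Q (fun=> 0) g ->
  Defs.ae_eq g (fun=> 0).
Proof.
move=> LQ gr; have [yt [u [e1 [a1 a2] _ _ _]]] := graph_isol LQ gr.
have y0 := ACd_ae0 a1 (ae_eq_sym e1).
have u0 : forall x, u x = 0.
  by apply: (ACd_ae0 a2); apply: ae_imp (ACd_cst_ae a1 y0) => x <-; rewrite y0 mulr0 add0r.
apply: ae_imp (ACd_cst_ae a2 u0) => x.
by rewrite y0 u0 !mulr0 subrr sub0r => /eqP; rewrite oppr_eq0 => /eqP.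
Qed.

End Vanishing.

(** * Dense domain, dense range and the Lyapunov criterion *)

Section Spectrum.
Context {R : realType}.
Local Notation C := (R[i]).
Local Notation "x %:C" := (real_complex R x).
Variables (Cc : C) (Q : R -> C).
Hypotheses (Qpi : forall x : R, Q (x + pi) = Q x) (LQ : L2loc Q).

Lemma l2norm_lt (f : R -> C) (e : R) : 0 < e -> N2 f < e ^+ 2 -> l2norm f < e.
Proof.
move=> e0; rewrite -l2norm_sqr; have : 0 <= l2norm f by exact: sqrtr_ge0.
by move=> f0; rewrite ltr_pXn2r// nnegrE ltW.
Qed.

Lemma graphL00 : graphL Cc Q (fun=> 0) (fun=> 0).
Proof.
have [lam [M0 [_ hM]]] := solvable_exists Cc Qpi LQ.
have [y [f [g _ _]]] := hM (fun=> 0) (@L2_0 R).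
have -> : (fun=> 0 : C) = (fun x : R => 0 * y x) by apply/funext => x; rewrite mul0r.
have e : (fun x : R => 0 * f x) = (fun x : R => 0 * y x).
  by apply/funext => x; rewrite !mul0r.
by rewrite -{2}e; exact: graphLZ.
Qed.

(** Annihilating the range puts [(conj g, conj (lam g))] in the graph of the adjoint, which is the
    conjugate of the graph of [L(v)]. *)
Lemma orthogonal_range lam (g : R -> C) : L2 g ->
  (forall y f, graphL Cc Q y f -> cint setT (fun x => (f x - lam * y x) * g x) = 0) ->
  graphL Cc Q g (fun x => lam * g x).
Proof.
move=> Lg orth; have Llg := L2Z lam Lg.
suff : graphL Cc Q (fun x => ((g x)^*)^*) (fun x => ((lam * g x)^*)^*).
  by rewrite (conj_funK g) (conj_funK (fun x => lam * g x)).
apply/graphLJ_iff => //; apply/(adjgraphLE Cc Qpi LQ); split; first exact: L2J.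
split; first exact: L2J.
move=> y f gr; have [Ly Lf] := graphL_L2 gr; have := orth y f gr; rewrite /l2inner.
under eq_cint do rewrite mulrBl.
rewrite cintB//; [|exact: L2M|exact: L2M (L2Z _ Ly) Lg].
move=> /eqP; rewrite subr_eq0 => /eqP e.
under eq_cint do rewrite conjCK.
by rewrite e; apply: eq_cint => x _; rewrite !conjCK; ring.
Qed.

Lemma domL_dense (h : R -> C) : L2 h -> forall eps : R, 0 < eps ->
  exists y, domL Cc Q y /\ l2norm (fun x => h x - y x) < eps.
Proof.
move=> Lh eps eps0.
have [y [dy lt]] : exists y, domL Cc Q y /\ N2 (fun x => h x - y x) < eps ^+ 2.
  apply: dense_of_orthogonal => //.
  - by move=> y [f /graphL_L2[]].
  - by exists (fun=> 0); exact: graphL00.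
  - by move=> y z [f gf] [k gk]; exists (fun x => f x + k x); exact: graphLD.
  - by move=> c y [f gf]; exists (fun x => c * f x); exact: graphLZ.
  (* Annihilating the domain puts [(0, conj g)] in the graph of the adjoint. *)
  - move=> g Lg orth; apply: (graphL0_ae LQ).
    suff : graphL Cc Q (fun x => ((fun=> 0 : C) x)^*) (fun x => ((g x)^*)^*).
      by rewrite (conj_funK g); congr (graphL _ _ _ _); apply/funext => x; rewrite rmorph0.
    apply/graphLJ_iff => //; apply/(adjgraphLE Cc Qpi LQ); split; first exact: L2_0.
    split; first exact: L2J.
    move=> y f gr; rewrite /l2inner.
    have -> : cint setT (fun x => y x * ((g x)^*)^*) = 0.
      rewrite -(orth y); last by exists f.
      by apply: eq_cint => x _; rewrite conjCK.
    by apply: cint0 => x _; rewrite rmorph0 mulr0.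
  - by rewrite exprn_gt0.
by exists y; split => //; exact: l2norm_lt.
Qed.

Lemma range_dense lam (h : R -> C) : L2 h -> forall eps : R, 0 < eps -> exists y f,
  graphL Cc Q y f /\ l2norm (fun x => f x - lam * y x - h x) < eps.
Proof.
move=> Lh eps eps0.
pose V v := exists y f, graphL Cc Q y f /\ v = (fun x : R => f x - lam * y x).
have [v [[y [f [g ->]]] lt]] : exists v, V v /\ N2 (fun x => h x - v x) < eps ^+ 2.
  apply: dense_of_orthogonal => //.
  - move=> v [y [f [/graphL_L2[Ly Lf] ->]]]; apply: L2B => //; exact: L2Z.
  - exists (fun=> 0), (fun=> 0); split; first exact: graphL00.
    by apply/funext => x; rewrite mulr0 subrr.
  - move=> v w [y [f [gf ->]]] [z [k [gk ->]]].
    exists (fun x => y x + z x), (fun x => f x + k x); split; first exact: graphLD.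
    by apply/funext => x; ring.
  - move=> c v [y [f [gf ->]]].
    exists (fun x => c * y x), (fun x => c * f x); split; first exact: graphLZ.
    by apply/funext => x; ring.
  - move=> g Lg orth; apply: (graphL_injective Qpi LQ (lam := lam)).
      by apply: orthogonal_range => // y f gr; apply: orth; exists y, f.
    by apply: ae_all => x; rewrite subrr.
  - by rewrite exprn_gt0.
exists y, f; split => //; apply: l2norm_lt => //.
by rewrite N2BC.
Qed.

Lemma spectrumLE lam : spectrumL Cc Q lam <->
  exists theta : R, 0 <= theta < 2 * pi /\ Lyapunov Cc Q lam = (2 * cos theta)%:C.
Proof.
have [f1 [v1 [s1 e1 e2]]] := hsol_exists (Cc - lam) 1 0 LQ.
have [f2 [v2 [s2 e3 e4]]] := hsol_exists (Cc - lam) 0 1 LQ.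
rewrite (LyapunovE LQ s1 s2 e1 e2 e3 e4).
have [r [r0 rD r1]] := multiplier_le1 (f1 pi + v2 pi).
split => [sp|[theta [_ ct]]].
- have ru : sqmod r = 1.
    apply/eqP; rewrite eq_le r1 leNgt; apply/negP => lt; apply: sp.
    by apply: (solvable_resolvent Qpi LQ); exact: (hyperbolic_solvable Qpi LQ s1 s2 e1 e2 e3 e4 r0 rD lt).
  by have [theta [th e]] := unimodular_cos ru; exists theta; rewrite -rD.
- have ru : sqmod r = 1 by apply: (cos_unimodular r0 (theta := theta)); rewrite rD.
  exact: (unimodular_not_surjective Qpi LQ s1 s2 e1 e2 e3 e4 ru rD).
Qed.

End Spectrum.

Theorem theorem4 (R : realType) (Cc : R[i]) (Q : R -> R[i]) :
  (forall x : R, Q (x + pi) = Q x) ->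
  L2loc Q ->
  cint (itv 0 pi) Q = 0 ->
  [/\ (* (a) D(L(v)) is dense in L^2(R) *)
      (forall h : R -> R[i], L2 h -> forall eps : R, 0 < eps ->
         exists y, domL Cc Q y /\ l2norm (fun x => h x - y x) < eps),
      (* (b) L(v) is closed and L(v)^* = L(conj v) *)
      closedL Cc Q /\
      (forall z w : R -> R[i], adjgraphL Cc Q z w <->
         graphL (Cc^*) (fun x => (Q x)^*) z w),
      (* (c) the spectrum is continuous ... *)
      (forall lam : R[i], spectrumL Cc Q lam -> cont_spectrumL Cc Q lam) &
      (* ... and is described by the Lyapunov function *)
      (forall lam : R[i], spectrumL Cc Q lam <->
         exists theta : R, 0 <= theta < 2 * pi /\
           Lyapunov Cc Q lam = ((2 * cos theta)%:C)%C)].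
Proof.
move=> Qpi LQ _; split.
- exact: domL_dense.
- by split; [exact: closedLE|exact: adjgraphLE].
- move=> lam sp; split => //; first by move=> y f; exact: graphL_injective.
  exact: range_dense.
- exact: spectrumLE.
Qed.
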